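(* Let $\sigma\in\,]-\tfrac32,\tfrac12[$, $\sigma\ne-\tfrac12$. There exists a constant $C$ such that for every $(\lambda,\zeta)\in\mathbb{S}\times(\mathbb{Z}^2\setminus\{0\})$, $\zeta=(\xi,\eta)$, the operator $$\mathcal{L}:(H^{\sigma+2}_\zeta)^2_{\mathrm{div}}\times\mathbb{C}\times H^{\sigma+2}_\zeta\to(H^\sigma_\zeta)^3,\quad (u,v,p_0,\theta)\mapsto\begin{bmatrix}(\omega^2-\nu\partial_{zz})u+i\xi p_0-\alpha v+i\xi\beta\int_0^z\theta\\(\omega^2-\nu\partial_{zz})v+i\eta p_0+\alpha u+i\eta\beta\int_0^z\theta\\(\omega^2-\nu\partial_{zz})\theta-\gamma\int_0^z(i\xi u+i\eta v)\end{bmatrix}=F$$ is continuous and bijective, and $Y=(u,v)$ splits as $Y=Y_1+Y_2$ with $$\begin{aligned} &(a)\ |\zeta|\,|p_0|\le C\langle\omega\rangle^2M_\sigma\|F\|_{\sigma,\zeta},\\ &(b)\ \frac{M_{-\sigma-2}}{M_{-\sigma}}\|Y_1\|_{\sigma,\zeta}+\|Y_1\|_{\sigma+2,\zeta}\le C\langle\omega\rangle^2M_\sigma M_{-\sigma-2}\|F\|_{\sigma,\zeta},\\ &(c)\ \langle\omega\rangle^2\|Y_2\|_{\sigma,\zeta}+\|Y_2\|_{\sigma+2,\zeta}\le C\|F\|_{\sigma,\zeta},\\ &(d)\ \langle\omega\rangle^2\|\theta\|_{\sigma,\zeta}+\|\theta\|_{\sigma+2,\zeta}\le C\|F\|_{\sigma,\zeta},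 \end{aligned}$$ where $\int_0^z g$ denotes $z\mapsto\int_0^zg(z')dz'$ and $M_\sigma,M_{-\sigma},M_{-\sigma-2}$ are evaluated at $(\lambda,\zeta)$.
   Context: Fix $a>0$, $\nu>0$, $\alpha\in\mathbb{R}$, $\beta,\gamma>0$, $\Omega=\mathbb{T}^2\times(0,a)$, $\mathbb{T}^2=(\mathbb{R}/2\pi\mathbb{Z})^2$. Let $e_k(z)=\sqrt{2/a}\sin(k\pi z/a)$, $k\in\mathbb{N}^*$. For $\zeta\in\mathbb{Z}^2$, $s\in\mathbb{R}$, $H^s_\zeta$ is the Hilbert space of series $f=\sum_{k\ge1}f_ke_k(z)$ on $(0,a)$ with norm $\|f\|_{s,\zeta}^2=\sum_k(1+\nu k^2+\nu|\zeta|^2)^s|f_k|^2<\infty$; for vectors the norm is the $\ell^2$ combination of component norms. $(H^{s}_\zeta)^2_{\mathrm{div}}=\{(u,v)\in(H^s_\zeta)^2:\int_0^a(\xi u+\eta v)\,dz=0\}$. Spectral set: let $\mathcal{V}=\mathcal{V}_1\times\mathcal{V}_2$, where $\mathcal{V}_1$ is the closure in $H^1(\Omega)^2$ of smooth $(u,v)$ periodic in $x,y$, vanishing at $z=0,a$, with $\int_0^a(\partial_xu+\partial_yv)dz=0$, and $\mathcal{V}_2$ the closure in $H^1(\Omega)$ of smooth $\theta$ periodic in $x,y$ vanishing at $z=0,a$. For $X=(u,v,\theta),X'=(u',v',\theta')\in\mathcal{V}$ put $(X,X')_{\mathcal{H}}=\int_\Omega(u\bar u'+v\bar v'+\frac\beta\gamma\theta\bar\theta')$,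 $(X,X')_{\mathcal{V}}=\int_\Omega(\nabla u\cdot\nabla\bar u'+\nabla v\cdot\nabla\bar v'+\frac\beta\gamma\nabla\theta\cdot\nabla\bar\theta')$, $w=-\int_0^z(\partial_xu+\partial_yv)$, $w'=-\int_0^z(\partial_xu'+\partial_yv')$, $B(X,X')=-\int_\Omega\theta\bar w'+\int_\Omega w\bar\theta'$, $C(X,X')=-\int_\Omega v\bar u'+\int_\Omega u\bar v'$, and $\langle PX,X'\rangle=\nu(X,X')_{\mathcal{V}}+\beta B(X,X')+\alpha C(X,X')$. $\mathbb{V}_P=\{\lambda\in\mathbb{C}:\exists X\in\mathcal{V}\setminus\{0\},\ \lambda(X,X')_{\mathcal{H}}+\langle PX,X'\rangle=0\ \forall X'\in\mathcal{V}\}$. Then $\mathbb{S}=\{-\delta_2-\mu_1+i\mu_2:(\mu_1,\mu_2)\in\mathbb{R}^2,\ |\mu_2|\ge\mu_1/\delta_1\}$, where $\delta_1>0$ is small enough that $\mathbb{S}\cap\mathbb{V}_P=\emptyset$ and $\delta_2<\min(\frac{\nu\pi^2}{2a^2},\frac\nu2)$. Parameters: $\omega^2=\lambda+\nu|\zeta|^2$, $\langle\zeta\rangle=1+|\zeta|$, $\langle\omega\rangle^2=|\lambda|+\langle\zeta\rangle^2$, and $M_s(\lambda,\zeta)=\big(\sum_{k\ge1}\frac{1}{k^2(k^4+\langle\omega\rangle^4)(k^2+\langle\zeta\rangle^2)^s}\big)^{1/2}$. *)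

(* Defs.v *)
From Stdlib Require Import Reals ZArith.
From Coquelicot Require Import Coquelicot.
Open Scope R_scope.

Definition ek (a : R) (k : nat) (z : R) : R :=
  sqrt (2 / a) * sin (INR k * PI * z / a).

(* Sequences f : nat -> C represent sine series: f n is the coefficient of
   e_(n+1), i.e. f_k with k = n+1. *)
Definition kk (n : nat) : R := INR (S n).

Definition Cseries (f : nat -> C) : C :=
  (Series (fun n => Re (f n)), Series (fun n => Im (f n))).

(* sine coefficient of the constant function 1: int_0^a e_k *)
Definition one_coef (a : R) (n : nat) : R := RInt (fun z => ek a (S n) z) 0 a.

(* j-th sine coefficient of z |-> int_0^z e_k :
   int_0^a (int_0^z e_k(z') dz') e_j(z) dz *)
Definition cc (a : R) (j n : nat) : R :=
  RInt (fun z => RInt (fun t => ek a (S n) t) 0 z * ek a (S j) z) 0 a.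

(* sine coefficients of z |-> int_0^z g, for g = sum_k g_k e_k *)
Definition Iz (a : R) (g : nat -> C) (j : nat) : C :=
  Cseries (fun n => (g n * RtoC (cc a j n))%C).

Definition zabs (zeta : Z * Z) : R :=
  sqrt (IZR (fst zeta) ^ 2 + IZR (snd zeta) ^ 2).

Definition wgt (nu s : R) (zeta : Z * Z) (n : nat) : R :=
  Rpower (1 + nu * kk n ^ 2 + nu * zabs zeta ^ 2) s.

Definition inH (nu s : R) (zeta : Z * Z) (f : nat -> C) : Prop :=
  ex_series (fun n => wgt nu s zeta n * Cmod (f n) ^ 2).

Definition normH (nu s : R) (zeta : Z * Z) (f : nat -> C) : R :=
  sqrt (Series (fun n => wgt nu s zeta n * Cmod (f n) ^ 2)).

(* (H^s_zeta)^2_div : int_0^a (xi u + eta v) dz = 0 *)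
Definition inHdiv (a nu s : R) (zeta : Z * Z) (u v : nat -> C) : Prop :=
  inH nu s zeta u /\ inH nu s zeta v /\
  Cseries (fun n => ((RtoC (IZR (fst zeta)) * u n + RtoC (IZR (snd zeta)) * v n)
                     * RtoC (one_coef a n))%C) = 0%C.

Definition norm2 (nu s : R) (zeta : Z * Z) (u v : nat -> C) : R :=
  sqrt (normH nu s zeta u ^ 2 + normH nu s zeta v ^ 2).

Definition norm3 (nu s : R) (zeta : Z * Z) (f1 f2 f3 : nat -> C) : R :=
  sqrt (normH nu s zeta f1 ^ 2 + normH nu s zeta f2 ^ 2 + normH nu s zeta f3 ^ 2).

Definition omega2 (nu : R) (lam : C) (zeta : Z * Z) : C :=
  (lam + RtoC (nu * zabs zeta ^ 2))%C.
Definition bzeta (zeta : Z * Z) : R := 1 + zabs zeta.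
Definition bomega2 (lam : C) (zeta : Z * Z) : R := Cmod lam + bzeta zeta ^ 2.

Definition Ms (s : R) (lam : C) (zeta : Z * Z) : R :=
  sqrt (Series (fun n =>
    / (kk n ^ 2 * (kk n ^ 4 + bomega2 lam zeta ^ 2)
       * Rpower (kk n ^ 2 + bzeta zeta ^ 2) s))).

(* (omega^2 - nu d_zz) acts on e_k as multiplication by omega^2 + nu (k pi/a)^2 *)
Definition symb (a nu : R) (lam : C) (zeta : Z * Z) (n : nat) : C :=
  (omega2 nu lam zeta + RtoC (nu * (kk n * PI / a) ^ 2))%C.

Definition L1 (a nu alpha beta : R) (lam : C) (zeta : Z * Z)
  (u v : nat -> C) (p0 : C) (th : nat -> C) (n : nat) : C :=
  (symb a nu lam zeta n * u n
   + Ci * RtoC (IZR (fst zeta)) * p0 * RtoC (one_coef a n)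
   - RtoC alpha * v n
   + Ci * RtoC (IZR (fst zeta)) * RtoC beta * Iz a th n)%C.

Definition L2 (a nu alpha beta : R) (lam : C) (zeta : Z * Z)
  (u v : nat -> C) (p0 : C) (th : nat -> C) (n : nat) : C :=
  (symb a nu lam zeta n * v n
   + Ci * RtoC (IZR (snd zeta)) * p0 * RtoC (one_coef a n)
   + RtoC alpha * u n
   + Ci * RtoC (IZR (snd zeta)) * RtoC beta * Iz a th n)%C.

Definition L3 (a nu gamma : R) (lam : C) (zeta : Z * Z)
  (u v : nat -> C) (th : nat -> C) (n : nat) : C :=
  (symb a nu lam zeta n * th n
   - RtoC gamma * Iz a (fun m => Ci * RtoC (IZR (fst zeta)) * u m
                                 + Ci * RtoC (IZR (snd zeta)) * v m)%C n)%C.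

(* Functions on Omega = T^2 x (0,a) are represented by their coefficients on the
   orthogonal basis exp(i(xi x + eta y)) e_k(z), zeta = (xi,eta) in Z^2, k >= 1. *)
Definition field := Z -> Z -> nat -> C.

Definition boxsum (f : field) (N : nat) : C :=
  sum_n (fun i => sum_n (fun j => sum_n (fun n =>
     f (Z.of_nat i - Z.of_nat N)%Z (Z.of_nat j - Z.of_nat N)%Z n) N) (2 * N)) (2 * N).

Definition zabs2 (xi eta : Z) : R := IZR xi ^ 2 + IZR eta ^ 2.

(* membership in V = V1 x V2 : H^1 finiteness, vanishing at z = 0,a (sine basis),
   and int_0^a (d_x u + d_y v) dz = 0 for every (x,y), i.e. in each mode. *)
Definition inV (a : R) (U V Th : field) : Prop :=
  (exists B : R, forall N, Re (boxsum (fun xi eta n =>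
      RtoC ((1 + zabs2 xi eta + (kk n * PI / a) ^ 2)
            * (Cmod (U xi eta n) ^ 2 + Cmod (V xi eta n) ^ 2
               + Cmod (Th xi eta n) ^ 2))) N) <= B) /\
  (forall xi eta, Cseries (fun n =>
      ((RtoC (IZR xi) * U xi eta n + RtoC (IZR eta) * V xi eta n)
       * RtoC (one_coef a n))%C) = 0%C).

(* sine coefficients of w = - int_0^z (d_x u + d_y v), mode by mode *)
Definition Wc (a : R) (U V : field) (xi eta : Z) (j : nat) : C :=
  (- Iz a (fun n => Ci * RtoC (IZR xi) * U xi eta n
                    + Ci * RtoC (IZR eta) * V xi eta n)%C j)%C.

(* the mode-(zeta,k) contribution to
   lam (X,X')_H + nu (X,X')_V + beta B(X,X') + alpha C(X,X') *)
Definition VPterm (a nu alpha beta gamma : R) (lam : C)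
  (U V Th U' V' Th' : field) (xi eta : Z) (n : nat) : C :=
  let h := (U xi eta n * Cconj (U' xi eta n) + V xi eta n * Cconj (V' xi eta n)
            + RtoC (beta / gamma) * Th xi eta n * Cconj (Th' xi eta n))%C in
  (RtoC ((2 * PI) ^ 2) *
   (lam * h
    + RtoC (nu * (zabs2 xi eta + (kk n * PI / a) ^ 2)) * h
    + RtoC beta * (- (Th xi eta n * Cconj (Wc a U' V' xi eta n))
                   + Wc a U V xi eta n * Cconj (Th' xi eta n))
    + RtoC alpha * (- (V xi eta n * Cconj (U' xi eta n))
                    + U xi eta n * Cconj (V' xi eta n))))%C.

Definition VP (a nu alpha beta gamma : R) (lam : C) : Prop :=
  exists U V Th : field,
    inV a U V Th /\
    (exists xi eta n, U xi eta n <> 0%C \/ V xi eta n <> 0%C \/ Th xi eta n <> 0%C) /\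
    forall U' V' Th' : field, inV a U' V' Th' ->
      is_lim_seq (fun N => Cmod (boxsum
        (VPterm a nu alpha beta gamma lam U V Th U' V' Th') N)) 0.

Definition inS (delta1 delta2 : R) (lam : C) : Prop :=
  exists mu1 mu2 : R, lam = ((- delta2 - mu1)%R, mu2) /\ Rabs mu2 >= mu1 / delta1.

(* Main.v *)
(** The uncoupled system (alpha = beta = gamma = 0) is diagonal on the sine basis up to the pressure:
    u = (G - i xi p0 c) / symb, where c is the sequence of integrals of the e_k, and p0 is read off the
    divergence constraint. On the sector |symb| is comparable to k^2 + <omega>^2, and the values of symb
    stay in a half-plane off 0, so that |sum c_k^2 / symb_k| >= C / <omega>^2. The estimates (a)-(d), with
    the uncoupled right-hand side G in place of F, are then termwise, with Y1 the pressure part of Y.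

    It remains to bound G by F. Writing T G for the coupling terms evaluated at the uncoupled solution
    for G, one has to solve G + T G = F. Hilbert-Schmidt bounds for the primitive operator give
    ||T|| <= C <omega>^(-e) with e > 0, hence a Neumann series when <omega> is large. The remaining
    zeta are finitely many and the remaining lam form a compact set; there T is compact, a nonzero
    G with G + T G = 0 would put lam in V_P, and the Fredholm alternative together with stability of
    solvability under small changes of lam gives a uniform bound. *)

Require Import Defs.
From Stdlib Require Import Reals ZArith Lra Lia List FunctionalExtensionality ClassicalEpsilon Classical.
From Coquelicot Require Import Coquelicot.
Open Scope R_scope.

(** * Finite sums and weighted square-summability *)

(** The two ends of the range of sigma have different origins. The constant function 1, through
    which the pressure enters, has sine coefficients of order 1/k and lies in H^sigma only below
    1/2; primitives do not vanish at z = a and meet the same limit. The lower end comes from the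
    coupling: a primitive comes with a factor zeta, the pressure brings another, and what is left
    after paying them with powers of <omega> is the exponent [decay]. The delicate quantity is
    |zeta| <omega>^2 M_sigma times the norm of the primitive of the pressure profile. The powers of
    <zeta> cancel between its factors, which is why the bounds keep <zeta> and <omega> apart. Norms
    are avoided until the end: a bound on all partial sums contains convergence and estimate at
    once. The unknown is G rather than (u, v, p0, theta), because G lives in the same weighted l2
    space as F. Constants are uniform in lam and zeta, except in the Fredholm argument, which treats
    one pair (lam, zeta) at a time. *)

Fixpoint rsum (f : nat -> R) (N : nat) : R :=
  match N with O => 0 | S m => rsum f m + f m end.
Fixpoint csum (f : nat -> C) (N : nat) : C :=
  match N with O => 0%C | S m => (csum f m + f m)%C end.

Lemma rsum_ext f g N : (forall n, (n < N)%nat -> f n = g n) -> rsum f N = rsum g N.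
Proof. induction N; simpl; intros H; auto. rewrite IHN, H; auto. Qed.

Lemma rsum_le f g N : (forall n, (n < N)%nat -> f n <= g n) -> rsum f N <= rsum g N.
Proof.
  induction N; simpl; intros H; [lra|].
  apply Rplus_le_compat; auto.
Qed.

Lemma rsum_zero N : rsum (fun _ => 0) N = 0.
Proof. induction N; simpl; lra. Qed.

Lemma rsum_ge0 f N : (forall n, 0 <= f n) -> 0 <= rsum f N.
Proof.
  intros H. rewrite <- (rsum_zero N). apply rsum_le; auto.
Qed.

Lemma rsum_plus f g N : rsum (fun n => f n + g n) N = rsum f N + rsum g N.
Proof. induction N; simpl; lra. Qed.

Lemma rsum_scal c f N : rsum (fun n => c * f n) N = c * rsum f N.
Proof. induction N; simpl; [lra|]. rewrite IHN; ring. Qed.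

Lemma rsum_swap f N M :
  rsum (fun i => rsum (f i) M) N = rsum (fun j => rsum (fun i => f i j) N) M.
Proof.
  induction N; simpl; [symmetry; apply rsum_zero|].
  rewrite IHN, <- rsum_plus. reflexivity.
Qed.

Lemma rsum_mono f N M : (forall n, 0 <= f n) -> (N <= M)%nat -> rsum f N <= rsum f M.
Proof.
  intros H. induction 1; simpl; [lra|]. specialize (H m); lra.
Qed.

Lemma rsum_term f N p : (forall n, 0 <= f n) -> (p < N)%nat -> f p <= rsum f N.
Proof.
  intros H Hp. apply Rle_trans with (rsum f (S p)); [|apply rsum_mono; auto].
  simpl. generalize (rsum_ge0 f p H); lra.
Qed.

Lemma sum_n_rsum f N : sum_n f N = rsum f (S N).
Proof.
  induction N; [rewrite sum_O; simpl; lra|].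
  rewrite sum_Sn, IHN. reflexivity.
Qed.

Lemma sum_n_csum (f : nat -> C) N : sum_n f N = csum f (S N).
Proof.
  induction N; [rewrite sum_O; simpl; ring|].
  rewrite sum_Sn, IHN. reflexivity.
Qed.

(** Weighted Cauchy-Schwarz from AM-GM with multiplier b/a. Since A or B may be 0, it is done with A
    + e and B + e, and e is removed by contradiction. *)
Lemma rsum_CS (w x y : nat -> R) N A B : 0 <= A -> 0 <= B -> (forall n, 0 <= w n) ->
  rsum (fun n => w n * x n ^ 2) N <= A ^ 2 -> rsum (fun n => w n * y n ^ 2) N <= B ^ 2 ->
  rsum (fun n => w n * (x n * y n)) N <= A * B.
Proof.
  intros HA HB Hw Hx Hy.
  assert (K : forall e, 0 < e -> rsum (fun n => w n * (x n * y n)) N <= (A + e) * (B + e)).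
  { intros e He. set (a := A + e). set (b := B + e).
    assert (0 < a) by (unfold a; lra). assert (0 < b) by (unfold b; lra).
    apply Rle_trans with (rsum (fun n => (b / a / 2) * (w n * x n ^ 2) + (a / b / 2) * (w n * y n ^ 2)) N).
    - apply rsum_le; intros n _.
      replace (b / a / 2 * (w n * x n ^ 2) + a / b / 2 * (w n * y n ^ 2))
        with (w n * (x n * y n) + w n * ((b * x n - a * y n) ^ 2 / (2 * a * b))) by (field; lra).
      assert (0 <= w n * ((b * x n - a * y n) ^ 2 / (2 * a * b))); [|lra].
      apply Rmult_le_pos; auto. apply Rdiv_le_0_compat; [apply pow2_ge_0|nra].
    - rewrite rsum_plus, !rsum_scal.
      assert (A ^ 2 <= a ^ 2) by (unfold a; nra). assert (B ^ 2 <= b ^ 2) by (unfold b; nra).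
      assert (b / a / 2 * rsum (fun n => w n * x n ^ 2) N <= b / a / 2 * a ^ 2).
      { apply Rmult_le_compat_l; [|lra]. unfold Rdiv.
        apply Rmult_le_pos; [apply Rmult_le_pos|]; try lra. left; apply Rinv_0_lt_compat; lra. }
      assert (a / b / 2 * rsum (fun n => w n * y n ^ 2) N <= a / b / 2 * b ^ 2).
      { apply Rmult_le_compat_l; [|lra]. unfold Rdiv.
        apply Rmult_le_pos; [apply Rmult_le_pos|]; try lra. left; apply Rinv_0_lt_compat; lra. }
      replace (b / a / 2 * a ^ 2) with (a * b / 2) in H3 by (field; lra).
      replace (a / b / 2 * b ^ 2) with (a * b / 2) in H4 by (field; lra). lra. }
  apply Rnot_lt_le; intros Hlt.
  set (d := rsum (fun n => w n * (x n * y n)) N - A * B).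
  assert (0 < d) by (unfold d; lra).
  (* As e <= 1, this choice gives (A + e)(B + e) <= A B + e (A + B + 1) <= A B + d / 2. *)
  set (e := Rmin 1 (d / (2 * (A + B + 1)))).
  assert (He : 0 < e).
  { unfold e; apply Rmin_pos; [lra|]. apply Rdiv_lt_0_compat; lra. }
  assert (He1 : e <= 1) by apply Rmin_l.
  assert (He2 : e <= d / (2 * (A + B + 1))) by apply Rmin_r.
  assert (e * (A + B + 1) <= d / (2 * (A + B + 1)) * (A + B + 1)) by (apply Rmult_le_compat_r; lra).
  replace (d / (2 * (A + B + 1)) * (A + B + 1)) with (d / 2) in H0 by (field; lra).
  specialize (K e He). unfold d in *. nra.
Qed.

Lemma rsum_lim (u : nat -> nat -> R) (v : nat -> R) N :
  (forall n, is_lim_seq (fun m => u m n) (v n)) ->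
  is_lim_seq (fun m => rsum (u m) N) (rsum v N).
Proof.
  intros H. induction N; simpl; [apply is_lim_seq_const|].
  apply (is_lim_seq_plus' _ _ _ _ IHN (H N)).
Qed.

Lemma csum_ext f g N : (forall n, (n < N)%nat -> f n = g n) -> csum f N = csum g N.
Proof. induction N; simpl; intros H; auto. rewrite IHN, H; auto. Qed.

Lemma csum_plus f g N : csum (fun n => (f n + g n)%C) N = (csum f N + csum g N)%C.
Proof. induction N; simpl; [ring|rewrite IHN; ring]. Qed.

Lemma csum_scal c f N : csum (fun n => (c * f n)%C) N = (c * csum f N)%C.
Proof. induction N; simpl; [ring|rewrite IHN; ring]. Qed.

Lemma csum_zero N : csum (fun _ => 0%C) N = 0%C.
Proof. induction N; simpl; [reflexivity|rewrite IHN; ring]. Qed.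

Lemma csum_swap f N M :
  csum (fun i => csum (f i) M) N = csum (fun j => csum (fun i => f i j) N) M.
Proof.
  induction N; simpl; [symmetry; apply csum_zero|].
  rewrite IHN, <- csum_plus. reflexivity.
Qed.

Lemma csum_mod f N : Cmod (csum f N) <= rsum (fun n => Cmod (f n)) N.
Proof.
  induction N; simpl; [rewrite Cmod_0; lra|].
  generalize (Cmod_triangle (csum f N) (f N)); lra.
Qed.

Lemma csum_re f N : Re (csum f N) = rsum (fun n => Re (f n)) N.
Proof. induction N; simpl; [reflexivity|rewrite <- IHN; reflexivity]. Qed.
Lemma csum_im f N : Im (csum f N) = rsum (fun n => Im (f n)) N.
Proof. induction N; simpl; [reflexivity|rewrite <- IHN; reflexivity]. Qed.

(** * Limits of complex sequences and absolutely convergent series *)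

Definition clim (u : nat -> C) (l : C) := is_lim_seq (fun n => Cmod (u n - l)%C) 0.

Lemma is_lim_seq_dom0 (u v : nat -> R) :
  (forall n, 0 <= u n <= v n) -> is_lim_seq v 0 -> is_lim_seq u 0.
Proof.
  intros H Hv. apply (is_lim_seq_le_le (fun _ => 0) u v); auto. apply is_lim_seq_const.
Qed.

Lemma Cmod_le_ReIm z : Cmod z <= Rabs (Re z) + Rabs (Im z).
Proof.
  assert (H := Cmod2_alt z). assert (0 <= Cmod z) by apply Cmod_ge_0.
  assert (H1 := Rabs_pos (Re z)). assert (H2 := Rabs_pos (Im z)).
  rewrite <- (pow2_abs (Re z)), <- (pow2_abs (Im z)) in H.
  apply Rsqr_incr_0_var; unfold Rsqr; nra.
Qed.
Lemma Im_le_Cmod z : Rabs (Im z) <= Cmod z.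
Proof. eapply Rle_trans; [|apply Rmax_Cmod]. apply Rmax_r. Qed.

Lemma clim_ReIm u l : is_lim_seq (fun n => Re (u n)) (Re l) ->
  is_lim_seq (fun n => Im (u n)) (Im l) -> clim u l.
Proof.
  intros H1 H2.
  assert (K : forall (x : nat -> R) (y : R), is_lim_seq x y -> is_lim_seq (fun n => Rabs (x n - y)) 0).
  { intros x y H. apply (proj1 (is_lim_seq_abs_0 _)).
    replace (Finite 0) with (Finite (y - y)) by (f_equal; ring).
    apply is_lim_seq_minus'; auto. apply is_lim_seq_const. }
  apply is_lim_seq_dom0 with (v := fun n => Rabs (Re (u n) - Re l) + Rabs (Im (u n) - Im l)).
  - intros n. split; [apply Cmod_ge_0|]. apply (Cmod_le_ReIm (u n - l)).
  - replace (Finite 0) with (Finite (0 + 0)) by (f_equal; ring).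
    apply is_lim_seq_plus'; auto.
Qed.

Lemma clim_Re u l : clim u l -> is_lim_seq (fun n => Re (u n)) (Re l).
Proof.
  intros H. apply is_lim_seq_ext with (fun n => (Re (u n) - Re l) + Re l); [intros; ring|].
  replace (Finite (Re l)) with (Finite (0 + Re l)) by (f_equal; ring).
  apply is_lim_seq_plus'; [|apply is_lim_seq_const].
  apply (proj2 (is_lim_seq_abs_0 _)). eapply is_lim_seq_dom0; [|exact H].
  intros n; split; [apply Rabs_pos|]. apply (re_le_Cmod (u n - l)).
Qed.
Lemma clim_Im u l : clim u l -> is_lim_seq (fun n => Im (u n)) (Im l).
Proof.
  intros H. apply is_lim_seq_ext with (fun n => (Im (u n) - Im l) + Im l); [intros; ring|].
  replace (Finite (Im l)) with (Finite (0 + Im l)) by (f_equal; ring).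
  apply is_lim_seq_plus'; [|apply is_lim_seq_const].
  apply (proj2 (is_lim_seq_abs_0 _)). eapply is_lim_seq_dom0; [|exact H].
  intros n; split; [apply Rabs_pos|]. apply (Im_le_Cmod (u n - l)).
Qed.

Lemma C_ext (x y : C) : Re x = Re y -> Im x = Im y -> x = y.
Proof. destruct x, y; simpl; intros; subst; auto. Qed.

Lemma clim_unique u l l' : clim u l -> clim u l' -> l = l'.
Proof.
  intros H H'. apply C_ext.
  - assert (A := is_lim_seq_unique _ _ (clim_Re _ _ H)).
    rewrite (is_lim_seq_unique _ _ (clim_Re _ _ H')) in A. injection A as A. symmetry; exact A.
  - assert (A := is_lim_seq_unique _ _ (clim_Im _ _ H)).
    rewrite (is_lim_seq_unique _ _ (clim_Im _ _ H')) in A. injection A as A. symmetry; exact A.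
Qed.

Lemma clim_ext u v l : (forall n, u n = v n) -> clim u l -> clim v l.
Proof. intros H. apply is_lim_seq_ext. intros; now rewrite H. Qed.

Lemma clim_const l : clim (fun _ => l) l.
Proof.
  apply is_lim_seq_ext with (fun _ => 0); [|apply is_lim_seq_const].
  intros _. replace (l - l)%C with (RtoC 0) by ring. now rewrite Cmod_0.
Qed.

Lemma clim_plus u v l m : clim u l -> clim v m -> clim (fun n => (u n + v n)%C) (l + m)%C.
Proof.
  intros H H'. apply is_lim_seq_dom0 with (v := fun n => Cmod (u n - l) + Cmod (v n - m)).
  - intros n; split; [apply Cmod_ge_0|].
    replace (u n + v n - (l + m))%C with ((u n - l) + (v n - m))%C by ring. apply Cmod_triangle.
  - replace (Finite 0) with (Finite (0 + 0)) by (f_equal; ring). apply is_lim_seq_plus'; auto.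
Qed.

Lemma clim_scal c u l : clim u l -> clim (fun n => (c * u n)%C) (c * l)%C.
Proof.
  intros H. apply is_lim_seq_ext with (fun n => Cmod c * Cmod (u n - l)).
  - intros n. rewrite <- Cmod_mult. f_equal; ring.
  - replace (Finite 0) with (Finite (Cmod c * 0)) by (f_equal; ring).
    apply is_lim_seq_mult'; auto. apply is_lim_seq_const.
Qed.

Lemma clim_Cmod u l : clim u l -> is_lim_seq (fun n => Cmod (u n)) (Cmod l).
Proof.
  intros H.
  apply is_lim_seq_ext with (fun n => (Cmod (u n) - Cmod l) + Cmod l); [intros; ring|].
  replace (Finite (Cmod l)) with (Finite (0 + Cmod l)) by (f_equal; ring).
  apply is_lim_seq_plus'; [|apply is_lim_seq_const].
  apply (proj2 (is_lim_seq_abs_0 _)). eapply is_lim_seq_dom0; [|exact H].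
  intros n; split; [apply Rabs_pos|].
  generalize (Cmod_triangle (u n - l) l) (Cmod_triangle (l - u n) (u n)).
  replace (u n - l + l)%C with (u n) by ring. replace (l - u n + u n)%C with l by ring.
  replace (l - u n)%C with (- (u n - l))%C by ring. rewrite Cmod_opp.
  intros; apply Rabs_le; lra.
Qed.

Lemma rsum_ex_series f B : (forall n, 0 <= f n) -> (forall N, rsum f N <= B) -> ex_series f.
Proof.
  intros Hf HB.
  destruct (ex_finite_lim_seq_incr (sum_n f) B) as [l Hl].
  - intros n. rewrite !sum_n_rsum. simpl. specialize (Hf (S n)). lra.
  - intros n. rewrite sum_n_rsum. auto.
  - exists l. exact Hl.
Qed.

Lemma ex_series_rsum_lim f : ex_series f -> is_lim_seq (rsum f) (Series f).
Proof.
  intros H. apply Series_correct in H. apply is_lim_seq_incr_1.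
  apply is_lim_seq_ext with (sum_n f); [intros; apply sum_n_rsum|exact H].
Qed.

Lemma rsum_le_Series f N : (forall n, 0 <= f n) -> ex_series f -> rsum f N <= Series f.
Proof.
  intros Hf H.
  apply (is_lim_seq_le_loc (fun _ => rsum f N) (rsum f) (rsum f N) (Series f)).
  - exists N. intros; apply rsum_mono; auto.
  - apply is_lim_seq_const.
  - now apply ex_series_rsum_lim.
Qed.

Lemma Series_le_bound f B : (forall n, 0 <= f n) -> (forall N, rsum f N <= B) -> Series f <= B.
Proof.
  intros Hf HB.
  apply (is_lim_seq_le (rsum f) (fun _ => B) (Series f) B); auto.
  - apply ex_series_rsum_lim. now apply rsum_ex_series with B.
  - apply is_lim_seq_const.
Qed.

(** [Series] returns a value even for divergent terms. The bound on the moduli is what makes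
    [Cseries] the limit of its partial sums. *)
Lemma Cseries_clim f B : (forall N, rsum (fun n => Cmod (f n)) N <= B) -> clim (csum f) (Cseries f).
Proof.
  intros HB.
  assert (E : ex_series (fun n => Cmod (f n))).
  { apply rsum_ex_series with B; auto. intros; apply Cmod_ge_0. }
  apply clim_ReIm.
  - apply is_lim_seq_ext with (rsum (fun n => Re (f n))); [intros; symmetry; apply csum_re|].
    apply ex_series_rsum_lim. apply (@ex_series_le R_AbsRing R_CompleteNormedModule) with (b := fun n => Cmod (f n)); auto.
    intros n; apply re_le_Cmod.
  - apply is_lim_seq_ext with (rsum (fun n => Im (f n))); [intros; symmetry; apply csum_im|].
    apply ex_series_rsum_lim. apply (@ex_series_le R_AbsRing R_CompleteNormedModule) with (b := fun n => Cmod (f n)); auto.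
    intros n; apply Im_le_Cmod.
Qed.

Lemma Cseries_bound f B : (forall N, rsum (fun n => Cmod (f n)) N <= B) -> Cmod (Cseries f) <= B.
Proof.
  intros HB. apply (is_lim_seq_le (fun n => Cmod (csum f n)) (fun _ => B) (Cmod (Cseries f)) B).
  - intros n. eapply Rle_trans; [apply csum_mod|auto].
  - apply clim_Cmod. now apply Cseries_clim with B.
  - apply is_lim_seq_const.
Qed.

Lemma Cseries_eq f B l : (forall N, rsum (fun n => Cmod (f n)) N <= B) ->
  clim (csum f) l -> Cseries f = l.
Proof. intros H H'. eapply clim_unique; [now apply Cseries_clim with B|auto]. Qed.

Lemma Cseries_ext f g : (forall n, f n = g n) -> Cseries f = Cseries g.
Proof. intros H. f_equal. apply functional_extensionality; auto. Qed.

Definition abs_summable (f : nat -> C) := exists B, forall N, rsum (fun n => Cmod (f n)) N <= B.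

Lemma abs_summable_plus f g : abs_summable f -> abs_summable g -> abs_summable (fun n => (f n + g n)%C).
Proof.
  intros [A HA] [B HB]. exists (A + B). intros N.
  eapply Rle_trans; [|apply Rplus_le_compat; [apply (HA N)|apply (HB N)]].
  rewrite <- rsum_plus. apply rsum_le; intros; apply Cmod_triangle.
Qed.

Lemma abs_summable_scal c f : abs_summable f -> abs_summable (fun n => (c * f n)%C).
Proof.
  intros [A HA]. exists (Cmod c * A). intros N.
  rewrite (rsum_ext _ (fun n => Cmod c * Cmod (f n))); [|intros; apply Cmod_mult].
  rewrite rsum_scal. apply Rmult_le_compat_l; auto. apply Cmod_ge_0.
Qed.

Lemma Cseries_plus f g : abs_summable f -> abs_summable g ->
  Cseries (fun n => (f n + g n)%C) = (Cseries f + Cseries g)%C.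
Proof.
  intros Hf Hg. destruct (abs_summable_plus _ _ Hf Hg) as [B HB].
  apply Cseries_eq with B; auto. destruct Hf as [Bf Hf], Hg as [Bg Hg].
  apply clim_ext with (fun n => (csum f n + csum g n)%C); [intros; symmetry; apply csum_plus|].
  apply clim_plus; eapply Cseries_clim; eauto.
Qed.

Lemma Cseries_scal c f : abs_summable f -> Cseries (fun n => (c * f n)%C) = (c * Cseries f)%C.
Proof.
  intros Hf. destruct (abs_summable_scal c _ Hf) as [B HB].
  apply Cseries_eq with B; auto. destruct Hf as [Bf Hf].
  apply clim_ext with (fun n => (c * csum f n)%C); [intros; symmetry; apply csum_scal|].
  apply clim_scal; eapply Cseries_clim; eauto.
Qed.

Lemma Cseries_zero : Cseries (fun _ => 0%C) = 0%C.
Proof.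
  apply Cseries_eq with 0.
  - intros N. rewrite (rsum_ext _ (fun _ => 0)); [rewrite rsum_zero; lra|intros; apply Cmod_0].
  - apply clim_ext with (fun _ => 0%C); [intros; symmetry; apply csum_zero|apply clim_const].
Qed.

(** Stands for finiteness of the weighted norm together with the bound B. Speaking of partial sums
    only, it needs no convergence side condition and survives coordinatewise limits. *)
Definition l2le (w : nat -> R) (f : nat -> C) (B : R) : Prop :=
  0 <= B /\ forall N, rsum (fun n => w n * Cmod (f n) ^ 2) N <= B ^ 2.

Lemma sq_le x y : 0 <= x <= y -> x ^ 2 <= y ^ 2.
Proof. intros; nra. Qed.
Lemma sq_le_inv x y : 0 <= y -> x ^ 2 <= y ^ 2 -> x <= y.
Proof. intros; nra. Qed.

Lemma l2le_dom w w' f g c B : 0 <= c ->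
  (forall n, w' n * Cmod (g n) ^ 2 <= c ^ 2 * (w n * Cmod (f n) ^ 2)) -> l2le w f B -> l2le w' g (c * B).
Proof.
  intros Hc Hd [HB Hf]. split; [now apply Rmult_le_pos|]. intros N.
  eapply Rle_trans; [apply rsum_le; intros; apply Hd|]. rewrite rsum_scal, Rpow_mult_distr.
  apply Rmult_le_compat_l; auto. apply pow2_ge_0.
Qed.

Lemma l2le_weaken w f B B' : B <= B' -> l2le w f B -> l2le w f B'.
Proof.
  intros H [HB Hf]. split; [lra|]. intros N. eapply Rle_trans; [apply Hf|]. apply sq_le; lra.
Qed.

Lemma l2le_plus w f g A B : (forall n, 0 <= w n) -> l2le w f A -> l2le w g B ->
  l2le w (fun n => (f n + g n)%C) (A + B).
Proof.
  intros Hw [HA Hf] [HB Hg]. split; [lra|]. intros N.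
  assert (H := rsum_CS w (fun n => Cmod (f n)) (fun n => Cmod (g n)) N A B HA HB Hw (Hf N) (Hg N)).
  apply Rle_trans with (rsum (fun n => (w n * Cmod (f n) ^ 2 + w n * Cmod (g n) ^ 2)
     + 2 * (w n * (Cmod (f n) * Cmod (g n)))) N).
  - apply rsum_le; intros n _.
    assert (T := Cmod_triangle (f n) (g n)).
    replace (w n * Cmod (f n) ^ 2 + w n * Cmod (g n) ^ 2 + 2 * (w n * (Cmod (f n) * Cmod (g n))))
      with (w n * (Cmod (f n) + Cmod (g n)) ^ 2) by ring.
    apply Rmult_le_compat_l; auto. apply sq_le. split; [apply Cmod_ge_0|auto].
  - rewrite !rsum_plus, rsum_scal. specialize (Hf N); specialize (Hg N); nra.
Qed.

Lemma l2le_scal w c f B : l2le w f B -> l2le w (fun n => (c * f n)%C) (Cmod c * B).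
Proof.
  apply l2le_dom; [apply Cmod_ge_0|]. intros n. rewrite Cmod_mult. right; ring.
Qed.

Lemma l2le_ext w f g B : (forall n, f n = g n) -> l2le w f B -> l2le w g B.
Proof. intros H. replace g with f; auto. now apply functional_extensionality. Qed.

Lemma l2le_opp w f B : l2le w f B -> l2le w (fun n => (- f n)%C) B.
Proof.
  intros H. replace B with (1 * B) by ring. revert H; apply l2le_dom; [lra|].
  intros n. rewrite Cmod_opp. right; ring.
Qed.

Lemma l2le_minus w f g A B : (forall n, 0 <= w n) -> l2le w f A -> l2le w g B ->
  l2le w (fun n => (f n - g n)%C) (A + B).
Proof. intros Hw Hf Hg. apply (l2le_plus w f (fun n => (- g n)%C)); auto. now apply l2le_opp. Qed.

(** Fatou for sequences: a finite weighted sum passes to the coordinatewise limit, and its length is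
    arbitrary. *)
Lemma l2le_lim w (u : nat -> nat -> C) f B :
  (forall m, l2le w (u m) B) -> (forall n, clim (fun m => u m n) (f n)) -> l2le w f B.
Proof.
  intros H Hl. split; [apply (H O)|]. intros N.
  apply (is_lim_seq_le (fun m => rsum (fun n => w n * Cmod (u m n) ^ 2) N) (fun _ => B ^ 2)
          (rsum (fun n => w n * Cmod (f n) ^ 2) N) (B ^ 2)).
  - intros m; apply (H m).
  - apply rsum_lim. intros n. apply (is_lim_seq_scal_l _ (w n) (Cmod (f n) ^ 2)).
    specialize (Hl n). simpl.
    apply clim_Cmod in Hl.
    replace (Finite (Cmod (f n) * (Cmod (f n) * 1))) with (Finite (Cmod (f n) * Cmod (f n))) by (f_equal; ring).
    apply is_lim_seq_ext with (fun m => Cmod (u m n) * Cmod (u m n)); [intros; ring|].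
    now apply is_lim_seq_mult'.
  - apply is_lim_seq_const.
Qed.

Lemma l2le_term w f B p : (forall n, 0 <= w n) -> l2le w f B -> w p * Cmod (f p) ^ 2 <= B ^ 2.
Proof.
  intros Hw [HB H]. eapply Rle_trans; [|apply (H (S p))].
  apply (rsum_term (fun n => w n * Cmod (f n) ^ 2)); [|lia].
  intros n; apply Rmult_le_pos; auto. apply pow2_ge_0.
Qed.

Lemma l2le_zero w B : 0 <= B -> l2le w (fun _ => 0%C) B.
Proof.
  intros H; split; auto. intros N.
  rewrite (rsum_ext _ (fun _ => 0)), rsum_zero; [apply pow2_ge_0|].
  intros; rewrite Cmod_0; ring.
Qed.

Lemma l2le_pair_abs w f (t : nat -> R) B Q N : (forall n, 0 < w n) -> l2le w f B -> 0 <= Q ->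
  rsum (fun n => t n ^ 2 / w n) N <= Q ^ 2 ->
  rsum (fun n => Cmod (f n) * Rabs (t n)) N <= Q * B.
Proof.
  intros Hw [HB H] HQ Ht.
  rewrite (rsum_ext _ (fun n => w n * ((Rabs (t n) / w n) * Cmod (f n)))).
  - apply rsum_CS; auto; [intros; now left|].
    rewrite (rsum_ext _ (fun n => t n ^ 2 / w n)); auto. intros n _.
    rewrite <- (pow2_abs (t n)). field. generalize (Hw n); lra.
  - intros n _. field. generalize (Hw n); lra.
Qed.

(** The kernel t j n m n is Hilbert-Schmidt, of norm at most Q, from l2 to the weighted l2; [colb]
    bounds the weighted columns of t. Cauchy-Schwarz in each row gives absolute convergence;
    exchanging the two finite sums and passing to the limit gives the norm. *)
Lemma hilbert_schmidt_l2le (w : nat -> R) (t : nat -> nat -> R) (m x : nat -> R) (colb : nat -> R) (g : nat -> C) Q B :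
  (forall n, 0 < w n) -> (forall n, 0 <= m n) -> 0 <= Q -> 0 <= B ->
  (forall n, Cmod (g n) <= m n * x n) ->
  (forall N, rsum (fun n => x n ^ 2) N <= B ^ 2) ->
  (forall J n, rsum (fun j => w j * t j n ^ 2) J <= colb n) ->
  (forall N, rsum (fun n => colb n * m n ^ 2) N <= Q ^ 2) ->
  (forall j, abs_summable (fun n => (g n * RtoC (t j n))%C)) /\
  l2le w (fun j => Cseries (fun n => (g n * RtoC (t j n))%C)) (Q * B).
Proof.
  intros Hw Hm HQ HB Hg Hx Hk HQs.
  assert (Hgm : forall j n, Cmod (g n * RtoC (t j n)) <= Rabs (t j n) * m n * x n).
  { intros j n. rewrite Cmod_mult, Cmod_R. generalize (Rabs_pos (t j n)) (Hg n). nra. }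
  assert (Hdbl : forall J N, rsum (fun j => w j * rsum (fun n => (Rabs (t j n) * m n) ^ 2) N) J <= Q ^ 2).
  { intros J N. rewrite (rsum_ext _ (fun j => rsum (fun n => w j * t j n ^ 2 * m n ^ 2) N)).
    - rewrite rsum_swap. eapply Rle_trans; [|apply (HQs N)]. apply rsum_le; intros n _.
      rewrite (rsum_ext _ (fun j => m n ^ 2 * (w j * t j n ^ 2))); [|intros; ring].
      rewrite rsum_scal, Rmult_comm. apply Rmult_le_compat_r; auto. apply pow2_ge_0.
    - intros j _. rewrite <- rsum_scal. apply rsum_ext; intros n _.
      rewrite Rpow_mult_distr, pow2_abs. ring. }
  assert (Hrow : forall j N, rsum (fun n => (Rabs (t j n) * m n) ^ 2) N <= Q ^ 2 / w j).
  { intros j N. apply Rmult_le_reg_l with (w j); auto.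
    replace (w j * (Q ^ 2 / w j)) with (Q ^ 2) by (field; generalize (Hw j); lra).
    eapply Rle_trans; [|apply (Hdbl (S j) N)].
    apply (rsum_term (fun j => w j * rsum (fun n => (Rabs (t j n) * m n) ^ 2) N)); [|lia].
    intros i; apply Rmult_le_pos; [left; auto|]. apply rsum_ge0; intros; apply pow2_ge_0. }
  assert (HCS : forall j N, rsum (fun n => Cmod (g n * RtoC (t j n))) N
     <= sqrt (rsum (fun n => (Rabs (t j n) * m n) ^ 2) N) * B).
  { intros j N. apply Rle_trans with (rsum (fun n => 1 * ((Rabs (t j n) * m n) * x n)) N).
    - apply rsum_le; intros n _. rewrite Rmult_1_l. apply Hgm.
    - apply rsum_CS; auto; [apply sqrt_pos|intros; lra| |].
      + rewrite pow2_sqrt; [|apply rsum_ge0; intros; apply pow2_ge_0].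
        right; apply rsum_ext; intros; ring.
      + rewrite (rsum_ext _ (fun n => x n ^ 2)); auto. intros; ring. }
  assert (Habs : forall j, abs_summable (fun n => (g n * RtoC (t j n))%C)).
  { intros j. exists (sqrt (Q ^ 2 / w j) * B). intros N. eapply Rle_trans; [apply HCS|].
    apply Rmult_le_compat_r; auto. apply sqrt_le_1_alt. auto. }
  split; auto.
  apply l2le_lim with (u := fun N j => csum (fun n => (g n * RtoC (t j n))%C) N).
  - intros N. split; [now apply Rmult_le_pos|]. intros J.
    apply Rle_trans with (rsum (fun j => B ^ 2 * (w j * rsum (fun n => (Rabs (t j n) * m n) ^ 2) N)) J).
    + apply rsum_le; intros j _.
      assert (E : Cmod (csum (fun n => (g n * RtoC (t j n))%C) N) ^ 2 <= B ^ 2 * rsum (fun n => (Rabs (t j n) * m n) ^ 2) N).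
      { rewrite <- (pow2_sqrt (rsum _ N)); [|apply rsum_ge0; intros; apply pow2_ge_0].
        rewrite <- Rpow_mult_distr. apply sq_le. split; [apply Cmod_ge_0|].
        eapply Rle_trans; [apply csum_mod|]. rewrite Rmult_comm. apply HCS. }
      generalize (Hw j); nra.
    + rewrite rsum_scal, Rpow_mult_distr. rewrite (Rmult_comm (Q ^ 2)).
      apply Rmult_le_compat_l; auto. apply pow2_ge_0.
  - intros j. destruct (Habs j) as [Bj Hj]. eapply Cseries_clim; eauto.
Qed.

(** * Neumann series and the Fredholm alternative in l2 *)

Definition lsum (f : nat -> C) (l : list nat) : C := fold_right (fun j s => (f j + s)%C) 0%C l.

Lemma lsum_app f l1 l2 : lsum f (l1 ++ l2) = (lsum f l1 + lsum f l2)%C.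
Proof. induction l1; simpl; [ring|rewrite IHl1; ring]. Qed.

Lemma lsum_ext f g l : (forall j, In j l -> f j = g j) -> lsum f l = lsum g l.
Proof.
  induction l; simpl; intros H; auto. rewrite IHl, H; auto.
Qed.

Lemma lsum_lin f g c l : lsum (fun j => (f j + c * g j)%C) l = (lsum f l + c * lsum g l)%C.
Proof. induction l; simpl; [ring|rewrite IHl; ring]. Qed.

Lemma lsum_seq f N : lsum f (seq 0 N) = csum f N.
Proof.
  induction N; [reflexivity|]. rewrite seq_S, lsum_app, IHN. simpl. ring.
Qed.

(* Indexing the unknowns by a duplicate-free list lets Gaussian elimination drop a pivot without renumbering. *)
Lemma exists_dependence n : forall (l : list nat) (M : nat -> nat -> C), NoDup l -> (n < length l)%nat ->
  exists x : nat -> C, (exists j, In j l /\ x j <> 0%C) /\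
    forall i, (i < n)%nat -> lsum (fun j => (M i j * x j)%C) l = 0%C.
Proof.
  induction n; intros l M Hl Hn.
  - exists (fun _ => 1%C). split; [|intros; lia].
    destruct l as [|h t]; simpl in Hn; [lia|]. exists h. split; [now left|].
    apply C1_nz.
  (* Equation n is the last one. If it involves some unknown p, that unknown is eliminated from the
     others; otherwise the equation is void and the smaller system suffices. *)
  - destruct (classic (exists p, In p l /\ M n p <> 0%C)) as [[p [Hp Hnz]]|Hall].
    + destruct (in_split _ _ Hp) as [l1 [l2 El]].
      assert (Hl' : NoDup (l1 ++ l2)) by (rewrite El in Hl; now apply NoDup_remove_1 in Hl).
      assert (Hp' : ~ In p (l1 ++ l2)) by (rewrite El in Hl; now apply NoDup_remove_2 in Hl).
      assert (Hlen : (n < length (l1 ++ l2))%nat).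
      { rewrite El in Hn. rewrite length_app in *. simpl in Hn. lia. }
      destruct (IHn (l1 ++ l2) (fun i j => (M i j - M i p * M n j / M n p)%C) Hl' Hlen)
        as [x [[j0 [Hj0 Hx0]] Hx]].
      set (s := lsum (fun j => (M n j * x j)%C) (l1 ++ l2)).
      set (x' := fun j => if Nat.eqb j p then (- s / M n p)%C else x j).
      assert (Hx' : forall j, In j (l1 ++ l2) -> x' j = x j).
      { intros j Hj. unfold x'. destruct (Nat.eqb_spec j p); subst; tauto. }
      assert (Hxp : x' p = (- s / M n p)%C) by (unfold x'; now rewrite Nat.eqb_refl).
      exists x'. split.
      * exists j0. split; [|now rewrite Hx']. rewrite El. apply in_or_app.
        apply in_app_or in Hj0. simpl; tauto.
      * assert (E : forall i, lsum (fun j => (M i j * x' j)%C) l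
            = (lsum (fun j => (M i j * x j)%C) (l1 ++ l2) + M i p * (- s / M n p))%C).
        { intros i. rewrite El, !lsum_app. simpl. rewrite Hxp.
          rewrite (lsum_ext _ (fun j => (M i j * x j)%C) l1);
            [|intros j Hj; rewrite Hx'; auto; apply in_or_app; auto].
          rewrite (lsum_ext _ (fun j => (M i j * x j)%C) l2);
            [|intros j Hj; rewrite Hx'; auto; apply in_or_app; auto]. ring. }
        intros i Hi. rewrite E.
        destruct (Nat.eq_dec i n) as [->|Hin].
        -- fold s. field. auto.
        -- assert (Hi' : (i < n)%nat) by lia. specialize (Hx i Hi').
           rewrite (lsum_ext _
              (fun j => (M i j * x j + (- (M i p / M n p)) * (M n j * x j))%C)) in Hx; [|intros; field; auto].
           rewrite lsum_lin in Hx. fold s in Hx.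
           transitivity (lsum (fun j => (M i j * x j)%C) (l1 ++ l2) + - (M i p / M n p) * s)%C; [|exact Hx].
           field; auto.
    + destruct (IHn l M Hl ltac:(lia)) as [x [H1 H2]]. exists x; split; auto.
      intros i Hi. destruct (Nat.eq_dec i n) as [->|Hin]; [|apply H2; lia].
      rewrite (lsum_ext _ (fun j => 0%C)).
      * clear. induction l; simpl; [reflexivity|]. rewrite IHl. ring.
      * intros j Hj. destruct (classic (M n j = 0%C)) as [E|E]; [rewrite E; ring|].
        exfalso; eauto.
Qed.

(** N equations in N + 1 unknowns, b being the extra column, have a nontrivial solution. Injectivity
    forces its last entry to be nonzero, and dividing by it expresses b through the columns of A. *)
Lemma injective_system_solvable N (A : nat -> nat -> C) :
  (forall x, (forall i, (i < N)%nat -> csum (fun j => (A i j * x j)%C) N = 0%C) ->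
     forall j, (j < N)%nat -> x j = 0%C) ->
  forall b : nat -> C, exists x, forall i, (i < N)%nat -> csum (fun j => (A i j * x j)%C) N = b i.
Proof.
  intros Hinj b.
  destruct (exists_dependence N (seq 0 (S N)) (fun i j => if Nat.eqb j N then b i else A i j))
    as [x [[j0 [Hj0 Hx0]] Hx]]; [apply seq_NoDup|rewrite length_seq; lia|].
  assert (Hx' : forall i, (i < N)%nat -> (csum (fun j => (A i j * x j)%C) N + b i * x N = 0)%C).
  { intros i Hi. rewrite <- (Hx i Hi), lsum_seq. simpl. rewrite Nat.eqb_refl. f_equal.
    apply csum_ext. intros n Hn. destruct (Nat.eqb_spec n N); [lia|auto]. }
  assert (HN : x N <> 0%C).
  { intros E. apply Hx0. apply in_seq in Hj0. destruct (Nat.eq_dec j0 N) as [->|]; auto.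
    apply Hinj; [|lia]. intros i Hi. rewrite <- (Hx' i Hi), E. ring. }
  exists (fun j => (- / x N * x j)%C). intros i Hi.
  rewrite (csum_ext _ (fun j => (- / x N * (A i j * x j))%C)); [|intros; ring].
  rewrite csum_scal. specialize (Hx' i Hi).
  replace (csum (fun j => (A i j * x j)%C) N) with (- (b i * x N))%C.
  - field; auto.
  - transitivity (- (b i * x N) + (csum (fun j => (A i j * x j)%C) N + b i * x N))%C; [rewrite Hx'|]; ring.
Qed.

(** * Linear operators on plain l2 *)

Definition unit_wgt (_ : nat) : R := 1.
Definition ell2 f := exists B, l2le unit_wgt f B.
(** Linearity is asked on l2 only: elsewhere the series inside an operator may diverge and take
    meaningless values. *)
Definition linear_op (T : (nat -> C) -> nat -> C) := forall f g c, ell2 f -> ell2 g -> forall n,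
  T (fun m => (f m + c * g m)%C) n = (T f n + c * T g n)%C.
Definition bounded_op (T : (nat -> C) -> nat -> C) K := forall f B, l2le unit_wgt f B -> l2le unit_wgt (T f) (K * B).

Lemma unit_wgt_ge0 n : 0 <= unit_wgt n. Proof. unfold unit_wgt; lra. Qed.
#[global] Hint Resolve unit_wgt_ge0 : core.

Lemma l2le_coord f B p : l2le unit_wgt f B -> Cmod (f p) <= B.
Proof.
  intros H. apply sq_le_inv; [apply H|]. generalize (l2le_term unit_wgt f B p unit_wgt_ge0 H).
  unfold unit_wgt. lra.
Qed.

Lemma ell2_plus f g : ell2 f -> ell2 g -> ell2 (fun n => (f n + g n)%C).
Proof. intros [A HA] [B HB]. exists (A + B). now apply l2le_plus. Qed.
Lemma ell2_scal c f : ell2 f -> ell2 (fun n => (c * f n)%C).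
Proof. intros [A HA]. eexists; apply l2le_scal; eauto. Qed.
Lemma ell2_bdd T K f : bounded_op T K -> ell2 f -> ell2 (T f).
Proof. intros H [A HA]. eexists; apply H; eauto. Qed.
Lemma ell2_zero : ell2 (fun _ => 0%C).
Proof. exists 0. apply l2le_zero; lra. Qed.

Lemma op_ext (T : (nat -> C) -> nat -> C) f g : (forall n, f n = g n) -> T f = T g.
Proof. intros H. f_equal. now apply functional_extensionality. Qed.

Lemma linear_op_zero T : linear_op T -> forall n, T (fun _ => 0%C) n = 0%C.
Proof.
  intros H n. generalize (H (fun _ => 0%C) (fun _ => 0%C) 1%C ell2_zero ell2_zero n).
  rewrite (op_ext T (fun m => (0 + 1 * 0)%C) (fun _ => 0%C)); [|intros; ring].
  intros E. transitivity ((T (fun _ => 0) n + 1 * T (fun _ => 0) n) - T (fun _ => 0) n)%C; [ring|].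
  rewrite <- E. ring.
Qed.

Lemma linear_op_minus T f g : linear_op T -> ell2 f -> ell2 g -> forall n,
  T (fun m => (f m - g m)%C) n = (T f n - T g n)%C.
Proof.
  intros H Hf Hg n.
  rewrite (op_ext T (fun m => (f m - g m)%C) (fun m => (f m + (- (1)) * g m)%C)); [|intros; ring].
  rewrite H; auto. ring.
Qed.

Lemma ell2_csum (e : nat -> nat -> C) c N : (forall j, ell2 (e j)) ->
  ell2 (fun n => csum (fun j => (c j * e j n)%C) N).
Proof.
  intros He. induction N; simpl; [apply ell2_zero|].
  apply ell2_plus; auto. now apply ell2_scal.
Qed.

Lemma linear_op_csum T (e : nat -> nat -> C) c N : linear_op T -> (forall j, ell2 (e j)) -> forall n,
  T (fun n => csum (fun j => (c j * e j n)%C) N) n = csum (fun j => (c j * T (e j) n)%C) N.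
Proof.
  intros H He n. induction N; simpl; [now apply linear_op_zero|].
  rewrite (H (fun n => csum (fun j => (c j * e j n)%C) N) (e N)), IHN; auto. now apply ell2_csum.
Qed.

Lemma le_halves (x B : R) : (forall m, x <= B * (1 / 2) ^ m) -> x <= 0.
Proof.
  intros H. apply (is_lim_seq_le (fun _ => x) (fun m => B * (1 / 2) ^ m) x 0); auto.
  - apply is_lim_seq_const.
  - replace (Finite 0) with (Finite (B * 0)) by (f_equal; ring).
    apply is_lim_seq_mult'; [apply is_lim_seq_const|].
    apply is_lim_seq_geom. rewrite Rabs_pos_eq; lra.
Qed.

Lemma le_halves_zero z B : (forall m, Cmod z <= B * (1 / 2) ^ m) -> z = 0%C.
Proof.
  intros H. apply Cmod_eq_0. apply le_halves in H. generalize (Cmod_ge_0 z); lra.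
Qed.

(** As g = - T g, every bound on g can be halved, arbitrarily often. *)
Lemma neumann_unique T g : linear_op T -> bounded_op T (1 / 2) -> ell2 g ->
  (forall n, (g n + T g n = 0)%C) -> forall n, g n = 0%C.
Proof.
  intros Hl Hb [B HB] E n. apply le_halves_zero with B. intros m.
  apply l2le_coord with (f := g). induction m; simpl.
  - now rewrite Rmult_1_r.
  - apply l2le_ext with (fun n => (- T g n)%C).
    + intros k. transitivity (- T g k + (g k + T g k))%C; [rewrite E|]; ring.
    + apply l2le_opp. replace (B * (1 / 2 * (1 / 2) ^ m)) with (1 / 2 * (B * (1 / 2) ^ m)) by ring.
      now apply Hb.
Qed.

Lemma neumann T f B : linear_op T -> bounded_op T (1 / 2) -> l2le unit_wgt f B ->
  exists g, l2le unit_wgt g (2 * B) /\ forall n, (g n + T g n = f n)%C.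
Proof.
  intros Hl Hb Hf.
  set (it := fix it m := match m with O => f | S k => fun n => (- T (it k) n)%C end).
  assert (Hit : forall m, l2le unit_wgt (it m) (B * (1 / 2) ^ m)).
  { induction m; simpl; [now rewrite Rmult_1_r|]. apply l2le_opp.
    replace (B * (1 / 2 * (1 / 2) ^ m)) with (1 / 2 * (B * (1 / 2) ^ m)) by ring. now apply Hb. }
  assert (HL : forall m, ell2 (it m)) by (intros m; eexists; apply Hit).
  set (s := fun M n => csum (fun m => it m n) M).
  assert (HsL : forall M, ell2 (s M)).
  { intros M. unfold s. induction M; simpl; [apply ell2_zero|apply ell2_plus; auto]. }
  (* The telescoping identity T s_M = f - s_(M+1) for the partial sums of the Neumann series. *)
  assert (HTs : forall M n, T (s M) n = (f n - s (S M) n)%C).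
  { intros M n. induction M.
    - unfold s at 1. simpl. rewrite linear_op_zero; auto. unfold s; simpl. ring.
    - unfold s at 1. simpl.
      rewrite (op_ext T _ (fun n => (s M n + 1 * it M n)%C)); [|intros; unfold s; ring].
      rewrite Hl, IHM; auto. unfold s at 2. simpl. unfold s. simpl. ring. }
  assert (Htail : forall M k, l2le unit_wgt (fun n => csum (fun m => it (M + m)%nat n) k)
      (2 * B * (1 / 2) ^ M * (1 - (1 / 2) ^ k))).
  { intros M k. induction k.
    - simpl. apply l2le_zero. lra.
    - simpl.
      replace (2 * B * (1 / 2) ^ M * (1 - 1 / 2 * (1 / 2) ^ k))
        with (2 * B * (1 / 2) ^ M * (1 - (1 / 2) ^ k) + B * (1 / 2) ^ (M + k)) by (rewrite pow_add; field).
      apply l2le_plus; auto. }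
  assert (HB : 0 <= B) by apply Hf.
  assert (Htail' : forall M k, l2le unit_wgt (fun n => csum (fun m => it (M + m)%nat n) k) (2 * B * (1 / 2) ^ M)).
  { intros M k. eapply l2le_weaken; [|apply Htail].
    assert (0 <= (1 / 2) ^ k) by (apply pow_le; lra).
    assert (0 <= 2 * B * (1 / 2) ^ M) by (apply Rmult_le_pos; [lra|apply pow_le; lra]). nra. }
  assert (Habs : forall n N, rsum (fun m => Cmod (it m n)) N <= 2 * B * (1 - (1 / 2) ^ N)).
  { intros n N. induction N; simpl; [lra|].
    generalize (l2le_coord _ _ n (Hit N)). lra. }
  set (g := fun n => Cseries (fun m => it m n)).
  assert (Hg : forall n, clim (fun M => s M n) (g n)).
  { intros n. apply Cseries_clim with (2 * B). intros N.
    eapply Rle_trans; [apply Habs|]. assert (0 <= (1 / 2) ^ N) by (apply pow_le; lra). nra. }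
  assert (Hsplit : forall M k n, s (M + k)%nat n = (s M n + csum (fun m => it (M + m)%nat n) k)%C).
  { intros M k n. induction k; simpl; [rewrite Nat.add_0_r; ring|].
    rewrite Nat.add_succ_r. unfold s in *. simpl. rewrite IHk. ring. }
  assert (Hgs : forall M, l2le unit_wgt (fun n => (g n - s M n)%C) (2 * B * (1 / 2) ^ M)).
  { intros M. apply l2le_lim with (u := fun k n => csum (fun m => it (M + m)%nat n) k); auto.
    intros n. apply clim_ext with (fun k => (s (k + M)%nat n + (- s M n))%C).
    - intros k. rewrite Nat.add_comm, Hsplit. ring.
    - apply clim_plus; [|apply clim_const].
      unfold clim. apply (is_lim_seq_incr_n (fun M => Cmod (s M n - g n)) M). apply Hg. }
  assert (Hg2 : l2le unit_wgt g (2 * B)).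
  { apply l2le_ext with (fun n => (g n - s 0%nat n)%C); [intros; unfold s; simpl; ring|].
    replace (2 * B) with (2 * B * (1 / 2) ^ 0) by (simpl; ring). apply Hgs. }
  exists g. split; auto. intros n.
  assert (HgL : ell2 g) by (eexists; eauto).
  (* The residual is (g - s_(M+1)) + T (g - s_M), and both parts tend to 0 with M. *)
  assert (E : (g n + T g n - f n = 0)%C).
  { apply le_halves_zero with (2 * B). intros M.
    replace (g n + T g n - f n)%C with ((fun n => (g n - s (S M) n) + T (fun k => (g k - s M k)%C) n)%C n).
    - apply (l2le_coord (fun n => (g n - s (S M) n) + T (fun k => (g k - s M k)%C) n)%C).
      replace (2 * B * (1 / 2) ^ M) with (2 * B * (1 / 2) ^ (S M) + 1 / 2 * (2 * B * (1 / 2) ^ M))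
        by (simpl; field).
      apply l2le_plus; auto.
    - rewrite linear_op_minus; auto. rewrite HTs. ring. }
  transitivity ((g n + T g n - f n) + f n)%C; [ring|]. rewrite E. ring.
Qed.

(** The inverse comes from choice, with the solution fixed before the bound B. Uniqueness makes it
    inherit the estimate for every B, and also gives its linearity. *)
Lemma neumann_inv Q : linear_op Q -> bounded_op Q (1 / 2) -> exists R,
  linear_op R /\ bounded_op R 2 /\ forall f, ell2 f -> forall n, (R f n + Q (R f) n = f n)%C.
Proof.
  intros Hl Hb.
  assert (H : forall f, exists g, forall B, l2le unit_wgt f B ->
    l2le unit_wgt g (2 * B) /\ forall n, (g n + Q g n = f n)%C).
  { intros f. destruct (classic (ell2 f)) as [[B0 HB0]|Hn].
    - destruct (neumann Q f B0 Hl Hb HB0) as [g [Hg Eg]]. exists g. intros B HB. split; auto.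
      destruct (neumann Q f B Hl Hb HB) as [g' [Hg' Eg']].
      apply l2le_ext with g'; auto. intros n.
      assert (ell2 g) by (eexists; eauto). assert (ell2 g') by (eexists; eauto).
      assert (E : (g' n - g n)%C = 0%C).
      { apply (neumann_unique Q (fun n => (g' n - g n)%C) Hl Hb).
        - destruct H as [b1 H], H0 as [b2 H0]. eexists. apply l2le_minus; eauto.
        - intros k. rewrite linear_op_minus; auto.
          transitivity ((g' k + Q g' k) - (g k + Q g k))%C; [ring|].
          rewrite Eg, Eg'. ring. }
      transitivity ((g' n - g n) + g n)%C; [ring|]. rewrite E; ring.
    - exists (fun _ => 0%C). intros B HB. exfalso. apply Hn. eexists; eauto. }
  destruct (choice _ H) as [R HR]. exists R.
  assert (HRb : bounded_op R 2) by (intros f B HB; now apply HR).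
  assert (HRe : forall f, ell2 f -> forall n, (R f n + Q (R f) n = f n)%C).
  { intros f [B HB]. now apply (HR f B). }
  split; [|split]; auto.
  intros f g c Hf Hg n.
  assert (HRf := ell2_bdd R 2 f HRb Hf). assert (HRg := ell2_bdd R 2 g HRb Hg).
  assert (Hs : ell2 (fun m => (f m + c * g m)%C)) by (apply ell2_plus; auto; now apply ell2_scal).
  assert (HRs := ell2_bdd R 2 _ HRb Hs).
  assert (Hs' : ell2 (fun m => (R f m + c * R g m)%C)) by (apply ell2_plus; auto; now apply ell2_scal).
  assert (E : (R (fun m => (f m + c * g m)%C) n - (R f n + c * R g n))%C = 0%C).
  { apply (neumann_unique Q (fun n => (R (fun m => (f m + c * g m)%C) n - (R f n + c * R g n))%C) Hl Hb).
    - destruct HRs as [b1 H1], Hs' as [b2 H2]. eexists. apply l2le_minus; eauto.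
    - intros k. rewrite (linear_op_minus Q _ (fun n => (R f n + c * R g n)%C)); auto.
      rewrite Hl; auto.
      transitivity ((R (fun m => (f m + c * g m)%C) k + Q (R (fun m => (f m + c * g m)%C)) k)
         - (R f k + Q (R f) k) - c * (R g k + Q (R g) k))%C; [ring|].
      rewrite !HRe; auto. ring. }
  transitivity ((R (fun m => (f m + c * g m)%C) n - (R f n + c * R g n)) + (R f n + c * R g n))%C; [ring|].
  rewrite E; ring.
Qed.

Definition dirac (j n : nat) : C := if Nat.eqb j n then 1%C else 0%C.

Lemma dirac_l2le j : l2le unit_wgt (dirac j) 1.
Proof.
  split; [lra|]. intros N.
  assert (H : rsum (fun n => unit_wgt n * Cmod (dirac j n) ^ 2) N = if Nat.ltb j N then 1 else 0).
  { induction N; [reflexivity|]. cbn [rsum]. rewrite IHN. unfold unit_wgt, dirac.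
    destruct (Nat.eqb_spec j N); destruct (Nat.ltb_spec j N); destruct (Nat.ltb_spec j (S N)); try lia;
      rewrite ?Cmod_0, ?Cmod_1; ring. }
  rewrite H. destruct (Nat.ltb j N); lra.
Qed.

Lemma csum_dirac y N n : csum (fun j => (y j * dirac j n)%C) N = if Nat.ltb n N then y n else 0%C.
Proof.
  induction N; [reflexivity|]. cbn [csum]. rewrite IHN. unfold dirac.
  destruct (Nat.eqb_spec N n); destruct (Nat.ltb_spec n N); destruct (Nat.ltb_spec n (S N)); try lia; subst; ring.
Qed.

Lemma csum_dirac_l2le y N : l2le unit_wgt (fun n => csum (fun j => (y j * dirac j n)%C) N) (rsum (fun j => Cmod (y j)) N).
Proof.
  induction N; simpl; [apply l2le_zero; lra|]. apply l2le_plus; auto.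
  replace (Cmod (y N)) with (Cmod (y N) * 1) by ring. apply l2le_scal, dirac_l2le.
Qed.

(* If the rows of T beyond N are small, 1 + T is a finite-rank perturbation of an invertible operator,
   so that solving reduces to an N x N system. *)
Lemma fredholm T K N : linear_op T -> bounded_op T K -> 0 <= K ->
  bounded_op (fun f n => if Nat.ltb n N then 0%C else T f n) (1 / 2) ->
  (forall g, ell2 g -> (forall n, (g n + T g n = 0)%C) -> forall n, g n = 0%C) ->
  exists K', 0 <= K' /\ forall f B, l2le unit_wgt f B ->
    exists g, l2le unit_wgt g (K' * B) /\ forall n, (g n + T g n = f n)%C.
Proof.
  intros HT HTb HK HQb Hinj. set (Q := fun (f : nat -> C) n => if Nat.ltb n N then RtoC 0 else T f n) in *.
  assert (HQ : linear_op Q).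
  { intros f g c Hf Hg n. unfold Q. destruct (Nat.ltb n N); [ring|now apply HT]. }
  destruct (neumann_inv Q HQ HQb) as [R [HR [HRb HRe]]].
  set (TR := fun f => T (R f)).
  assert (HTR : linear_op TR).
  { intros f g c Hf Hg n. unfold TR.
    rewrite (op_ext T _ (fun m => (R f m + c * R g m)%C)); [|now apply HR].
    apply HT; eapply ell2_bdd; eauto. }
  assert (Hd : forall j, ell2 (dirac j)) by (intros j; eexists; apply dirac_l2le).
  set (fin := fun y n => csum (fun j => (y j * dirac j n)%C) N).
  assert (Hfin : forall y, ell2 (fin y)) by (intros; now apply ell2_csum).
  assert (HfinE : forall y n, fin y n = if Nat.ltb n N then y n else 0%C) by (intros; apply csum_dirac).
  (* For g = R (f - fin y) the equation g + T g = f holds beyond N whatever y is. Below N, where Q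
     vanishes, it reads y + TR (fin y) = TR f, an N x N system with matrix A. *)
  set (A := fun i j => (dirac i j + TR (dirac j) i)%C).
  assert (HA : forall y i, (i < N)%nat -> csum (fun j => (A i j * y j)%C) N = (y i + TR (fin y) i)%C).
  { intros y i Hi. unfold A. change (fin y) with (fun n => csum (fun j => (y j * dirac j n)%C) N). rewrite (linear_op_csum TR dirac); auto.
    rewrite (csum_ext _ (fun j => (y j * dirac j i + y j * TR (dirac j) i)%C)).
    - rewrite csum_plus, csum_dirac. destruct (Nat.ltb_spec i N); [ring|lia].
    - intros j _. unfold dirac at 1 3. rewrite (Nat.eqb_sym i j). ring. }
  assert (HAinj : forall y, (forall i, (i < N)%nat -> csum (fun j => (A i j * y j)%C) N = 0%C) ->
     forall j, (j < N)%nat -> y j = 0%C).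
  { intros y Hy.
    assert (Hg : forall n, R (fin y) n = 0%C).
    { apply Hinj; [eapply ell2_bdd; eauto|]. intros n.
      assert (E := HRe (fin y) (Hfin y) n). rewrite HfinE in E. unfold Q in E.
      destruct (Nat.ltb_spec n N) as [Hn|Hn].
      - generalize (Hy n Hn). rewrite HA; auto. unfold TR. intros E'.
        rewrite <- E'. rewrite <- E. fold (fin y). ring.
      - exact E. }
    intros j Hj.
    assert (E := HRe (fin y) (Hfin y) j). rewrite Hg in E.
    rewrite (op_ext Q _ (fun _ => 0%C) Hg), linear_op_zero in E; auto.
    rewrite HfinE in E. destruct (Nat.ltb_spec j N); [|lia].
    rewrite <- E. ring. }
  (* The system is solved for unit vectors once and for all: X is the inverse matrix, and its
     entries give a bound independent of f. *)
  assert (HX : exists X : nat -> nat -> C, forall l i, (i < N)%nat ->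
     csum (fun j => (A i j * X l j)%C) N = dirac l i).
  { apply (choice (fun l x => forall i, (i < N)%nat -> csum (fun j => (A i j * x j)%C) N = dirac l i)).
    intros l. exact (injective_system_solvable N A HAinj (dirac l)). }
  destruct HX as [X HX].
  set (S1 := rsum (fun j => rsum (fun l => Cmod (X l j)) N) N).
  assert (HS1 : 0 <= S1).
  { unfold S1. apply rsum_ge0; intros; apply rsum_ge0; intros; apply Cmod_ge_0. }
  exists (2 * (1 + S1 * (K * 2))). split; [nra|]. intros f B Hf.
  assert (HB : 0 <= B) by apply Hf. assert (HfL : ell2 f) by (eexists; eauto).
  set (b := TR f).
  assert (Hb : l2le unit_wgt b (K * (2 * B))) by (apply HTb, HRb, Hf).
  set (y := fun j => csum (fun l => (b l * X l j)%C) N).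
  assert (Hy : forall i, (i < N)%nat -> (y i + TR (fin y) i = b i)%C).
  { intros i Hi. rewrite <- HA; auto. unfold y.
    rewrite (csum_ext _ (fun j => csum (fun l => (b l * (A i j * X l j))%C) N)).
    - rewrite csum_swap. rewrite (csum_ext _ (fun l => (b l * dirac l i)%C)).
      + rewrite csum_dirac. destruct (Nat.ltb_spec i N); [auto|lia].
      + intros l _. rewrite csum_scal, HX; auto.
    - intros j _. rewrite <- csum_scal. apply csum_ext; intros; ring. }
  assert (Hyb : l2le unit_wgt (fin y) (S1 * (K * (2 * B)))).
  { eapply l2le_weaken; [|apply csum_dirac_l2le]. unfold S1. rewrite Rmult_comm, <- rsum_scal.
    apply rsum_le; intros j _. unfold y. eapply Rle_trans; [apply csum_mod|].
    rewrite <- rsum_scal. apply rsum_le; intros l _. rewrite Cmod_mult.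
    apply Rmult_le_compat_r; [apply Cmod_ge_0|]. now apply l2le_coord. }
  exists (R (fun n => (f n - fin y n)%C)). split.
  - replace (2 * (1 + S1 * (K * 2)) * B) with (2 * (B + S1 * (K * (2 * B)))) by ring.
    apply HRb. apply l2le_minus; auto.
  - intros n.
    assert (HL : ell2 (fun n => (f n - fin y n)%C)) by (eexists; apply l2le_minus; eauto).
    assert (E := HRe _ HL n). unfold Q in E. rewrite HfinE in E.
    destruct (Nat.ltb_spec n N) as [Hn|Hn]; [|rewrite E; ring].
    change (T (R (fun n0 => (f n0 - fin y n0)%C)) n) with (TR (fun n0 => (f n0 - fin y n0)%C) n).
    rewrite (linear_op_minus TR); auto. change (TR f n) with (b n).
    replace (b n) with (y n + TR (fin y) n)%C by auto.
    transitivity ((R (fun n0 => (f n0 - fin y n0)%C) n + 0) + y n)%C; [ring|].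
    rewrite E. ring.
Qed.

(** * The primitive operator on sine series *)

Lemma kk_ge1 n : 1 <= kk n.
Proof. unfold kk. rewrite S_INR. generalize (pos_INR n); lra. Qed.
Lemma kk_pos n : 0 < kk n.
Proof. generalize (kk_ge1 n); lra. Qed.
Lemma kk_S n : kk (S n) = kk n + 1.
Proof. unfold kk. rewrite (S_INR (S n)). ring. Qed.

Lemma ln_le_sub1 y : 0 < y -> ln y <= y - 1.
Proof.
  intros H. destruct (Req_dec y 1) as [->|Hn]; [rewrite ln_1; lra|].
  assert (ln y <> 0).
  { intros E. apply Hn. rewrite <- (exp_ln y), E, exp_0; auto. }
  generalize (exp_ineq1 (ln y) H0). rewrite exp_ln; auto. lra.
Qed.
Lemma exp_ge x : 1 + x <= exp x.
Proof. destruct (Req_dec x 0) as [->|H]; [rewrite exp_0; lra|left; now apply exp_ineq1]. Qed.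

Lemma Rpower_pos x p : 0 < Rpower x p.
Proof. apply exp_pos. Qed.
#[global] Hint Resolve Rpower_pos kk_ge1 kk_pos : core.

Definition kpow n p := Rpower (kk n) p.

Lemma kpow_pos n p : 0 < kpow n p. Proof. apply exp_pos. Qed.
Lemma kpow_plus n p q : kpow n (p + q) = kpow n p * kpow n q.
Proof. apply Rpower_plus. Qed.
Lemma kpow_1 n : kpow n 1 = kk n. Proof. apply Rpower_1; auto. Qed.
Lemma kpow_0 n : kpow n 0 = 1. Proof. apply Rpower_O; auto. Qed.
Lemma kpow_m1 n : kpow n (-1) = / kk n.
Proof. unfold kpow. replace (-1) with (- (1)) by ring. rewrite Rpower_Ropp, Rpower_1; auto. Qed.
Lemma kpow_2 n : kpow n 2 = kk n ^ 2.
Proof. replace 2 with (1 + 1) by ring. rewrite kpow_plus, kpow_1. ring. Qed.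
Lemma kpow_m2 n : kpow n (-2) = / kk n ^ 2.
Proof. unfold kpow. replace (-2) with (- (2)) by ring. rewrite Rpower_Ropp. now rewrite <- kpow_2. Qed.
Lemma kpow_le n p q : p <= q -> kpow n p <= kpow n q.
Proof. intros H. apply Rle_Rpower; auto. Qed.
Lemma kpow_ge1 n p : 0 <= p -> 1 <= kpow n p.
Proof. intros H. rewrite <- (kpow_0 n). now apply kpow_le. Qed.

Lemma kpow_first p : kpow 0 p = 1.
Proof. unfold kpow, kk, Rpower. simpl INR. rewrite ln_1, Rmult_0_r, exp_0. reflexivity. Qed.

(** Comparison with an integral, done by induction: with r = q - 1, the bound is 1 plus the integral
    of x^(-q) from 1 to the last k. *)
Lemma p_series_bounded q : 1 < q -> exists Z, 0 < Z /\ forall N, rsum (fun n => kpow n (- q)) N <= Z.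
Proof.
  intros Hq. set (r := q - 1). assert (Hr : 0 < r) by (unfold r; lra).
  assert (K : forall N, rsum (fun n => kpow n (- q)) (S N) <= 1 + (1 - kpow N (- r)) / r).
  { induction N.
    - simpl. rewrite !kpow_first. replace ((1 - 1) / r) with 0 by (field; lra). lra.
    - cbn [rsum] in *.
      assert (Hx : 0 < kk N) by auto.
      (* Passing from x = k + 1 to k multiplies x^(-r) by exp (- r ln ((x - 1) / x)), which is at
         least 1 + r / x because ln y <= y - 1 and exp t >= 1 + t. *)
      assert (E : kpow N (- r) >= kpow (S N) (- r) * (1 + r / kk (S N))).
      { unfold kpow. set (x := kk (S N)). assert (Hx1 : kk N = x * ((x - 1) / x)).
        { unfold x. rewrite kk_S. field. lra. }
        assert (1 < x) by (unfold x; rewrite kk_S; lra).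
        assert (0 < (x - 1) / x) by (apply Rdiv_lt_0_compat; lra).
        rewrite Hx1, <- Rpower_mult_distr; try lra.
        apply Rle_ge, Rmult_le_compat_l; [left; auto|].
        unfold Rpower. eapply Rle_trans; [|apply exp_ge].
        assert (L := ln_le_sub1 _ H0). replace ((x - 1) / x - 1) with (- / x) in L by (field; lra).
        unfold Rdiv. nra. }
      assert (E2 : kpow (S N) (- q) = kpow (S N) (- r) * / kk (S N)).
      { rewrite <- kpow_m1, <- kpow_plus. f_equal. unfold r; ring. }
      rewrite E2.
      apply Rle_trans with (1 + (1 - kpow N (- r)) / r + kpow (S N) (- r) * / kk (S N)); [lra|].
      apply Rmult_le_reg_l with r; auto.
      replace (r * (1 + (1 - kpow N (- r)) / r + kpow (S N) (- r) * / kk (S N)))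
        with (r + 1 - kpow N (- r) + kpow (S N) (- r) * (r / kk (S N))) by (field; split; [generalize (kk_pos (S N)); lra|lra]).
      replace (r * (1 + (1 - kpow (S N) (- r)) / r)) with (r + 1 - kpow (S N) (- r)) by (field; lra).
      lra. }
  exists (1 + 1 / r). assert (0 < 1 / r) by (apply Rdiv_lt_0_compat; lra).
  split; [lra|]. intros N. destruct N; [simpl; lra|].
  eapply Rle_trans; [apply K|]. assert (0 < kpow N (- r)) by apply kpow_pos.
  unfold Rdiv. assert (0 < / r) by (apply Rinv_0_lt_compat; lra). nra.
Qed.

(** * Kernels depending on the distance of two indices *)

Lemma rsum_split f n m : rsum f (n + m) = rsum f n + rsum (fun i => f (n + i)%nat) m.
Proof.
  induction m; [rewrite Nat.add_0_r; simpl; ring|].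
  rewrite Nat.add_succ_r. cbn [rsum]. rewrite IHm. ring.
Qed.

Lemma rsum_rev f N : rsum (fun n => f (N - 1 - n)%nat) N = rsum f N.
Proof.
  revert f. induction N; intros f; [reflexivity|].
  cbn [rsum]. replace (S N - 1 - N)%nat with O by lia.
  rewrite (rsum_ext _ (fun n => (fun i => f (S i)) (N - 1 - n)%nat)).
  - rewrite (IHN (fun i => f (S i))). change (rsum f N + f N) with (rsum f (S N)).
    change (S N) with (1 + N)%nat. rewrite (rsum_split f 1 N). simpl. ring.
  - intros n Hn. f_equal. lia.
Qed.

(** Vanishes on the diagonal and depends on |j - n| only. The argument is |j - n| - 1 because [kk]
    shifts by one: [kk] of it is the distance itself. *)
Definition dist_kernel (h : nat -> R) (j n : nat) : R :=
  if Nat.ltb n j then h (j - 1 - n)%nat else if Nat.ltb j n then h (n - 1 - j)%nat else 0.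

Lemma dist_kernel_sym h j n : dist_kernel h j n = dist_kernel h n j.
Proof.
  unfold dist_kernel. destruct (Nat.ltb_spec n j), (Nat.ltb_spec j n); auto; lia.
Qed.

Lemma dist_kernel_sum h Z j N : (forall n, 0 <= h n) -> (forall N, rsum h N <= Z) ->
  rsum (dist_kernel h j) N <= 2 * Z.
Proof.
  intros Hh HZ.
  apply Rle_trans with (rsum (dist_kernel h j) (j + (1 + N))).
  - apply rsum_mono; [|lia]. intros n. unfold dist_kernel.
    destruct (Nat.ltb n j), (Nat.ltb j n); auto; lra.
  - rewrite rsum_split, rsum_split.
    rewrite (rsum_ext _ (fun n => h (j - 1 - n)%nat) j).
    + rewrite rsum_rev. rewrite (rsum_ext (fun i => dist_kernel h j (j + (1 + i))) h).
      * cbn [rsum]. unfold dist_kernel. rewrite Nat.add_0_r, Nat.ltb_irrefl.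
        generalize (HZ j) (HZ N). lra.
      * intros n _. unfold dist_kernel. destruct (Nat.ltb_spec (j + (1 + n)) j); [lia|].
        destruct (Nat.ltb_spec j (j + (1 + n))); [|lia]. f_equal; lia.
    + intros n Hn. unfold dist_kernel. destruct (Nat.ltb_spec n j); [auto|lia].
Qed.

Definition inv_dist := dist_kernel (fun m => / kk m).

Lemma kk_sub n m : (m < n)%nat -> kk (n - 1 - m) = kk n - kk m.
Proof.
  intros H. unfold kk. rewrite <- minus_INR by lia. f_equal. lia.
Qed.

Lemma inv_dist_spec j n : j <> n -> inv_dist j n = / Rabs (kk j - kk n).
Proof.
  intros H. unfold inv_dist, dist_kernel.
  destruct (Nat.ltb_spec n j); [|destruct (Nat.ltb_spec j n); [|lia]].
  - rewrite kk_sub by lia. rewrite Rabs_pos_eq; auto.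
    rewrite <- kk_sub by lia. left; auto.
  - rewrite kk_sub by lia. rewrite Rabs_minus_sym, Rabs_pos_eq; auto.
    rewrite <- kk_sub by lia. left; auto.
Qed.
Lemma inv_dist_diag n : inv_dist n n = 0.
Proof. unfold inv_dist, dist_kernel. now rewrite Nat.ltb_irrefl. Qed.
Lemma inv_dist_ge0 j n : 0 <= inv_dist j n.
Proof.
  unfold inv_dist, dist_kernel. destruct (Nat.ltb n j), (Nat.ltb j n); try lra; left; apply Rinv_0_lt_compat; auto.
Qed.

(** * Sine coefficients of the primitive of e_k *)

Lemma ex_derive_contR (f : R -> R) x : ex_derive f x -> @continuous R_UniformSpace R_UniformSpace f x.
Proof. apply (ex_derive_continuous f x). Qed.

Definition freq a n := kk n * PI / a.
Definition amp a := sqrt (2 / a).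
Definition ek_int a n z := amp a / freq a n * (1 - cos (freq a n * z)).

Lemma freq_pos a n : 0 < a -> 0 < freq a n.
Proof. intros. unfold freq. apply Rdiv_lt_0_compat; auto. apply Rmult_lt_0_compat; auto. apply PI_RGT_0. Qed.

Lemma ek_freq a n z : 0 < a -> ek a (S n) z = amp a * sin (freq a n * z).
Proof. intros. unfold ek, freq, kk, amp. f_equal. f_equal. field. lra. Qed.

Lemma amp_sq a : 0 < a -> amp a * amp a = 2 / a.
Proof. intros. apply sqrt_sqrt. left; apply Rdiv_lt_0_compat; lra. Qed.
Lemma amp_pos a : 0 < a -> 0 < amp a.
Proof. intros. apply sqrt_lt_R0. apply Rdiv_lt_0_compat; lra. Qed.

Lemma ek_int_is_RInt a n z : 0 < a -> is_RInt (ek a (S n)) 0 z (ek_int a n z).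
Proof.
  intros Ha. assert (H := freq_pos a n Ha).
  apply is_RInt_ext with (fun z => amp a * sin (freq a n * z)); [intros; symmetry; now apply ek_freq|].
  replace (ek_int a n z) with (minus (ek_int a n z) (ek_int a n 0)).
  - apply (is_RInt_derive (ek_int a n)).
    + intros x _. unfold ek_int. auto_derive; auto. field. lra.
    + intros x _. apply ex_derive_contR. auto_derive. auto.
  - unfold minus, plus, opp; simpl. unfold ek_int. rewrite Rmult_0_r, cos_0. ring.
Qed.

Lemma one_coef_E a n : 0 < a -> one_coef a n = ek_int a n a.
Proof. intros. apply is_RInt_unique. now apply ek_int_is_RInt. Qed.

Lemma cc_E a j n : 0 < a -> cc a j n = RInt (fun z => ek_int a n z * ek a (S j) z) 0 a.
Proof.
  intros Ha. apply RInt_ext. intros z _. f_equal. apply is_RInt_unique. now apply ek_int_is_RInt.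
Qed.

Lemma cos_diff_le x y : Rabs (cos x - cos y) <= 2.
Proof. generalize (COS_bound x) (COS_bound y). intros. apply Rabs_le; lra. Qed.

Lemma one_coef_bound a n : 0 < a -> Rabs (one_coef a n) <= 2 * amp a * a / PI / kk n.
Proof.
  intros Ha. rewrite one_coef_E; auto. unfold ek_int. rewrite Rabs_mult.
  assert (H := freq_pos a n Ha). assert (H2 := amp_pos a Ha). assert (P := PI_RGT_0).
  replace (2 * amp a * a / PI / kk n) with (amp a / freq a n * 2)
    by (unfold freq; field; repeat split; try lra; generalize (kk_pos n); lra).
  rewrite Rabs_pos_eq; [|left; now apply Rdiv_lt_0_compat].
  apply Rmult_le_compat_l; [left; now apply Rdiv_lt_0_compat|].
  replace 1 with (cos 0) by apply cos_0. apply cos_diff_le.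
Qed.

Lemma one_coef_first a : 0 < a -> one_coef a 0 = 2 * amp a * a / PI.
Proof.
  intros Ha. rewrite one_coef_E; auto. unfold ek_int, freq, kk. simpl INR. assert (P := PI_RGT_0).
  replace (1 * PI / a * a) with PI by (field; lra). rewrite cos_PI. field. split; lra.
Qed.

(** The integrand on the left is the derivative of the product of the two primitives, which vanishes
    at 0. *)
Lemma cc_antisym a j n : 0 < a -> cc a j n + cc a n j = one_coef a j * one_coef a n.
Proof.
  intros Ha. rewrite !cc_E; auto.
  assert (Hc : forall j n, is_RInt (fun z => ek_int a n z * ek a (S j) z) 0 a (RInt (fun z => ek_int a n z * ek a (S j) z) 0 a)).
  { intros j0 n0. apply (RInt_correct (V := R_CompleteNormedModule)).
    apply (ex_RInt_continuous (V := R_CompleteNormedModule)). intros z _.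
    apply ex_derive_contR. unfold ek_int, ek. auto_derive. auto. }
  assert (H := is_RInt_plus _ _ _ _ _ _ (Hc j n) (Hc n j)).
  apply (is_RInt_unique (V := R_CompleteNormedModule)) in H. change (RInt (fun z => ek_int a n z * ek a (S j) z) 0 a + RInt (fun z => ek_int a j z * ek a (S n) z) 0 a) with (plus (RInt (fun z => ek_int a n z * ek a (S j) z) 0 a) (RInt (fun z => ek_int a j z * ek a (S n) z) 0 a)). etransitivity; [symmetry; exact H|].
  apply is_RInt_unique. rewrite !one_coef_E; auto.
  replace (ek_int a j a * ek_int a n a) with (minus (ek_int a j a * ek_int a n a) (ek_int a j 0 * ek_int a n 0)).
  - apply (is_RInt_derive (fun z => ek_int a j z * ek_int a n z)).
    + intros x _. assert (H1 := freq_pos a n Ha). assert (H2 := freq_pos a j Ha).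
      rewrite !ek_freq; auto. unfold ek_int. auto_derive; auto.
      unfold plus; simpl. field. lra.
    + intros x _. apply ex_derive_contR. unfold ek_int, ek, plus; simpl. auto_derive. auto.
  - unfold minus, plus, opp; simpl. unfold ek_int. rewrite !Rmult_0_r, !cos_0. ring.
Qed.

Lemma sin_int_bound s a : s <> 0 -> Rabs (cos (s * a) / s - cos (s * 0) / s) <= 2 / Rabs s.
Proof.
  intros Hs. replace (cos (s * a) / s - cos (s * 0) / s) with ((cos (s * a) - cos (s * 0)) * / s) by (field; auto).
  rewrite Rabs_mult, Rabs_inv. unfold Rdiv. apply Rmult_le_compat_r.
  - left; apply Rinv_0_lt_compat, Rabs_pos_lt; auto.
  - apply cos_diff_le.
Qed.

Definition cc_const (a : R) := 6 * a / PI ^ 2.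
Lemma cc_const_pos a : 0 < a -> 0 < cc_const a.
Proof. intros. unfold cc_const. apply Rdiv_lt_0_compat; [lra|]. apply pow_lt, PI_RGT_0. Qed.

(** The product (1 - cos) sin is a combination of sines with frequencies freq j, freq n + freq j and
    freq j - freq n, and a sine of frequency s has integral at most 2 / |s|. The first two give 1 /
    k_j, the last gives [inv_dist]. *)
Lemma cc_bound a j n : 0 < a -> Rabs (cc a j n) <= cc_const a / kk n * (/ kk j + inv_dist j n).
Proof.
  intros Ha. rewrite cc_E; auto.
  assert (Hn := freq_pos a n Ha). assert (Hj := freq_pos a j Ha).
  assert (P := PI_RGT_0). assert (Kj := kk_pos j). assert (Kn := kk_pos n).
  set (I := fun s z => cos (s * z) / s).
  (* Common end of both cases; d is the contribution of the frequency difference, absent for j = n.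
     The constant 6 a / PI^2 is 2 / PI, from amp^2 / freq, times 3 a / PI. *)
  assert (Hfin : forall A d, A = minus (I (freq a n + freq a j) a) (I (freq a n + freq a j) 0) / 2 -
      minus (I (freq a j) a) (I (freq a j) 0) + d -> Rabs d <= a / PI * inv_dist j n ->
      Rabs (amp a / freq a n * amp a * A) <= cc_const a / kk n * (/ kk j + inv_dist j n)).
  { intros A d EA Hd.
    replace (amp a / freq a n * amp a) with (2 / PI / kk n).
    2:{ transitivity (amp a * amp a / freq a n); [|field; lra]. rewrite amp_sq; auto. unfold freq. field. repeat split; lra. }
    rewrite Rabs_mult.
    assert (Hc : 0 < 2 / PI / kk n) by (repeat apply Rdiv_lt_0_compat; lra).
    rewrite Rabs_pos_eq; [|lra].
    replace (cc_const a / kk n * (/ kk j + inv_dist j n)) with (2 / PI / kk n * (3 * a / PI * (/ kk j + inv_dist j n)))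
      by (unfold cc_const; field; repeat split; lra).
    apply Rmult_le_compat_l; [lra|]. rewrite EA.
    assert (B1 : Rabs (minus (I (freq a n + freq a j) a) (I (freq a n + freq a j) 0)) <= 2 * a / PI / kk j).
    { eapply Rle_trans; [apply (sin_int_bound (freq a n + freq a j) a); lra|].
      rewrite Rabs_pos_eq; [|lra].
      apply Rle_trans with (2 / freq a j).
      - unfold Rdiv. apply Rmult_le_compat_l; [lra|]. apply Rinv_le_contravar; lra.
      - right. unfold freq. field. repeat split; lra. }
    assert (B2 : Rabs (minus (I (freq a j) a) (I (freq a j) 0)) <= 2 * a / PI / kk j).
    { eapply Rle_trans; [apply (sin_int_bound (freq a j) a); lra|].
      rewrite Rabs_pos_eq; [|lra]. right. unfold freq. field. repeat split; lra. }
    assert (D := inv_dist_ge0 j n).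
    assert (0 < a / PI) by (apply Rdiv_lt_0_compat; lra).
    replace (3 * a / PI * (/ kk j + inv_dist j n)) with (2 * a / PI / kk j + 2 * a / PI / kk j / 2 + 3 * (a / PI) * inv_dist j n) by (field; split; lra).
    revert B1 B2 Hd. generalize (minus (I (freq a n + freq a j) a) (I (freq a n + freq a j) 0)) (minus (I (freq a j) a) (I (freq a j) 0)).
    intros x y B1 B2 Hd.
    apply Rabs_le_between in B1. apply Rabs_le_between in B2. apply Rabs_le_between in Hd.
    assert (0 <= a / PI * inv_dist j n) by (apply Rmult_le_pos; lra).
    apply Rabs_le. lra. }
  assert (HI : forall s, s <> 0 -> is_RInt (fun z => - sin (s * z)) 0 a (minus (I s a) (I s 0))).
  { intros s Hs. apply (is_RInt_derive (I s)).
    - intros x _. unfold I. auto_derive; auto. field. auto.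
    - intros x _. apply ex_derive_contR. auto_derive. auto. }
  assert (Hmain : forall A, is_RInt (fun z => (1 - cos (freq a n * z)) * sin (freq a j * z)) 0 a A ->
     RInt (fun z => ek_int a n z * ek a (S j) z) 0 a = amp a / freq a n * amp a * A).
  { intros A HA. apply is_RInt_unique.
    apply is_RInt_ext with (fun z => scal (amp a / freq a n * amp a) ((1 - cos (freq a n * z)) * sin (freq a j * z))).
    - intros x _. rewrite ek_freq; auto. unfold ek_int, scal; simpl. unfold mult; simpl. ring.
    - apply (is_RInt_scal (V := R_NormedModule)). exact HA. }
  destruct (Nat.eq_dec j n) as [->|Hne].
  - rewrite (Hmain (minus (I (freq a n + freq a n) a) (I (freq a n + freq a n) 0) / 2 - minus (I (freq a n) a) (I (freq a n) 0))).
    + apply (Hfin _ 0); [ring|]. rewrite Rabs_R0, inv_dist_diag. lra.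
    + apply is_RInt_ext with (fun z => minus (scal (/ 2) (- sin ((freq a n + freq a n) * z))) (- sin (freq a n * z))).
      * intros x _. unfold minus, plus, opp, scal; simpl. unfold mult; simpl.
        replace ((freq a n + freq a n) * x) with (2 * (freq a n * x)) by ring. rewrite sin_2a. field.
      * replace (_ / 2 - _) with (minus (scal (/ 2) (minus (I (freq a n + freq a n) a) (I (freq a n + freq a n) 0))) (minus (I (freq a n) a) (I (freq a n) 0))).
        -- apply (is_RInt_minus (V := R_NormedModule)); [apply (is_RInt_scal (V := R_NormedModule))|]; apply HI; lra.
        -- unfold minus, plus, opp, scal; simpl. unfold mult; simpl. field.
  - assert (Hd : freq a j - freq a n <> 0).
    { unfold freq. replace (kk j * PI / a - kk n * PI / a) with ((kk j - kk n) * (PI / a)) by (field; lra).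
      apply Rmult_integral_contrapositive_currified.
      - intros E. apply Hne. unfold kk in E. apply Rminus_diag_uniq in E. apply INR_eq in E. lia.
      - apply Rgt_not_eq, Rdiv_lt_0_compat; lra. }
    rewrite (Hmain (minus (I (freq a n + freq a j) a) (I (freq a n + freq a j) 0) / 2 - minus (I (freq a j) a) (I (freq a j) 0)
        + minus (I (freq a j - freq a n) a) (I (freq a j - freq a n) 0) / 2)).
    + apply (Hfin _ (minus (I (freq a j - freq a n) a) (I (freq a j - freq a n) 0) / 2)); [ring|].
      rewrite inv_dist_spec; auto.
      unfold Rdiv at 1. rewrite Rabs_mult, (Rabs_pos_eq (/ 2)) by lra.
      apply Rle_trans with (2 / Rabs (freq a j - freq a n) * / 2).
      * apply Rmult_le_compat_r; [lra|]. apply sin_int_bound; auto.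
      * unfold freq. replace (kk j * PI / a - kk n * PI / a) with ((kk j - kk n) * (PI / a)) by (field; lra).
        rewrite Rabs_mult, (Rabs_pos_eq (PI / a)); [|left; apply Rdiv_lt_0_compat; lra].
        right. field. repeat split; try lra. apply Rabs_no_R0.
        intros E. apply Hne. unfold kk in E. apply Rminus_diag_uniq in E. apply INR_eq in E. lia.
    + apply is_RInt_ext with (fun z => plus (minus (scal (/ 2) (- sin ((freq a n + freq a j) * z))) (- sin (freq a j * z)))
           (scal (/ 2) (- sin ((freq a j - freq a n) * z)))).
      * intros x _. unfold minus, plus, opp, scal; simpl. unfold mult; simpl.
        rewrite !Rmult_plus_distr_r. rewrite Rmult_minus_distr_r, sin_plus, sin_minus. field.
      * replace (_ / 2 - _ + _) with (plus (minus (scal (/ 2) (minus (I (freq a n + freq a j) a) (I (freq a n + freq a j) 0))) (minus (I (freq a j) a) (I (freq a j) 0)))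
           (scal (/ 2) (minus (I (freq a j - freq a n) a) (I (freq a j - freq a n) 0)))).
        -- apply (is_RInt_plus (V := R_NormedModule)); [apply (is_RInt_minus (V := R_NormedModule)); [apply (is_RInt_scal (V := R_NormedModule))|]|apply (is_RInt_scal (V := R_NormedModule))]; apply HI; lra.
        -- unfold minus, plus, opp, scal; simpl. unfold mult; simpl. field.
Qed.

(** * Sobolev weights and Hilbert-Schmidt bounds for the primitive *)

Definition wbase nu zeta n := 1 + nu * kk n ^ 2 + nu * zabs zeta ^ 2.

Lemma wgt_wbase nu s zeta n : wgt nu s zeta n = Rpower (wbase nu zeta n) s.
Proof. reflexivity. Qed.
Lemma wgt_pos nu s zeta n : 0 < wgt nu s zeta n.
Proof. apply exp_pos. Qed.
#[global] Hint Resolve wgt_pos : core.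
Lemma wgt_ge0 nu s zeta n : 0 <= wgt nu s zeta n.
Proof. left; auto. Qed.
#[global] Hint Resolve wgt_ge0 : core.

Lemma wbase_ge1 nu zeta n : 0 < nu -> 1 <= wbase nu zeta n.
Proof.
  intros H. unfold wbase. assert (0 <= kk n ^ 2) by apply pow2_ge_0.
  assert (0 <= zabs zeta ^ 2) by apply pow2_ge_0. nra.
Qed.

Lemma wbase_ratio nu zeta j n : 0 < nu -> wbase nu zeta j <= kk j ^ 2 * wbase nu zeta n.
Proof.
  intros H. unfold wbase. assert (1 <= kk j ^ 2) by (generalize (kk_ge1 j); nra).
  assert (1 <= kk n ^ 2) by (generalize (kk_ge1 n); nra).
  assert (0 <= zabs zeta ^ 2) by apply pow2_ge_0.
  set (x := kk j ^ 2) in *. set (y := kk n ^ 2) in *. set (z := zabs zeta ^ 2) in *.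
  assert (0 <= nu * z) by nra. assert (nu <= nu * y) by nra.
  assert (x * nu <= x * (nu * y)) by (apply Rmult_le_compat_l; lra). nra.
Qed.

Lemma Rpower_kk2 n s : Rpower (kk n ^ 2) s = kpow n (2 * s).
Proof. rewrite <- kpow_2. unfold kpow. now rewrite Rpower_mult. Qed.

(** Moves the weight from the output index j to the input index n uniformly in zeta. The price is a
    power of k_j for s >= 0, to be absorbed by the decay in j, and a power of k_n for s < 0. *)
Lemma wgt_ratio nu s zeta j n : 0 < nu ->
  wgt nu s zeta j <= wgt nu s zeta n * (if Rle_dec 0 s then kpow j (2 * s) else kpow n (2 * - s)).
Proof.
  intros H. rewrite !wgt_wbase.
  assert (Pj := wbase_ge1 nu zeta j H). assert (Pn := wbase_ge1 nu zeta n H).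
  assert (Qj : 0 < kk j ^ 2) by (apply pow_lt; auto).
  assert (Qn : 0 < kk n ^ 2) by (apply pow_lt; auto).
  destruct (Rle_dec 0 s).
  - rewrite <- Rpower_kk2, Rpower_mult_distr; try lra.
    apply Rle_Rpower_l; auto. rewrite (Rmult_comm (wbase nu zeta n)). split; [lra|now apply wbase_ratio].
  - replace s with (- (- s)) at 1 2 by ring.
    assert (E : Rpower (wbase nu zeta n) (- s) <= kpow n (2 * - s) * Rpower (wbase nu zeta j) (- s)).
    { rewrite <- Rpower_kk2, Rpower_mult_distr; try lra.
      apply Rle_Rpower_l; [lra|]. split; [lra|now apply wbase_ratio]. }
    rewrite !(Rpower_Ropp _ (- s)).
    assert (A := Rpower_pos (wbase nu zeta n) (- s)). assert (B := Rpower_pos (wbase nu zeta j) (- s)).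
    apply Rmult_le_reg_l with (Rpower (wbase nu zeta n) (- s)); auto.
    apply Rmult_le_reg_r with (Rpower (wbase nu zeta j) (- s)); auto.
    replace (Rpower (wbase nu zeta n) (- s) * / Rpower (wbase nu zeta j) (- s) * Rpower (wbase nu zeta j) (- s))
      with (Rpower (wbase nu zeta n) (- s)) by (field; lra).
    replace (Rpower (wbase nu zeta n) (- s) * (/ Rpower (wbase nu zeta n) (- s) * kpow n (2 * - s)) * Rpower (wbase nu zeta j) (- s))
      with (kpow n (2 * - s) * Rpower (wbase nu zeta j) (- s)) by (field; lra). exact E.
Qed.

Lemma inv_dist_sq j n : inv_dist j n ^ 2 = dist_kernel (fun m => kpow m (-2)) j n.
Proof.
  unfold inv_dist, dist_kernel. destruct (Nat.ltb n j), (Nat.ltb j n); rewrite ?kpow_m2, ?pow_inv; auto; ring.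
Qed.

(** Off the diagonal k_j <= k_n + d <= 2 k_n d with d = |j - n|, so the power of k_j is traded for
    one of k_n and a slower decay in d, still summable for s < 1/2. *)
Lemma kpow_inv_dist j n s : 0 <= s -> kpow j (2 * s) * inv_dist j n ^ 2 <= Rpower 4 s * kpow n (2 * s) * dist_kernel (fun m => kpow m (- (2 - 2 * s))) j n.
Proof.
  intros Hs. rewrite inv_dist_sq. unfold dist_kernel.
  assert (K : forall m, kk j <= 2 * kk n * kk m ->
    kpow j (2 * s) * kpow m (-2) <= Rpower 4 s * kpow n (2 * s) * kpow m (- (2 - 2 * s))).
  { intros m Hm. replace (- (2 - 2 * s)) with (2 * s + -2) by ring. rewrite kpow_plus.
    rewrite <- Rmult_assoc. apply Rmult_le_compat_r; [left; apply kpow_pos|].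
    rewrite <- !Rpower_kk2.
    assert (0 < kk j ^ 2) by (apply pow_lt; auto).
    assert (0 < kk m ^ 2) by (apply pow_lt; auto).
    assert (0 < kk n ^ 2) by (apply pow_lt; auto).
    rewrite !Rpower_mult_distr; try lra.
    apply Rle_Rpower_l; auto. split; auto.
    replace (4 * kk n ^ 2 * kk m ^ 2) with ((2 * kk n * kk m) ^ 2) by ring.
    apply sq_le. split; auto. left; auto. }
  destruct (Nat.ltb_spec n j); [|destruct (Nat.ltb_spec j n)].
  - apply K. assert (E := kk_sub j n H). generalize (kk_ge1 n) (kk_ge1 (j - 1 - n)). nra.
  - apply K. assert (E := kk_sub n j H0). generalize (kk_ge1 n) (kk_ge1 (n - 1 - j)). nra.
  - rewrite !Rmult_0_r. lra.
Qed.

Lemma cc_sq a j n : 0 < a -> cc a j n ^ 2 <= 2 * cc_const a ^ 2 * kpow n (-2) * (kpow j (-2) + inv_dist j n ^ 2).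
Proof.
  intros Ha. rewrite <- pow2_abs.
  assert (H := cc_bound a j n Ha).
  assert (Rabs (cc a j n) ^ 2 <= (cc_const a / kk n * (/ kk j + inv_dist j n)) ^ 2).
  { apply sq_le. split; auto. apply Rabs_pos. }
  eapply Rle_trans; [exact H0|]. rewrite Rpow_mult_distr. unfold Rdiv.
  rewrite Rpow_mult_distr, pow_inv, <- !kpow_m1.
  rewrite <- kpow_m2. assert (A := kpow_pos n (-2)).
  assert (B : (kpow j (-1) + inv_dist j n) ^ 2 <= 2 * (kpow j (-2) + inv_dist j n ^ 2)).
  { assert (E : kpow j (-2) = kpow j (-1) ^ 2) by (rewrite kpow_m2, kpow_m1, pow_inv; auto).
    rewrite E. generalize (pow2_ge_0 (kpow j (-1) - inv_dist j n)). nra. }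
  replace (2 * cc_const a ^ 2 * kpow n (-2) * (kpow j (-2) + inv_dist j n ^ 2)) with
     (cc_const a ^ 2 * kpow n (-2) * (2 * (kpow j (-2) + inv_dist j n ^ 2))) by ring.
  apply Rmult_le_compat_l; auto. apply Rmult_le_pos; [apply pow2_ge_0|lra].
Qed.

Lemma cc_const_kpow_ge0 a n : 0 <= 2 * cc_const a ^ 2 * kpow n (-2).
Proof.
  apply Rmult_le_pos; [|left; apply kpow_pos]. apply Rmult_le_pos; [lra|apply pow2_ge_0].
Qed.

Lemma cc_column_sum a s : 0 < a -> s < 1 / 2 -> exists K, 0 < K /\ forall nu zeta n J, 0 < nu ->
  rsum (fun j => wgt nu s zeta j * cc a j n ^ 2) J <= K * kpow n (2 * Rabs s - 2) * wgt nu s zeta n.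
Proof.
  intros Ha Hs.
  assert (KC := cc_const_pos a Ha).
  destruct (p_series_bounded 2 ltac:(lra)) as [Z [HZ0 HZ]].
  replace (- (2)) with (-2) in HZ by ring.
  assert (Hd : forall n J, rsum (fun j => inv_dist j n ^ 2) J <= 2 * Z).
  { intros n J. rewrite (rsum_ext _ (dist_kernel (fun m => kpow m (-2)) n)).
    - apply dist_kernel_sum; auto. intros; left; apply kpow_pos.
    - intros j _. rewrite inv_dist_sq. apply dist_kernel_sym. }
  destruct (Rle_dec 0 s) as [H0|H0].
  - destruct (p_series_bounded (2 - 2 * s) ltac:(lra)) as [Y [HY0 HY]].
    exists (2 * cc_const a ^ 2 * (Y + Rpower 4 s * (2 * Y))).
    assert (0 < Rpower 4 s) by auto.
    split; [assert (0 < cc_const a ^ 2) by (apply pow_lt; auto); apply Rmult_lt_0_compat; [lra|]; assert (0 < Rpower 4 s * (2 * Y)) by (apply Rmult_lt_0_compat; lra); lra|].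
    intros nu zeta n J Hnu. rewrite Rabs_pos_eq; auto.
    apply Rle_trans with (rsum (fun j => (wgt nu s zeta n * (2 * cc_const a ^ 2 * kpow n (-2))) *
       (kpow j (- (2 - 2 * s)) + (Rpower 4 s * kpow n (2 * s)) * dist_kernel (fun m => kpow m (- (2 - 2 * s))) n j)) J).
    + apply rsum_le. intros j _.
      apply Rle_trans with (wgt nu s zeta n * kpow j (2 * s) * (2 * cc_const a ^ 2 * kpow n (-2) * (kpow j (-2) + inv_dist j n ^ 2))).
      * apply Rmult_le_compat; auto; [apply pow2_ge_0| |now apply cc_sq].
        generalize (wgt_ratio nu s zeta j n Hnu). destruct (Rle_dec 0 s); tauto.
      * replace (wgt nu s zeta n * kpow j (2 * s) * (2 * cc_const a ^ 2 * kpow n (-2) * (kpow j (-2) + inv_dist j n ^ 2)))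
          with (wgt nu s zeta n * (2 * cc_const a ^ 2 * kpow n (-2)) * (kpow j (2 * s) * kpow j (-2) + kpow j (2 * s) * inv_dist j n ^ 2)) by ring.
        apply Rmult_le_compat_l.
        -- apply Rmult_le_pos; auto. apply cc_const_kpow_ge0.
        -- rewrite <- kpow_plus. replace (2 * s + -2) with (- (2 - 2 * s)) by ring.
           rewrite dist_kernel_sym. generalize (kpow_inv_dist j n s H0). lra.
    + rewrite rsum_scal, rsum_plus, rsum_scal.
      assert (A := HY J). assert (B := dist_kernel_sum (fun m => kpow m (- (2 - 2 * s))) Y n J ltac:(intros; left; apply kpow_pos) HY).
      replace (2 * s - 2) with (-2 + 2 * s) by ring. rewrite kpow_plus.
      assert (P1 := kpow_ge1 n (2 * s) ltac:(lra)).
      apply Rle_trans with (wgt nu s zeta n * (2 * cc_const a ^ 2 * kpow n (-2)) * (kpow n (2 * s) * (Y + Rpower 4 s * (2 * Y)))).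
      * apply Rmult_le_compat_l.
        -- apply Rmult_le_pos; auto. apply cc_const_kpow_ge0.
        -- assert (Rpower 4 s * kpow n (2 * s) * rsum (dist_kernel (fun m => kpow m (- (2 - 2 * s))) n) J <= Rpower 4 s * kpow n (2 * s) * (2 * Y)).
           { apply Rmult_le_compat_l; auto. apply Rmult_le_pos; lra. }
           assert (Y <= kpow n (2 * s) * Y) by nra. lra.
      * right; ring.
  - exists (2 * cc_const a ^ 2 * (3 * Z)).
    split; [assert (0 < cc_const a ^ 2) by (apply pow_lt; auto); nra|].
    intros nu zeta n J Hnu. rewrite Rabs_left; [|lra].
    apply Rle_trans with (rsum (fun j => (wgt nu s zeta n * kpow n (2 * - s) * (2 * cc_const a ^ 2 * kpow n (-2))) *
       (kpow j (-2) + inv_dist j n ^ 2)) J).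
    + apply rsum_le. intros j _. rewrite (Rmult_assoc (wgt nu s zeta n * _)).
      apply Rmult_le_compat; auto; [apply pow2_ge_0| |now apply cc_sq].
      generalize (wgt_ratio nu s zeta j n Hnu). destruct (Rle_dec 0 s); tauto.
    + rewrite rsum_scal, rsum_plus.
      replace (2 * - s - 2) with (2 * - s + -2) by ring. rewrite kpow_plus.
      replace (2 * cc_const a ^ 2 * (3 * Z) * (kpow n (2 * - s) * kpow n (-2)) * wgt nu s zeta n) with
        (wgt nu s zeta n * kpow n (2 * - s) * (2 * cc_const a ^ 2 * kpow n (-2)) * (Z + 2 * Z)) by ring.
      apply Rmult_le_compat_l.
      * apply Rmult_le_pos; [|apply cc_const_kpow_ge0]. apply Rmult_le_pos; auto. left; apply kpow_pos.
      * generalize (HZ J) (Hd n J). lra.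
Qed.

(** The primitive after a multiplier m. It is m that has to make the Hilbert-Schmidt sum converge,
    and it is left free since it will be 1/symb up to a constant, a negative power of the weight, or
    1. *)
Lemma Iz_bound a s : 0 < a -> s < 1 / 2 -> exists K, 0 < K /\ forall nu zeta m Q G g B,
  0 < nu -> (forall n, 0 <= m n) -> 0 <= Q ->
  (forall N, rsum (fun n => kpow n (2 * Rabs s - 2) * m n ^ 2) N <= Q ^ 2) ->
  l2le (wgt nu s zeta) G B -> (forall n, Cmod (g n) <= m n * Cmod (G n)) ->
  (forall j, abs_summable (fun n => (g n * RtoC (cc a j n))%C)) /\ l2le (wgt nu s zeta) (Iz a g) (K * Q * B).
Proof.
  intros Ha Hs. destruct (cc_column_sum a s Ha Hs) as [K [HK HC]].
  exists (sqrt K). split; [now apply sqrt_lt_R0|].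
  intros nu zeta m Q G g B Hnu Hm HQ HmQ [HB HG] Hg.
  apply (hilbert_schmidt_l2le (wgt nu s zeta) (cc a) (fun n => m n / sqrt (wgt nu s zeta n)) (fun n => sqrt (wgt nu s zeta n) * Cmod (G n))
     (fun n => K * kpow n (2 * Rabs s - 2) * wgt nu s zeta n)); auto.
  - intros n. apply Rmult_le_pos; auto. left; apply Rinv_0_lt_compat, sqrt_lt_R0; auto.
  - apply Rmult_le_pos; auto. apply sqrt_pos.
  - intros n. eapply Rle_trans; [apply Hg|]. right. field. apply Rgt_not_eq, sqrt_lt_R0; auto.
  - intros N. eapply Rle_trans; [|apply (HG N)]. right. apply rsum_ext. intros n _.
    rewrite Rpow_mult_distr, pow2_sqrt; auto.
  - intros N. rewrite Rpow_mult_distr, pow2_sqrt; [|lra].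
    eapply Rle_trans; [|apply Rmult_le_compat_l; [lra|apply (HmQ N)]].
    rewrite <- rsum_scal. right. apply rsum_ext; intros n _.
    unfold Rdiv. rewrite Rpow_mult_distr, pow_inv, pow2_sqrt; auto.
    field. apply Rgt_not_eq; apply wgt_pos.
Qed.

(** The primitive preserves coefficients of order 1/k. This is meant for the pressure profile
    [pmode], whose coefficients are explicit. *)
Lemma Iz_pointwise a : 0 < a -> exists K, 0 < K /\ forall g A, 0 <= A ->
  (forall n, Cmod (g n) <= A / kk n) ->
  forall j, abs_summable (fun n => (g n * RtoC (cc a j n))%C) /\ Cmod (Iz a g j) <= K * A / kk j.
Proof.
  intros Ha. destruct (p_series_bounded 2 ltac:(lra)) as [Z [HZ0 HZ]].
  replace (- (2)) with (-2) in HZ by ring.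
  assert (KC := cc_const_pos a Ha).
  exists (cc_const a * (4 * Z)). split; [nra|]. intros g A HA Hg j.
  assert (Hd : forall J, rsum (fun n => inv_dist j n ^ 2) J <= 2 * Z).
  { intros J. rewrite (rsum_ext _ (dist_kernel (fun m => kpow m (-2)) j)).
    - apply dist_kernel_sum; auto. intros; left; apply kpow_pos.
    - intros n _. apply inv_dist_sq. }
  assert (Kj := kk_pos j).
  assert (H : forall N, rsum (fun n => Cmod (g n * RtoC (cc a j n))) N <= cc_const a * (4 * Z) * A / kk j).
  (* With x = 1/k_n, y = 1/k_j and d = [inv_dist]: x^2 (y + d) <= 2 x^2 y + x y d, and AM-GM on x d
     gives y (5/2 x^2 + 1/2 d^2). *)
  { intros N. apply Rle_trans with (rsum (fun n => (A * cc_const a / kk j) * (5 / 2 * kpow n (-2) + 1 / 2 * inv_dist j n ^ 2)) N).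
    - apply rsum_le; intros n _. rewrite Cmod_mult, Cmod_R.
      apply Rle_trans with (A / kk n * (cc_const a / kk n * (/ kk j + inv_dist j n))).
      + apply Rmult_le_compat; auto; [apply Cmod_ge_0|apply Rabs_pos|now apply cc_bound].
      + assert (Kn := kk_pos n).
        replace (A / kk n * (cc_const a / kk n * (/ kk j + inv_dist j n))) with
          (A * cc_const a * (/ kk n * / kk n * (/ kk j + inv_dist j n))) by (field; lra).
        replace (A * cc_const a / kk j * (5 / 2 * kpow n (-2) + 1 / 2 * inv_dist j n ^ 2)) with
          (A * cc_const a * (/ kk j * (5 / 2 * kpow n (-2) + 1 / 2 * inv_dist j n ^ 2))) by (field; lra).
        apply Rmult_le_compat_l; [nra|].
        rewrite kpow_m2, <- pow_inv.
        (* Partial fractions, based on k_j <= k_n + |j - n|. *)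
        assert (E : / kk n * inv_dist j n <= / kk j * (/ kk n + inv_dist j n)).
        { destruct (Nat.eq_dec j n) as [<-|Hne].
          - rewrite inv_dist_diag, Rmult_0_r. assert (0 < / kk j) by (now apply Rinv_0_lt_compat). nra.
          - rewrite inv_dist_spec; auto. set (d := Rabs (kk j - kk n)).
            assert (Hd0 : 0 < d).
            { apply Rabs_pos_lt. intros E. apply Hne. unfold kk in E.
              apply Rminus_diag_uniq in E. apply INR_eq in E. lia. }
            replace (/ kk j * (/ kk n + / d)) with (/ kk j * / kk n * / d * (d + kk n)) by (field; lra).
            replace (/ kk n * / d) with (/ kk j * / kk n * / d * kk j) by (field; lra).
            apply Rmult_le_compat_l.
            + repeat apply Rmult_le_pos; left; apply Rinv_0_lt_compat; auto.
            + unfold d. generalize (Rle_abs (kk j - kk n)). lra. }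
        assert (D := inv_dist_ge0 j n).
        assert (I1 : 0 < / kk n) by (now apply Rinv_0_lt_compat).
        assert (I2 : 0 < / kk j) by (now apply Rinv_0_lt_compat).
        set (x := / kk n) in *. set (y := / kk j) in *. set (d := inv_dist j n) in *.
        assert (x * (x * d) <= x * (y * (x + d))) by (apply Rmult_le_compat_l; lra).
        assert (0 <= y * (x - d) ^ 2) by (apply Rmult_le_pos; [lra|apply pow2_ge_0]).
        nra.
    - rewrite rsum_scal, rsum_plus, !rsum_scal.
      replace (cc_const a * (4 * Z) * A / kk j) with (A * cc_const a / kk j * (4 * Z)) by (field; lra).
      apply Rmult_le_compat_l.
      + apply Rmult_le_pos; [nra|left; now apply Rinv_0_lt_compat].
      + generalize (HZ N) (Hd N). lra. }
  split; [eexists; exact H|]. now apply Cseries_bound.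
Qed.

Definition Iz_summable a g := forall j, abs_summable (fun n => (g n * RtoC (cc a j n))%C).

Lemma Iz_lin a f g c : Iz_summable a f -> Iz_summable a g -> forall j,
  Iz a (fun n => (f n + c * g n)%C) j = (Iz a f j + c * Iz a g j)%C.
Proof.
  intros Hf Hg j. unfold Iz. rewrite <- Cseries_scal, <- Cseries_plus; auto.
  - apply Cseries_ext; intros; ring.
  - now apply abs_summable_scal.
Qed.
Lemma Iz_zero a j : Iz a (fun _ => 0%C) j = 0%C.
Proof.
  unfold Iz. transitivity (Cseries (fun _ => 0%C)); [|apply Cseries_zero]. apply Cseries_ext; intros; ring.
Qed.

(** * The symbol on the sector *)

Lemma zabs_ge0 zeta : 0 <= zabs zeta.
Proof. apply sqrt_pos. Qed.
Lemma zabs_sq zeta : zabs zeta ^ 2 = IZR (fst zeta) ^ 2 + IZR (snd zeta) ^ 2.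
Proof. apply pow2_sqrt. generalize (pow2_ge_0 (IZR (fst zeta))) (pow2_ge_0 (IZR (snd zeta))); lra. Qed.

Lemma zabs_ge1 zeta : zeta <> (0%Z, 0%Z) -> 1 <= zabs zeta.
Proof.
  intros H. destruct zeta as [x y].
  assert (1 <= zabs (x, y) ^ 2).
  { rewrite zabs_sq. simpl fst; simpl snd. rewrite !pow_IZR, <- plus_IZR. apply IZR_le.
    change (Z.of_nat 2) with 2%Z. assert (x <> 0 \/ y <> 0)%Z.
    { destruct (Z.eq_dec x 0); destruct (Z.eq_dec y 0); auto. subst. tauto. }
    nia. }
  generalize (zabs_ge0 (x, y)). nra.
Qed.

Lemma bomega2_bounds lam zeta : zeta <> (0%Z, 0%Z) ->
  1 <= zabs zeta /\ 2 <= bzeta zeta /\ bzeta zeta ^ 2 <= 4 * zabs zeta ^ 2 /\ 4 <= bzeta zeta ^ 2 /\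
  bzeta zeta ^ 2 <= bomega2 lam zeta /\ Cmod lam <= bomega2 lam zeta /\ zabs zeta ^ 2 <= bomega2 lam zeta.
Proof.
  intros H. apply zabs_ge1 in H. unfold bomega2, bzeta.
  generalize (Cmod_ge_0 lam) (pow2_ge_0 (1 + zabs zeta)). repeat split; nra.
Qed.

(** The symbol at the apex lam = - delta2 of the sector. At a general point of the sector it is
    shifted by - mu1 + i mu2. *)
Definition shifted_symb a nu delta2 zeta n := nu * zabs zeta ^ 2 + nu * freq a n ^ 2 - delta2.

Lemma shifted_symb_lower a nu delta2 : 0 < a -> 0 < nu -> delta2 < Rmin (nu * PI ^ 2 / (2 * a ^ 2)) (nu / 2) ->
  exists c, 0 < c /\ forall zeta n, zeta <> (0%Z, 0%Z) ->
    c * (kk n ^ 2 + bzeta zeta ^ 2) <= shifted_symb a nu delta2 zeta n.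
Proof.
  intros Ha Hnu Hd. set (t := nu * PI ^ 2 / a ^ 2).
  assert (P := PI_RGT_0). assert (Ha2 : 0 < a ^ 2) by (apply pow_lt; auto).
  assert (Ht : 0 < t).
  { unfold t. apply Rdiv_lt_0_compat; auto. apply Rmult_lt_0_compat; auto. apply pow_lt; auto. }
  assert (D1 : delta2 < t / 2).
  { eapply Rlt_le_trans; [exact Hd|]. eapply Rle_trans; [apply Rmin_l|]. right. unfold t. field. lra. }
  assert (D2 : delta2 < nu / 2) by (eapply Rlt_le_trans; [exact Hd|apply Rmin_r]).
  (* As delta2 < (t + nu) / 4, a quarter of t k^2 and a quarter of nu |zeta|^2 absorb it. The factor
     4 between 3/4 and 3/16 is that of <zeta>^2 <= 4 |zeta|^2. *)
  exists (Rmin (3 * nu / 16) (3 * t / 4)). split; [apply Rmin_pos; lra|].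
  intros zeta n Hz. destruct (bomega2_bounds 0%C zeta Hz) as [Z1 [_ [Z2 _]]].
  assert (M1 := Rmin_l (3 * nu / 16) (3 * t / 4)). assert (M2 := Rmin_r (3 * nu / 16) (3 * t / 4)).
  set (c := Rmin (3 * nu / 16) (3 * t / 4)) in *.
  assert (K1 : 1 <= kk n ^ 2) by (generalize (kk_ge1 n); nra).
  unfold shifted_symb. replace (nu * freq a n ^ 2) with (t * kk n ^ 2) by (unfold t, freq; field; lra).
  assert (1 <= zabs zeta ^ 2) by nra.
  set (x := kk n ^ 2) in *. set (y := zabs zeta ^ 2) in *. set (b := bzeta zeta ^ 2) in *.
  assert (c * x <= 3 * t / 4 * x) by (apply Rmult_le_compat_r; lra).
  assert (0 <= b) by apply pow2_ge_0.
  assert (c * b <= 3 * nu / 16 * b) by (apply Rmult_le_compat_r; lra).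
  nra.
Qed.

Lemma symb_re a nu lam zeta n delta2 mu1 mu2 : lam = ((- delta2 - mu1)%R, mu2) ->
  symb a nu lam zeta n = ((shifted_symb a nu delta2 zeta n - mu1)%R, mu2).
Proof.
  intros ->. unfold symb, omega2, shifted_symb, freq, Cplus, RtoC; simpl. f_equal; ring.
Qed.

(** On the sector mu1 <= delta1 |mu2|: where the real part is pushed down, the imaginary part pays
    for it. The third inequality describes a half-plane off 0, the same for all n because mu2 is. *)
Lemma sector_bounds a nu delta1 delta2 mu1 mu2 zeta n : 0 < delta1 -> 0 <= shifted_symb a nu delta2 zeta n ->
  Rabs mu2 >= mu1 / delta1 ->
  let S := shifted_symb a nu delta2 zeta n + Rabs mu1 + Rabs mu2 in
  let z := ((shifted_symb a nu delta2 zeta n - mu1)%R, mu2) : C in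
  S <= (2 * delta1 + 2) * Cmod z /\ Cmod z <= S /\
  S <= (shifted_symb a nu delta2 zeta n - mu1) + (2 * delta1 + 1) * Rabs mu2.
Proof.
  intros Hd Hr Hm S z. unfold S. set (r := shifted_symb a nu delta2 zeta n) in *.
  assert (Hm' : mu1 <= delta1 * Rabs mu2).
  { apply Rge_le in Hm. apply Rmult_le_compat_r with (r := delta1) in Hm; [|lra].
    replace (mu1 / delta1 * delta1) with mu1 in Hm by (field; lra). lra. }
  assert (H1 := re_le_Cmod z). assert (H2 := Im_le_Cmod z). assert (H3 := Cmod_le_ReIm z).
  change (Re z) with (r - mu1) in *. change (Im z) with mu2 in *.
  assert (M := Rabs_pos mu2). assert (N := Rle_abs (r - mu1)).
  assert (0 <= Cmod z) by apply Cmod_ge_0.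
  assert (E1 : r + Rabs mu1 <= r - mu1 + 2 * (delta1 * Rabs mu2)).
  { unfold Rabs at 1. destruct (Rcase_abs mu1); [|lra]. nra. }
  repeat split.
  - nra.
  - assert (Rabs (r - mu1) <= r + Rabs mu1); [|lra].
    eapply Rle_trans; [apply Rabs_triang|]. rewrite Rabs_Ropp, (Rabs_pos_eq r); lra.
  - nra.
Qed.

Lemma symb_lower a nu delta1 delta2 : 0 < a -> 0 < nu -> 0 < delta1 ->
  delta2 < Rmin (nu * PI ^ 2 / (2 * a ^ 2)) (nu / 2) ->
  exists c, 0 < c /\ forall lam zeta n, inS delta1 delta2 lam -> zeta <> (0%Z, 0%Z) ->
    c * (kk n ^ 2 + bomega2 lam zeta) <= Cmod (symb a nu lam zeta n).
Proof.
  intros Ha Hnu Hd1 Hd2. destruct (shifted_symb_lower a nu delta2 Ha Hnu Hd2) as [c1 [Hc1 Hr]].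
  (* In M, the part 1 / c1 covers k^2 + <zeta>^2, the part |delta2| / c1 covers the delta2 hidden in
     |lam|, using r / c1 >= 1, and the 1 covers |mu1| + |mu2|. *)
  set (M := 1 + (1 + Rabs delta2) / c1).
  assert (HM : 0 < M).
  { unfold M. assert (0 < (1 + Rabs delta2) / c1); [|lra].
    apply Rdiv_lt_0_compat; auto. generalize (Rabs_pos delta2); lra. }
  exists (/ (M * (2 * delta1 + 2))). split; [apply Rinv_0_lt_compat; nra|].
  intros lam zeta n [mu1 [mu2 [El Hm]]] Hz.
  destruct (bomega2_bounds lam zeta Hz) as [Z1 [Z2 [Z3 [Z4 [Z5 [Z6 Z7]]]]]].
  specialize (Hr zeta n Hz). set (r := shifted_symb a nu delta2 zeta n) in *.
  assert (K1 := pow2_ge_0 (kk n)).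
  assert (Hr0 : 0 <= r) by nra.
  destruct (sector_bounds a nu delta1 delta2 mu1 mu2 zeta n Hd1 Hr0 Hm) as [S1 _].
  rewrite (symb_re a nu lam zeta n delta2 mu1 mu2 El). fold r in S1 |- *.
  assert (HL : Cmod lam <= Rabs delta2 + Rabs mu1 + Rabs mu2).
  { eapply Rle_trans; [apply Cmod_le_ReIm|]. rewrite El. simpl.
    assert (Rabs (- delta2 - mu1) <= Rabs delta2 + Rabs mu1); [|lra].
    eapply Rle_trans; [apply Rabs_triang|]. rewrite !Rabs_Ropp. lra. }
  apply Rmult_le_reg_l with (M * (2 * delta1 + 2)); [nra|].
  rewrite <- Rmult_assoc, Rinv_r, Rmult_1_l; [|nra].
  assert (B : kk n ^ 2 + bomega2 lam zeta <= M * (r + Rabs mu1 + Rabs mu2)).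
  { unfold bomega2.
    assert (E1 : kk n ^ 2 + bzeta zeta ^ 2 <= r / c1).
    { apply Rmult_le_reg_l with c1; auto. replace (c1 * (r / c1)) with r by (field; lra). lra. }
    assert (1 <= r / c1) by lra.
    assert (Rabs delta2 <= Rabs delta2 * (r / c1)) by (generalize (Rabs_pos delta2); nra).
    assert (0 <= (M - 1) * (Rabs mu1 + Rabs mu2)).
    { apply Rmult_le_pos; [unfold M|generalize (Rabs_pos mu1) (Rabs_pos mu2); lra].
      assert (0 <= (1 + Rabs delta2) / c1); [|lra].
      apply Rdiv_le_0_compat; auto. generalize (Rabs_pos delta2); lra. }
    replace (M * (r + Rabs mu1 + Rabs mu2)) with (r + r / c1 + Rabs delta2 * (r / c1) + (Rabs mu1 + Rabs mu2) + (M - 1) * (Rabs mu1 + Rabs mu2)) by (unfold M; field; lra).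
    lra. }
  eapply Rle_trans; [exact B|]. rewrite Rmult_assoc. apply Rmult_le_compat_l; lra.
Qed.

(** The integral over (0,a) of the velocity profile driven by a unit pressure; the divergence
    constraint is solved for p0 by dividing by it. *)
Definition psum a nu lam zeta : C :=
  Cseries (fun n => (RtoC (one_coef a n) * RtoC (one_coef a n) / symb a nu lam zeta n)%C).

(** Cancellation is excluded by the real functional Re - k0 sg Im, with sg the sign of mu2, which is
    nonnegative on every term. The first term alone then gives the bound, since S 0 <= D
    <omega>^2. *)
Lemma psum_lower a nu delta1 delta2 : 0 < a -> 0 < nu -> 0 < delta1 ->
  delta2 < Rmin (nu * PI ^ 2 / (2 * a ^ 2)) (nu / 2) ->
  exists c, 0 < c /\ forall lam zeta, inS delta1 delta2 lam -> zeta <> (0%Z, 0%Z) ->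
    c / bomega2 lam zeta <= Cmod (psum a nu lam zeta).
Proof.
  intros Ha Hnu Hd1 Hd2. destruct (shifted_symb_lower a nu delta2 Ha Hnu Hd2) as [c1 [Hc1 Hr]].
  destruct (symb_lower a nu delta1 delta2 Ha Hnu Hd1 Hd2) as [c2 [Hc2 Hsy]].
  assert (P := PI_RGT_0).
  set (D := nu + nu * freq a 0 ^ 2 + 2 * Rabs delta2 + 2).
  assert (HD : 0 < D).
  { unfold D. generalize (Rabs_pos delta2) (pow2_ge_0 (freq a 0)). nra. }
  set (k0 := 2 * delta1 + 1).
  assert (Hc0 : 0 < one_coef a 0).
  { rewrite one_coef_first; auto. apply Rdiv_lt_0_compat; auto. generalize (amp_pos a Ha). nra. }
  exists (one_coef a 0 ^ 2 / D / (1 + k0)). split.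
  { repeat apply Rdiv_lt_0_compat; auto; [apply pow_lt; auto|unfold k0; lra]. }
  intros lam zeta HS Hz. assert (HS' := HS). destruct HS as [mu1 [mu2 [El Hm]]].
  destruct (bomega2_bounds lam zeta Hz) as [Z1 [Z2 [Z3 [Z4 [Z5 [Z6 Z7]]]]]].
  assert (Hr0 : forall n, 0 < shifted_symb a nu delta2 zeta n).
  { intros n. specialize (Hr zeta n Hz). generalize (pow2_ge_0 (kk n)). nra. }
  set (sg := if Rle_dec 0 mu2 then 1 else -1).
  assert (Hsg : sg * mu2 = Rabs mu2).
  { unfold sg. destruct (Rle_dec 0 mu2); [rewrite Rabs_pos_eq; lra|rewrite Rabs_left; lra]. }
  set (t := fun n => (RtoC (one_coef a n) * RtoC (one_coef a n) / symb a nu lam zeta n)%C).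
  set (S := fun n => shifted_symb a nu delta2 zeta n + Rabs mu1 + Rabs mu2).
  assert (HSp : forall n, 0 < S n).
  { intros n. unfold S. generalize (Hr0 n) (Rabs_pos mu1) (Rabs_pos mu2); lra. }
  (* The imaginary part of 1/z is - mu2 / |z|^2, so the functional equals (x + k0 |mu2|) / |z|^2;
     its numerator is at least S and |z| <= S. *)
  assert (Ht : forall n, one_coef a n ^ 2 / S n <= Re (t n) - k0 * sg * Im (t n)).
  { intros n. unfold t. rewrite (symb_re a nu lam zeta n delta2 mu1 mu2 El).
    destruct (sector_bounds a nu delta1 delta2 mu1 mu2 zeta n Hd1 (Rlt_le _ _ (Hr0 n)) Hm) as [S1 [S2 S3]].
    fold k0 in S3. fold (S n) in S1, S2, S3. set (x := shifted_symb a nu delta2 zeta n - mu1) in *.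
    assert (Hm2 := Cmod2_alt (x, mu2)). simpl Re in Hm2. simpl Im in Hm2.
    assert (Hpos : 0 < Cmod (x, mu2)).
    { assert (0 < (2 * delta1 + 2) * Cmod (x, mu2)); [|nra]. generalize (HSp n); lra. }
    assert (Hq : 0 < x ^ 2 + mu2 ^ 2) by (rewrite <- Hm2; apply pow_lt; auto).
    replace (Re (RtoC (one_coef a n) * RtoC (one_coef a n) / (x, mu2))%C - k0 * sg * Im (RtoC (one_coef a n) * RtoC (one_coef a n) / (x, mu2))%C)
      with (one_coef a n ^ 2 * ((x + k0 * Rabs mu2) / (x ^ 2 + mu2 ^ 2))).
    - unfold Rdiv at 1. apply Rmult_le_compat_l; [apply pow2_ge_0|].
      apply Rle_trans with (S n / (x ^ 2 + mu2 ^ 2)).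
      + apply Rmult_le_reg_r with (x ^ 2 + mu2 ^ 2); auto.
        unfold Rdiv. rewrite (Rmult_assoc (S n)), Rinv_l, Rmult_1_r; [|lra].
        apply Rmult_le_reg_l with (S n); [apply HSp|].
        rewrite <- Rmult_assoc, Rinv_r, Rmult_1_l; [|generalize (HSp n); lra].
        rewrite <- Hm2. nra.
      + unfold Rdiv. apply Rmult_le_compat_r; [left; apply Rinv_0_lt_compat; auto|exact S3].
    - rewrite <- Hsg. unfold Cdiv, Cmult, Cinv, RtoC, Re, Im; simpl. field. simpl in Hq. lra. }
  assert (Hw : 0 < bomega2 lam zeta) by lra.
  assert (S0 : S 0%nat <= D * bomega2 lam zeta).
  { unfold S, shifted_symb, D.
    assert (Rabs mu2 <= Cmod lam) by (rewrite El; apply (Im_le_Cmod (_, mu2))).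
    assert (Rabs mu1 <= Cmod lam + Rabs delta2).
    { assert (Q := re_le_Cmod lam). rewrite El in Q at 1. simpl in Q.
      replace mu1 with (- ((- delta2 - mu1) + delta2)) at 1 by ring. rewrite Rabs_Ropp.
      eapply Rle_trans; [apply Rabs_triang|]. lra. }
    assert (U1 : nu * freq a 0 ^ 2 <= nu * freq a 0 ^ 2 * bomega2 lam zeta) by (assert (0 <= nu * freq a 0 ^ 2) by (apply Rmult_le_pos; [lra|apply pow2_ge_0]); nra).
    assert (U2 : Rabs delta2 <= Rabs delta2 * bomega2 lam zeta) by (assert (0 <= Rabs delta2) by apply Rabs_pos; nra).
    assert (U3 : nu * zabs zeta ^ 2 <= nu * bomega2 lam zeta) by (apply Rmult_le_compat_l; lra).
    assert (U4 : 0 < nu) by auto. generalize (Rle_abs (- delta2)). rewrite Rabs_Ropp. lra. }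
  assert (Habs : exists B, forall N, rsum (fun n => Cmod (t n)) N <= B).
  { destruct (p_series_bounded 2 ltac:(lra)) as [Y [HY0 HY]]. replace (- (2)) with (-2) in HY by ring.
    exists ((2 * amp a * a / PI) ^ 2 / (c2 * bomega2 lam zeta) * Y). intros N.
    eapply Rle_trans; [|apply Rmult_le_compat_l; [|apply (HY N)]].
    - rewrite <- rsum_scal. apply rsum_le; intros n _. unfold t.
      assert (Q := Hsy lam zeta n HS' Hz). assert (0 < kk n ^ 2) by (apply pow_lt; auto).
      assert (0 < Cmod (symb a nu lam zeta n)) by nra.
      rewrite Cmod_div; [|now apply Cmod_gt_0]. rewrite Cmod_mult, !Cmod_R, kpow_m2.
      assert (O := one_coef_bound a n Ha). set (A := 2 * amp a * a / PI) in *.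
      replace (A ^ 2 / (c2 * bomega2 lam zeta) * / kk n ^ 2) with ((A / kk n) * (A / kk n) * / (c2 * bomega2 lam zeta))
        by (field; generalize (kk_pos n); intros; repeat split; lra).
      unfold Rdiv at 1. apply Rmult_le_compat.
      + apply Rmult_le_pos; apply Rabs_pos.
      + left; now apply Rinv_0_lt_compat.
      + apply Rmult_le_compat; auto; apply Rabs_pos.
      + apply Rinv_le_contravar; nra.
    - apply Rdiv_le_0_compat; [apply pow2_ge_0|nra]. }
  destruct Habs as [B HB]. assert (Hlim := Cseries_clim t B HB). fold (psum a nu lam zeta) in Hlim.
  change (Cseries t) with (psum a nu lam zeta) in Hlim. set (K := psum a nu lam zeta) in *.
  assert (HF : one_coef a 0 ^ 2 / S 0%nat <= Re K - k0 * sg * Im K).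
  { assert (L : is_lim_seq (fun n => rsum (fun n => Re (t n) - k0 * sg * Im (t n)) n) (Re K - k0 * sg * Im K)).
    { apply is_lim_seq_ext with (fun n => Re (csum t n) - k0 * sg * Im (csum t n)).
      - intros n. rewrite csum_re, csum_im.
        induction n; cbn [rsum]; [ring|]. rewrite <- IHn. ring.
      - apply is_lim_seq_minus'; [now apply clim_Re|].
        apply (is_lim_seq_scal_l _ (k0 * sg) (Im K)). now apply clim_Im. }
    apply (is_lim_seq_le_loc (fun _ => one_coef a 0 ^ 2 / S 0%nat) _ (one_coef a 0 ^ 2 / S 0%nat) (Re K - k0 * sg * Im K)) with (3 := L).
    - exists 1%nat. intros N HN. eapply Rle_trans; [apply Ht|].
      apply (rsum_term (fun n => Re (t n) - k0 * sg * Im (t n)) N 0); [|lia].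
      intros n. eapply Rle_trans; [|apply Ht]. apply Rdiv_le_0_compat; [apply pow2_ge_0|apply HSp].
    - apply is_lim_seq_const. }
  assert (HK : Re K - k0 * sg * Im K <= (1 + k0) * Cmod K).
  { assert (R1 := re_le_Cmod K). assert (R2 := Im_le_Cmod K).
    assert (0 < k0) by (unfold k0; lra).
    assert (Hs : - (sg * Im K) <= Rabs (Im K)).
    { unfold sg. destruct (Rle_dec 0 mu2).
      - rewrite Rmult_1_l, <- Rabs_Ropp. apply Rle_abs.
      - replace (- (-1 * Im K)) with (Im K) by ring. apply Rle_abs. }
    assert (- (k0 * sg * Im K) <= k0 * Rabs (Im K)) by nra.
    generalize (Rle_abs (Re K)). nra. }
  assert (HX : one_coef a 0 ^ 2 / (D * bomega2 lam zeta) <= one_coef a 0 ^ 2 / S 0%nat).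
  { unfold Rdiv. apply Rmult_le_compat_l; [apply pow2_ge_0|]. apply Rinv_le_contravar; auto. }
  assert (0 < 1 + k0) by (unfold k0; lra).
  apply Rmult_le_reg_l with (1 + k0); auto.
  replace ((1 + k0) * (one_coef a 0 ^ 2 / D / (1 + k0) / bomega2 lam zeta)) with (one_coef a 0 ^ 2 / (D * bomega2 lam zeta)) by (field; lra).
  lra.
Qed.

(** * Weights and the quantities M_s *)

(** Up to constants, [kb] is the base of the Sobolev weight and [kw] the lower bound for |symb| on
    the sector. *)
Definition kb zeta n := kk n ^ 2 + bzeta zeta ^ 2.
Definition kw lam zeta n := kk n ^ 2 + bomega2 lam zeta.

Lemma Rpower_comp x y L s : 0 < x -> 0 < y -> 0 < L -> x <= L * y -> y <= L * x ->
  Rpower x s <= Rpower L (Rabs s) * Rpower y s.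
Proof.
  intros Hx Hy HL Hxy Hyx. destruct (Rle_dec 0 s) as [H|H].
  - rewrite Rabs_pos_eq, Rpower_mult_distr; auto. apply Rle_Rpower_l; auto.
  - rewrite Rabs_left; [|lra].
    assert (E : Rpower y (- s) <= Rpower L (- s) * Rpower x (- s)).
    { rewrite Rpower_mult_distr; auto. apply Rle_Rpower_l; auto. lra. }
    rewrite !(Rpower_Ropp _ s) in *.
    assert (A := Rpower_pos x s). assert (B := Rpower_pos y s). assert (D := Rpower_pos L s).
    apply Rmult_le_reg_l with (/ Rpower y s * / Rpower x s).
    { apply Rmult_lt_0_compat; now apply Rinv_0_lt_compat. }
    replace (/ Rpower y s * / Rpower x s * Rpower x s) with (/ Rpower y s) by (field; lra).
    replace (/ Rpower y s * / Rpower x s * (/ Rpower L s * Rpower y s)) with (/ Rpower L s * / Rpower x s) by (field; lra).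
    exact E.
Qed.

Lemma kb_pos zeta n : 0 < kb zeta n.
Proof. unfold kb. assert (0 < kk n ^ 2) by (apply pow_lt; auto). generalize (pow2_ge_0 (bzeta zeta)). lra. Qed.

Lemma wbase_kb nu zeta n : 0 < nu -> zeta <> (0%Z, 0%Z) ->
  wbase nu zeta n <= (1 + nu + 4 / nu) * kb zeta n /\ kb zeta n <= (1 + nu + 4 / nu) * wbase nu zeta n.
Proof.
  intros Hnu Hz. destruct (bomega2_bounds 0%C zeta Hz) as [Z1 [Z2 [Z3 [Z4 _]]]]. unfold wbase, kb.
  assert (0 < 4 / nu) by (apply Rdiv_lt_0_compat; lra).
  assert (K := pow2_ge_0 (kk n)).
  assert (zabs zeta ^ 2 <= bzeta zeta ^ 2) by (unfold bzeta; apply sq_le; lra).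
  set (x := kk n ^ 2) in *. set (y := zabs zeta ^ 2) in *. set (b := bzeta zeta ^ 2) in *.
  assert (0 <= y) by apply pow2_ge_0.
  split; [|].
  - assert (0 <= 4 / nu * (x + b)) by (apply Rmult_le_pos; lra). nra.
  - assert (E : 4 / nu * (nu * x) = 4 * x) by (field; lra).
    assert (E' : 4 / nu * (nu * y) = 4 * y) by (field; lra).
    assert (0 <= nu * x) by nra. assert (0 <= nu * y) by nra.
    assert (0 <= (1 + nu) * (1 + nu * x + nu * y)) by nra. nra.
Qed.

Lemma wgt_kb nu s : 0 < nu -> exists M, 0 < M /\ forall zeta n, zeta <> (0%Z, 0%Z) ->
  wgt nu s zeta n <= M * Rpower (kb zeta n) s /\ Rpower (kb zeta n) s <= M * wgt nu s zeta n.
Proof.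
  intros Hnu. exists (Rpower (1 + nu + 4 / nu) (Rabs s)). split; auto.
  intros zeta n Hz. destruct (wbase_kb nu zeta n Hnu Hz) as [H1 H2].
  assert (0 < 4 / nu) by (apply Rdiv_lt_0_compat; lra).
  assert (O := wbase_ge1 nu zeta n Hnu). assert (A := kb_pos zeta n).
  split; apply Rpower_comp; try lra; fold (wbase nu zeta n); lra.
Qed.

Lemma kb_le zeta n : zeta <> (0%Z, 0%Z) -> kb zeta n <= 2 * (kk n ^ 2 * bzeta zeta ^ 2).
Proof.
  intros Hz. destruct (bomega2_bounds 0%C zeta Hz) as [Z1 [Z2 [Z3 [Z4 _]]]]. unfold kb.
  assert (1 <= kk n ^ 2) by (generalize (kk_ge1 n); nra). nra.
Qed.

(** Separates k from zeta: for s >= 0 through x + y <= 2 x y, for s < 0 by dropping k^2. *)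
Lemma Rpower_kb_upper zeta n s : zeta <> (0%Z, 0%Z) ->
  Rpower (kb zeta n) s <= Rpower 2 (Rmax 0 s) * kpow n (2 * Rmax 0 s) * Rpower (bzeta zeta ^ 2) s.
Proof.
  intros Hz. destruct (bomega2_bounds 0%C zeta Hz) as [Z1 [Z2 [Z3 [Z4 _]]]].
  assert (Hk : 0 < kk n ^ 2) by (apply pow_lt; auto).
  destruct (Rle_dec 0 s) as [H|H].
  - rewrite Rmax_right; auto. rewrite <- Rpower_kk2, !Rpower_mult_distr; try lra.
    apply Rle_Rpower_l; auto. split; [apply kb_pos|]. rewrite Rmult_assoc. now apply kb_le.
  - rewrite Rmax_left; [|lra]. rewrite Rpower_O, Rmult_0_r, kpow_0, !Rmult_1_l; [|lra].
    rewrite <- (Ropp_involutive s), !(Rpower_Ropp _ (- s)).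
    apply Rinv_le_contravar; auto. apply Rle_Rpower_l; [lra|]. unfold kb. lra.
Qed.

(** The squared H^s norm of the sequence 1/k, which dominates the coefficients of the constant 1. *)
Lemma sum_Rpower_kb s : s < 1 / 2 -> exists K, 0 < K /\ forall zeta N, zeta <> (0%Z, 0%Z) ->
  rsum (fun n => Rpower (kb zeta n) s * kpow n (-2)) N <= K * Rpower (bzeta zeta ^ 2) s.
Proof.
  intros Hs. set (t := Rmax 0 s).
  assert (Ht : t < 1 / 2) by (apply Rmax_lub_lt; lra).
  destruct (p_series_bounded (2 - 2 * t) ltac:(lra)) as [Y [HY0 HY]].
  exists (Rpower 2 t * Y). split; [apply Rmult_lt_0_compat; auto|].
  intros zeta N Hz.
  apply Rle_trans with (rsum (fun n => (Rpower 2 t * Rpower (bzeta zeta ^ 2) s) * kpow n (- (2 - 2 * t))) N).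
  - apply rsum_le; intros n _. replace (- (2 - 2 * t)) with (2 * t + -2) by ring. rewrite kpow_plus.
    replace (Rpower 2 t * Rpower (bzeta zeta ^ 2) s * (kpow n (2 * t) * kpow n (-2))) with
      (Rpower 2 t * kpow n (2 * t) * Rpower (bzeta zeta ^ 2) s * kpow n (-2)) by ring.
    apply Rmult_le_compat_r; [left; apply kpow_pos|]. now apply Rpower_kb_upper.
  - rewrite rsum_scal. replace (Rpower 2 t * Y * Rpower (bzeta zeta ^ 2) s) with (Rpower 2 t * Rpower (bzeta zeta ^ 2) s * Y) by ring.
    apply Rmult_le_compat_l; auto. apply Rmult_le_pos; left; auto.
Qed.

Lemma kw_pos lam zeta n : zeta <> (0%Z, 0%Z) -> 0 < kw lam zeta n.
Proof.
  intros Hz. destruct (bomega2_bounds lam zeta Hz) as [_ [_ [_ [Z4 [Z5 _]]]]]. unfold kw.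
  generalize (pow2_ge_0 (kk n)). lra.
Qed.

Lemma sum_kpow_kw s : 0 <= s < 3 / 2 -> exists K, 0 < K /\ forall lam zeta N, zeta <> (0%Z, 0%Z) ->
  rsum (fun n => kpow n (2 * s - 2) / kw lam zeta n ^ 2) N <= K * Rpower (bomega2 lam zeta) (- (7 / 4 - s / 2)).
Proof.
  intros Hs. destruct (p_series_bounded (5 / 2 - s) ltac:(lra)) as [Y [HY0 HY]].
  exists Y. split; auto. intros lam zeta N Hz.
  destruct (bomega2_bounds lam zeta Hz) as [_ [_ [_ [Z4 [Z5 _]]]]].
  eapply Rle_trans; [|rewrite Rmult_comm; apply Rmult_le_compat_l; [left; auto|apply (HY N)]].
  rewrite <- rsum_scal. apply rsum_le; intros n _.
  set (w := bomega2 lam zeta) in *. assert (Pp := kw_pos lam zeta n Hz).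
  (* Interpolation kw^2 >= k^(2p) w^(2-p). Summability in k requires p > s - 1/2; a decay in w that
     still beats a factor |zeta| <= w^(1/2) requires p < 1. The value is the midpoint, available for
     s < 3/2. *)
  set (p := s / 2 + 1 / 4).
  assert (E : kpow n (2 * p) * Rpower w (2 - p) <= kw lam zeta n ^ 2).
  { replace (kw lam zeta n ^ 2) with (Rpower (kw lam zeta n) p * Rpower (kw lam zeta n) (2 - p)).
    - rewrite <- Rpower_kk2. assert (0 < kk n ^ 2) by (apply pow_lt; auto).
      apply Rmult_le_compat; try (left; apply Rpower_pos); unfold kw; fold w; apply Rle_Rpower_l; unfold p; lra.
    - rewrite <- Rpower_plus. replace (p + (2 - p)) with (INR 2) by (simpl; ring). now apply Rpower_pow. }
  replace (7 / 4 - s / 2) with (2 - p) by (unfold p; field). rewrite Rpower_Ropp.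
  assert (A := kpow_pos n (2 * p)). assert (B := Rpower_pos w (2 - p)).
  apply Rle_trans with (kpow n (2 * s - 2) / (kpow n (2 * p) * Rpower w (2 - p))).
  - unfold Rdiv. apply Rmult_le_compat_l; [left; apply kpow_pos|]. apply Rinv_le_contravar; nra.
  - replace (2 * s - 2) with (- (5 / 2 - s) + 2 * p) by (unfold p; field). rewrite kpow_plus.
    right. field. lra.
Qed.

Definition Ms_term s lam zeta n :=
  / (kk n ^ 2 * (kk n ^ 4 + bomega2 lam zeta ^ 2) * Rpower (kk n ^ 2 + bzeta zeta ^ 2) s).

Lemma Ms_term_E s lam zeta n : Ms_term s lam zeta n = kpow n (-2) * / (kk n ^ 4 + bomega2 lam zeta ^ 2) * Rpower (kb zeta n) (- s).
Proof.
  unfold Ms_term. rewrite Rpower_Ropp, kpow_m2, !Rinv_mult. reflexivity.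
Qed.

Lemma den_pos lam zeta n : 0 < kk n ^ 4 + bomega2 lam zeta ^ 2.
Proof. assert (0 < kk n ^ 4) by (apply pow_lt; auto). generalize (pow2_ge_0 (bomega2 lam zeta)); lra. Qed.

Lemma Ms_term_pos s lam zeta n : 0 < Ms_term s lam zeta n.
Proof.
  rewrite Ms_term_E. assert (H := den_pos lam zeta n).
  repeat apply Rmult_lt_0_compat; auto; [apply kpow_pos|now apply Rinv_0_lt_compat].
Qed.

Lemma den_kw lam zeta n : zeta <> (0%Z, 0%Z) ->
  kw lam zeta n ^ 2 <= 2 * (kk n ^ 4 + bomega2 lam zeta ^ 2) /\ kk n ^ 4 + bomega2 lam zeta ^ 2 <= kw lam zeta n ^ 2.
Proof.
  intros Hz. destruct (bomega2_bounds lam zeta Hz) as [_ [_ [_ [Z4 [Z5 _]]]]]. unfold kw.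
  assert (H := pow2_ge_0 (kk n)). replace (kk n ^ 4) with ((kk n ^ 2) ^ 2) by ring.
  set (x := kk n ^ 2) in *. set (w := bomega2 lam zeta) in *. generalize (pow2_ge_0 (x - w)). split; nra.
Qed.

(** The terms are of order k^(-6-2s), whence the threshold -5/2. For the index - sigma - 2 it reads
    sigma < 1/2. *)
Lemma Ms_term_summable s lam zeta : -5 / 2 < s -> zeta <> (0%Z, 0%Z) -> ex_series (Ms_term s lam zeta).
Proof.
  intros Hs Hz. set (t := Rmax 0 (- s)).
  assert (Ht : t < 5 / 2) by (apply Rmax_lub_lt; lra).
  destruct (p_series_bounded (6 - 2 * t) ltac:(lra)) as [Y [HY0 HY]].
  apply rsum_ex_series with (Rpower 2 t * Rpower (bzeta zeta ^ 2) (- s) * Y).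
  { intros; left; apply Ms_term_pos. }
  intros N. eapply Rle_trans; [|apply Rmult_le_compat_l; [|apply (HY N)]].
  2:{ apply Rmult_le_pos; left; auto. }
  rewrite <- rsum_scal. apply rsum_le; intros n _. rewrite Ms_term_E.
  assert (U := Rpower_kb_upper zeta n (- s) Hz). fold t in U.
  assert (V : kpow n (-2) * / (kk n ^ 4 + bomega2 lam zeta ^ 2) <= kpow n (-6)).
  { replace (-6) with (-2 + (-2 + -2)) by ring. rewrite !kpow_plus.
    apply Rmult_le_compat_l; [left; apply kpow_pos|]. rewrite kpow_m2.
    assert (0 < kk n ^ 2) by (apply pow_lt; auto). rewrite <- Rinv_mult.
    apply Rinv_le_contravar; [nra|]. generalize (pow2_ge_0 (bomega2 lam zeta)). nra. }
  replace (- (6 - 2 * t)) with (-6 + 2 * t) by ring. rewrite kpow_plus.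
  replace (Rpower 2 t * Rpower (bzeta zeta ^ 2) (- s) * (kpow n (-6) * kpow n (2 * t))) with
    (kpow n (-6) * (Rpower 2 t * kpow n (2 * t) * Rpower (bzeta zeta ^ 2) (- s))) by ring.
  apply Rmult_le_compat; auto; [|left; auto].
  left. apply Rmult_lt_0_compat; [apply kpow_pos|apply Rinv_0_lt_compat, den_pos].
Qed.

Lemma Ms_sq s lam zeta : -5 / 2 < s -> zeta <> (0%Z, 0%Z) ->
  Ms s lam zeta ^ 2 = Series (Ms_term s lam zeta).
Proof.
  intros Hs Hz. unfold Ms. apply pow2_sqrt.
  eapply Rle_trans; [|apply (rsum_le_Series (Ms_term s lam zeta) 0)].
  - simpl; lra.
  - intros; left; apply Ms_term_pos.
  - now apply Ms_term_summable.
Qed.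

Lemma Ms_rsum s lam zeta N : -5 / 2 < s -> zeta <> (0%Z, 0%Z) ->
  rsum (Ms_term s lam zeta) N <= Ms s lam zeta ^ 2.
Proof.
  intros Hs Hz. rewrite Ms_sq; auto. apply rsum_le_Series; [intros; left; apply Ms_term_pos|now apply Ms_term_summable].
Qed.

Lemma Ms_ge0 s lam zeta : 0 <= Ms s lam zeta.
Proof. apply sqrt_pos. Qed.

Lemma Ms_pos s lam zeta : -5 / 2 < s -> zeta <> (0%Z, 0%Z) -> 0 < Ms s lam zeta.
Proof.
  intros Hs Hz. assert (H := Ms_rsum s lam zeta 1 Hs Hz). simpl rsum in H.
  assert (P := Ms_term_pos s lam zeta 0). generalize (Ms_ge0 s lam zeta). nra.
Qed.

Lemma Ms_le s lam zeta B : -5 / 2 < s -> zeta <> (0%Z, 0%Z) ->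
  (forall N, rsum (Ms_term s lam zeta) N <= B) -> Ms s lam zeta ^ 2 <= B.
Proof.
  intros Hs Hz H. rewrite Ms_sq; auto. apply Series_le_bound; auto. intros; left; apply Ms_term_pos.
Qed.

(** Splits M_s into a power of <zeta> and a power of <omega>; the latter is the one from
    [sum_kpow_kw]. *)
Lemma Ms_upper s : -3 / 2 < s < 1 / 2 -> exists K, 0 < K /\ forall lam zeta, zeta <> (0%Z, 0%Z) ->
  Ms s lam zeta ^ 2 <= K * Rpower (bzeta zeta ^ 2) (- s) * Rpower (bomega2 lam zeta) (- (7 / 4 - Rabs s / 2)).
Proof.
  intros Hs. assert (Hr : 0 <= Rabs s < 3 / 2) by (split; [apply Rabs_pos|apply Rabs_def1; lra]).
  destruct (sum_kpow_kw (Rabs s) Hr) as [K [HK HP]].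
  set (t := Rmax 0 (- s)). assert (Ht : t <= Rabs s).
  { apply Rmax_lub; [apply Rabs_pos|]. rewrite <- Rabs_Ropp. apply Rle_abs. }
  exists (Rpower 2 t * 2 * K). split; [repeat apply Rmult_lt_0_compat; auto; lra|].
  intros lam zeta Hz. apply Ms_le; auto; [lra|]. intros N.
  replace (Rpower 2 t * 2 * K * Rpower (bzeta zeta ^ 2) (- s) * Rpower (bomega2 lam zeta) (- (7 / 4 - Rabs s / 2)))
    with ((Rpower 2 t * 2 * Rpower (bzeta zeta ^ 2) (- s)) * (K * Rpower (bomega2 lam zeta) (- (7 / 4 - Rabs s / 2)))) by ring.
  eapply Rle_trans; [|apply Rmult_le_compat_l; [|apply (HP lam zeta N Hz)]].
  2:{ repeat apply Rmult_le_pos; try lra; left; auto. }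
  rewrite <- rsum_scal. apply rsum_le; intros n _. rewrite Ms_term_E.
  assert (U := Rpower_kb_upper zeta n (- s) Hz). fold t in U.
  destruct (den_kw lam zeta n Hz) as [D _]. assert (Pd := den_pos lam zeta n). assert (Pp := kw_pos lam zeta n Hz).
  assert (V : / (kk n ^ 4 + bomega2 lam zeta ^ 2) <= 2 * / kw lam zeta n ^ 2).
  { replace (2 * / kw lam zeta n ^ 2) with (/ (kw lam zeta n ^ 2 / 2)) by (field; lra).
    apply Rinv_le_contravar; [|lra]. apply Rdiv_lt_0_compat; [apply pow_lt; auto|lra]. }
  assert (W : kpow n (2 * t) <= kpow n (2 * Rabs s)) by (apply kpow_le; lra).
  replace (2 * Rabs s - 2) with (-2 + 2 * Rabs s) by ring. rewrite kpow_plus.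
  replace (Rpower 2 t * 2 * Rpower (bzeta zeta ^ 2) (- s) * (kpow n (-2) * kpow n (2 * Rabs s) / kw lam zeta n ^ 2))
    with (kpow n (-2) * (2 * / kw lam zeta n ^ 2) * (Rpower 2 t * kpow n (2 * Rabs s) * Rpower (bzeta zeta ^ 2) (- s)))
    by (field; lra).
  apply Rmult_le_compat.
  - left. apply Rmult_lt_0_compat; [apply kpow_pos|apply Rinv_0_lt_compat, den_pos].
  - left; auto.
  - apply Rmult_le_compat_l; auto. left; apply kpow_pos.
  - eapply Rle_trans; [apply U|]. apply Rmult_le_compat_r; [left; auto|].
    apply Rmult_le_compat_l; auto. left; auto.
Qed.

(** Dropping k^4 in the denominator leaves the weighted norm of 1/k. The power of <zeta> is inverse
    to the one in [Ms_upper]. *)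
Lemma Ms_opp_upper s : -5 / 2 < s < 1 / 2 -> exists K, 0 < K /\ forall lam zeta, zeta <> (0%Z, 0%Z) ->
  Ms (- s) lam zeta ^ 2 <= K * Rpower (bzeta zeta ^ 2) s / bomega2 lam zeta ^ 2.
Proof.
  intros Hs. destruct (sum_Rpower_kb s ltac:(lra)) as [K [HK HW]].
  exists K. split; auto. intros lam zeta Hz.
  destruct (bomega2_bounds lam zeta Hz) as [_ [_ [_ [Z4 [Z5 _]]]]].
  apply Ms_le; auto; [lra|]. intros N.
  unfold Rdiv. rewrite (Rmult_comm _ (/ _)).
  eapply Rle_trans; [|apply Rmult_le_compat_l; [|apply (HW zeta N Hz)]].
  2:{ left. apply Rinv_0_lt_compat, pow_lt. lra. }
  rewrite <- rsum_scal. apply rsum_le; intros n _. rewrite Ms_term_E, Ropp_involutive.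
  assert (V : / (kk n ^ 4 + bomega2 lam zeta ^ 2) <= / bomega2 lam zeta ^ 2).
  { apply Rinv_le_contravar; [apply pow_lt; lra|]. assert (0 < kk n ^ 4) by (apply pow_lt; auto). lra. }
  replace (/ bomega2 lam zeta ^ 2 * (Rpower (kb zeta n) s * kpow n (-2))) with
    (kpow n (-2) * / bomega2 lam zeta ^ 2 * Rpower (kb zeta n) s) by ring.
  apply Rmult_le_compat_r; [left; auto|]. apply Rmult_le_compat_l; auto. left; apply kpow_pos.
Qed.

(** * The uncoupled system *)

Definition hfreq (zeta : Z * Z) (i : nat) : R :=
  match i with O => IZR (fst zeta) | S O => IZR (snd zeta) | _ => 0 end.

(* In a triple X the components 0, 1, 2 are u, v, theta. The operator of the theorem is [stokes] + [coupling],
   where [stokes] is its value at alpha = beta = gamma = 0. *)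
Definition stokes a nu lam zeta (X : nat -> nat -> C) (p0 : C) (i n : nat) : C :=
  (symb a nu lam zeta n * X i n + Ci * RtoC (hfreq zeta i) * p0 * RtoC (one_coef a n))%C.

Definition hdot zeta (X : nat -> nat -> C) (n : nat) : C :=
  (RtoC (IZR (fst zeta)) * X 0%nat n + RtoC (IZR (snd zeta)) * X 1%nat n)%C.

Definition coupling a alpha beta gamma zeta (X : nat -> nat -> C) (i n : nat) : C :=
  match i with
  | O => (- (RtoC alpha * X 1%nat n) + Ci * RtoC (IZR (fst zeta)) * RtoC beta * Iz a (X 2%nat) n)%C
  | S O => (RtoC alpha * X 0%nat n + Ci * RtoC (IZR (snd zeta)) * RtoC beta * Iz a (X 2%nat) n)%C
  | _ => (- (RtoC gamma * Iz a (fun m => Ci * RtoC (IZR (fst zeta)) * X 0%nat m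
                                 + Ci * RtoC (IZR (snd zeta)) * X 1%nat m)%C n))%C
  end.

Definition l2le3 (w : nat -> R) (F : nat -> nat -> C) B := forall i, (i < 3)%nat -> l2le w (F i) B.

Definition in_dom a nu s zeta (X : nat -> nat -> C) :=
  (exists B, l2le3 (wgt nu (s + 2) zeta) X B) /\
  Cseries (fun n => (hdot zeta X n * RtoC (one_coef a n))%C) = 0%C.

(** The profile of the pressure response: the coefficients of the solution y of (omega^2 - nu d_zz)
    y = 1. *)
Definition pmode a nu lam zeta n : C := (RtoC (one_coef a n) / symb a nu lam zeta n)%C.

(** The pressure for which G/symb - i zeta p0 [pmode] satisfies the divergence constraint; the
    factor - i is the inverse of i. *)
Definition stokes_p a nu lam zeta (G : nat -> nat -> C) : C :=
  ((- Ci * Cseries (fun n => (pmode a nu lam zeta n * hdot zeta G n)%C)) /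
   (RtoC (zabs zeta ^ 2) * psum a nu lam zeta))%C.

Definition stokes_inv a nu lam zeta (G : nat -> nat -> C) (i n : nat) : C :=
  (G i n / symb a nu lam zeta n - Ci * RtoC (hfreq zeta i) * stokes_p a nu lam zeta G * pmode a nu lam zeta n)%C.

(** All that the later estimates use of the sector. With c and ck fixed, constants derived from it
    are uniform in lam and zeta. *)
Definition symb_bounds a nu c ck lam zeta := 0 < c /\ 0 < ck /\ zeta <> (0%Z, 0%Z) /\
  (forall n, c * kw lam zeta n <= Cmod (symb a nu lam zeta n)) /\
  ck / bomega2 lam zeta <= Cmod (psum a nu lam zeta).

Lemma L1_split a nu alpha beta gamma lam zeta X p0 n :
  L1 a nu alpha beta lam zeta (X 0%nat) (X 1%nat) p0 (X 2%nat) n =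
  (stokes a nu lam zeta X p0 0 n + coupling a alpha beta gamma zeta X 0 n)%C.
Proof. unfold L1, stokes, coupling, hfreq. ring. Qed.
Lemma L2_split a nu alpha beta gamma lam zeta X p0 n :
  L2 a nu alpha beta lam zeta (X 0%nat) (X 1%nat) p0 (X 2%nat) n =
  (stokes a nu lam zeta X p0 1 n + coupling a alpha beta gamma zeta X 1 n)%C.
Proof. unfold L2, stokes, coupling, hfreq. ring. Qed.
Lemma L3_split a nu alpha beta gamma lam zeta X p0 n :
  L3 a nu gamma lam zeta (X 0%nat) (X 1%nat) (X 2%nat) n =
  (stokes a nu lam zeta X p0 2 n + coupling a alpha beta gamma zeta X 2 n)%C.
Proof. unfold L3, stokes, coupling, hfreq. ring. Qed.

Lemma symb_nz a nu c ck lam zeta n : symb_bounds a nu c ck lam zeta -> symb a nu lam zeta n <> 0%C.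
Proof.
  intros [Hc [_ [Hz [H _]]]]. apply Cmod_gt_0. eapply Rlt_le_trans; [|apply H].
  apply Rmult_lt_0_compat; auto. now apply kw_pos.
Qed.

Lemma hdot_stokes a nu lam zeta X p0 n : hdot zeta (stokes a nu lam zeta X p0) n =
  (symb a nu lam zeta n * hdot zeta X n + Ci * RtoC (zabs zeta ^ 2) * p0 * RtoC (one_coef a n))%C.
Proof.
  rewrite zabs_sq, RtoC_plus, !RtoC_pow. unfold hdot, stokes, hfreq. ring.
Qed.

Lemma hfreq_le zeta i : Rabs (hfreq zeta i) <= zabs zeta.
Proof.
  assert (Z := zabs_sq zeta). assert (Z0 := zabs_ge0 zeta).
  assert (H1 := pow2_ge_0 (IZR (fst zeta))). assert (H2 := pow2_ge_0 (IZR (snd zeta))).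
  destruct i as [|[|i]]; simpl hfreq; [| |rewrite Rabs_R0; auto];
    apply sq_le_inv; auto; rewrite pow2_abs; lra.
Qed.

Lemma hdot_l2le w zeta G B : (forall n, 0 <= w n) -> l2le3 w G B -> l2le w (hdot zeta G) (2 * zabs zeta * B).
Proof.
  intros Hw H. assert (H0 := H 0%nat ltac:(lia)). assert (H1 := H 1%nat ltac:(lia)).
  assert (HB : 0 <= B) by apply H0.
  apply l2le_weaken with (Rabs (hfreq zeta 0) * B + Rabs (hfreq zeta 1) * B).
  - generalize (hfreq_le zeta 0) (hfreq_le zeta 1). nra.
  - unfold hdot. apply l2le_plus; auto.
    + rewrite <- (Cmod_R (hfreq zeta 0)). now apply l2le_scal.
    + rewrite <- (Cmod_R (hfreq zeta 1)). now apply l2le_scal.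
Qed.

Lemma one_coef_sq a n : 0 < a -> one_coef a n ^ 2 <= (2 * amp a * a / PI) ^ 2 * kpow n (-2).
Proof.
  intros Ha. rewrite kpow_m2, <- pow2_abs. assert (H := one_coef_bound a n Ha).
  replace ((2 * amp a * a / PI) ^ 2 * / kk n ^ 2) with ((2 * amp a * a / PI / kk n) ^ 2).
  - apply sq_le. split; auto. apply Rabs_pos.
  - unfold Rdiv at 1. rewrite Rpow_mult_distr, pow_inv. reflexivity.
Qed.

Lemma pmode_sq a nu c ck : 0 < a -> exists K, 0 < K /\ forall lam zeta n, symb_bounds a nu c ck lam zeta ->
  Cmod (pmode a nu lam zeta n) ^ 2 <= K * kpow n (-2) * / (kk n ^ 4 + bomega2 lam zeta ^ 2).
Proof.
  intros Ha. set (D := (2 * amp a * a / PI) ^ 2).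
  assert (HD : 0 < D).
  { unfold D. apply pow_lt, Rdiv_lt_0_compat; [|apply PI_RGT_0]. generalize (amp_pos a Ha). nra. }
  exists (D / c ^ 2 + 1). split.
  { assert (0 <= D / c ^ 2); [|lra]. unfold Rdiv. apply Rmult_le_pos; [lra|].
    rewrite <- pow_inv. apply pow2_ge_0. }
  intros lam zeta n HS. assert (Hnz := symb_nz a nu c ck lam zeta n HS).
  destruct HS as [Hc [_ [Hz [H _]]]]. specialize (H n).
  assert (Pp := kw_pos lam zeta n Hz). destruct (den_kw lam zeta n Hz) as [_ D2].
  assert (Pd := den_pos lam zeta n).
  unfold pmode. rewrite Cmod_div, Cmod_R; auto. unfold Rdiv at 1. rewrite Rpow_mult_distr, pow2_abs, pow_inv.
  assert (E : c ^ 2 * (kk n ^ 4 + bomega2 lam zeta ^ 2) <= Cmod (symb a nu lam zeta n) ^ 2).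
  { apply Rle_trans with ((c * kw lam zeta n) ^ 2).
    - rewrite Rpow_mult_distr. apply Rmult_le_compat_l; auto. apply pow2_ge_0.
    - apply sq_le. split; auto. nra. }
  assert (Hc2 : 0 < c ^ 2) by (apply pow_lt; auto).
  assert (Q := kpow_pos n (-2)).
  assert (QI : 0 < / (kk n ^ 4 + bomega2 lam zeta ^ 2)) by (now apply Rinv_0_lt_compat).
  apply Rle_trans with (D * kpow n (-2) * / (c ^ 2 * (kk n ^ 4 + bomega2 lam zeta ^ 2))).
  - apply Rmult_le_compat; [apply pow2_ge_0| |now apply one_coef_sq|].
    + left; apply Rinv_0_lt_compat. nra.
    + apply Rinv_le_contravar; auto. nra.
  - rewrite Rinv_mult.
    replace ((D / c ^ 2 + 1) * kpow n (-2) * / (kk n ^ 4 + bomega2 lam zeta ^ 2)) with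
      (D * kpow n (-2) * (/ c ^ 2 * / (kk n ^ 4 + bomega2 lam zeta ^ 2)) + kpow n (-2) * / (kk n ^ 4 + bomega2 lam zeta ^ 2)) by (field; lra).
    nra.
Qed.

(** Origin of M_s: up to a constant it bounds the norm of [pmode] in the dual space H^(-s), and the
    pairing is Cauchy-Schwarz. *)
Lemma pmode_pairing a nu c ck s : 0 < a -> 0 < nu -> -5 / 2 < s -> exists K, 0 < K /\ forall lam zeta f B N,
  symb_bounds a nu c ck lam zeta -> l2le (wgt nu s zeta) f B ->
  rsum (fun n => Cmod (pmode a nu lam zeta n * f n)) N <= K * Ms s lam zeta * B.
Proof.
  intros Ha Hnu Hs. destruct (pmode_sq a nu c ck Ha) as [K1 [HK1 Hb]].
  destruct (wgt_kb nu s Hnu) as [M [HM HW]].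
  exists (sqrt (K1 * M)). assert (0 < K1 * M) by nra. split; [now apply sqrt_lt_R0|].
  intros lam zeta f B N HS Hf.
  assert (Hz : zeta <> (0%Z, 0%Z)) by apply HS.
  rewrite (rsum_ext _ (fun n => Cmod (f n) * Rabs (Cmod (pmode a nu lam zeta n)))).
  - apply l2le_pair_abs with (w := wgt nu s zeta); auto.
    + apply Rmult_le_pos; [apply sqrt_pos|apply Ms_ge0].
    + rewrite Rpow_mult_distr, pow2_sqrt; [|lra].
      eapply Rle_trans; [|apply Rmult_le_compat_l; [lra|apply (Ms_rsum s lam zeta N Hs Hz)]].
      rewrite <- rsum_scal. apply rsum_le; intros n _. rewrite Ms_term_E.
      destruct (HW zeta n Hz) as [_ W]. assert (Wp := wgt_pos nu s zeta n).
      specialize (Hb lam zeta n HS).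
      replace (K1 * M * (kpow n (-2) * / (kk n ^ 4 + bomega2 lam zeta ^ 2) * Rpower (kb zeta n) (- s))) with
        ((K1 * kpow n (-2) * / (kk n ^ 4 + bomega2 lam zeta ^ 2)) * (M * Rpower (kb zeta n) (- s))) by ring.
      unfold Rdiv. apply Rmult_le_compat; auto; [apply pow2_ge_0|left; now apply Rinv_0_lt_compat|].
      rewrite Rpower_Ropp. assert (AP := Rpower_pos (kb zeta n) s).
      apply Rmult_le_reg_l with (wgt nu s zeta n * Rpower (kb zeta n) s); [nra|].
      replace (wgt nu s zeta n * Rpower (kb zeta n) s * / wgt nu s zeta n) with (Rpower (kb zeta n) s) by (field; lra).
      replace (wgt nu s zeta n * Rpower (kb zeta n) s * (M * / Rpower (kb zeta n) s)) with (M * wgt nu s zeta n) by (field; lra).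
      exact W.
  - intros n _. rewrite Cmod_mult, (Rabs_pos_eq (Cmod _)); [ring|apply Cmod_ge_0].
Qed.

Lemma pmode_l2le a nu c ck s : 0 < a -> 0 < nu -> s < 5 / 2 -> exists K, 0 < K /\ forall lam zeta,
  symb_bounds a nu c ck lam zeta -> l2le (wgt nu s zeta) (pmode a nu lam zeta) (K * Ms (- s) lam zeta).
Proof.
  intros Ha Hnu Hs. destruct (pmode_sq a nu c ck Ha) as [K1 [HK1 Hb]].
  destruct (wgt_kb nu s Hnu) as [M [HM HW]].
  exists (sqrt (K1 * M)). assert (0 < K1 * M) by nra. split; [now apply sqrt_lt_R0|].
  intros lam zeta HS. assert (Hz : zeta <> (0%Z, 0%Z)) by apply HS.
  split; [apply Rmult_le_pos; [apply sqrt_pos|apply Ms_ge0]|]. intros N.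
  rewrite Rpow_mult_distr, pow2_sqrt; [|lra].
  eapply Rle_trans; [|apply Rmult_le_compat_l; [lra|apply (Ms_rsum (- s) lam zeta N ltac:(lra) Hz)]].
  rewrite <- rsum_scal. apply rsum_le; intros n _. rewrite Ms_term_E, Ropp_involutive.
  destruct (HW zeta n Hz) as [W _]. specialize (Hb lam zeta n HS).
  replace (K1 * M * (kpow n (-2) * / (kk n ^ 4 + bomega2 lam zeta ^ 2) * Rpower (kb zeta n) s)) with
        ((M * Rpower (kb zeta n) s) * (K1 * kpow n (-2) * / (kk n ^ 4 + bomega2 lam zeta ^ 2))) by ring.
  apply Rmult_le_compat; auto. apply pow2_ge_0.
Qed.

(** |symb| >= c kw, and kw dominates both <omega>^2 and, up to a constant, the base of the weight.
    This is the source of (c) and (d). *)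
Lemma div_symb_l2le a nu c ck s : 0 < nu -> exists K, 0 < K /\ forall lam zeta f B,
  symb_bounds a nu c ck lam zeta -> l2le (wgt nu s zeta) f B ->
  l2le (wgt nu s zeta) (fun n => (f n / symb a nu lam zeta n)%C) (K * B / bomega2 lam zeta) /\
  l2le (wgt nu (s + 2) zeta) (fun n => (f n / symb a nu lam zeta n)%C) (K * B).
Proof.
  intros Hnu. set (L := 1 + nu + 4 / nu).
  assert (HL : 0 < 4 / nu) by (apply Rdiv_lt_0_compat; lra).
  (* The constant is chosen before c is known to be positive, which is part of [symb_bounds]; hence
     [Rabs c], and + 1 to keep it positive in any case. *)
  exists ((1 + L) / Rabs c + 1). split.
  { assert (0 <= (1 + L) / Rabs c); [|lra]. unfold Rdiv. apply Rmult_le_pos; [unfold L; lra|].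
    rewrite <- Rabs_inv. apply Rabs_pos. }
  intros lam zeta f B HS Hf. assert (Hnz := fun n => symb_nz a nu c ck lam zeta n HS).
  destruct HS as [Hc [_ [Hz [H _]]]]. rewrite (Rabs_pos_eq c); [|lra].
  destruct (bomega2_bounds lam zeta Hz) as [_ [_ [_ [Z4 [Z5 _]]]]].
  assert (Hw : 0 < bomega2 lam zeta) by lra.
  assert (HB : 0 <= B) by apply Hf.
  assert (Hin : forall n, / Cmod (symb a nu lam zeta n) <= / (c * kw lam zeta n)).
  { intros n. apply Rinv_le_contravar; auto. apply Rmult_lt_0_compat; auto. now apply kw_pos. }
  assert (Hdm : forall n, Cmod (f n / symb a nu lam zeta n) <= / (c * kw lam zeta n) * Cmod (f n)).
  { intros n. rewrite Cmod_div; auto. unfold Rdiv. rewrite Rmult_comm.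
    apply Rmult_le_compat_r; auto. apply Cmod_ge_0. }
  split.
  - apply l2le_weaken with (/ (c * bomega2 lam zeta) * B).
    + assert (0 <= L / c) by (apply Rdiv_le_0_compat; unfold L; lra).
      replace (((1 + L) / c + 1) * B / bomega2 lam zeta) with (/ (c * bomega2 lam zeta) * B + (L / c + 1) * (B / bomega2 lam zeta)) by (field; lra).
      assert (0 <= B / bomega2 lam zeta) by (apply Rdiv_le_0_compat; lra).
      assert (0 <= (L / c + 1) * (B / bomega2 lam zeta)) by (apply Rmult_le_pos; lra). lra.
    + revert Hf. apply l2le_dom.
      { left; apply Rinv_0_lt_compat. nra. }
      intros n. replace ((/ (c * bomega2 lam zeta)) ^ 2 * (wgt nu s zeta n * Cmod (f n) ^ 2)) with
        (wgt nu s zeta n * (/ (c * bomega2 lam zeta) * Cmod (f n)) ^ 2) by ring.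
      apply Rmult_le_compat_l; auto. apply sq_le. split; [apply Cmod_ge_0|].
      eapply Rle_trans; [apply Hdm|]. apply Rmult_le_compat_r; [apply Cmod_ge_0|].
      apply Rinv_le_contravar; [nra|]. apply Rmult_le_compat_l; [lra|].
      unfold kw. generalize (pow2_ge_0 (kk n)). lra.
  - apply l2le_weaken with (L / c * B).
    + assert (0 <= / c) by (left; now apply Rinv_0_lt_compat). unfold Rdiv. nra.
    + revert Hf. apply l2le_dom; [apply Rdiv_le_0_compat; unfold L; lra|].
      intros n. rewrite !wgt_wbase, Rpower_plus.
      replace (Rpower (wbase nu zeta n) 2) with (wbase nu zeta n ^ 2).
      2:{ replace 2 with (INR 2) by (simpl; ring). rewrite Rpower_pow; auto. generalize (wbase_ge1 nu zeta n Hnu); lra. }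
      replace ((L / c) ^ 2 * (Rpower (wbase nu zeta n) s * Cmod (f n) ^ 2)) with
        (Rpower (wbase nu zeta n) s * (L / c * Cmod (f n)) ^ 2) by ring.
      rewrite Rmult_assoc, <- Rpow_mult_distr.
      apply Rmult_le_compat_l; [left; auto|]. assert (O := wbase_ge1 nu zeta n Hnu).
      apply sq_le. split; [apply Rmult_le_pos; [lra|apply Cmod_ge_0]|].
      apply Rle_trans with (wbase nu zeta n * (/ (c * kw lam zeta n) * Cmod (f n))).
      { apply Rmult_le_compat_l; auto; lra. }
      rewrite <- Rmult_assoc. apply Rmult_le_compat_r; [apply Cmod_ge_0|].
      assert (Pp := kw_pos lam zeta n Hz).
      apply Rmult_le_reg_r with (c * kw lam zeta n); [nra|].
      replace (wbase nu zeta n * / (c * kw lam zeta n) * (c * kw lam zeta n)) with (wbase nu zeta n) by (field; lra).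
      replace (L / c * (c * kw lam zeta n)) with (L * kw lam zeta n) by (field; lra).
      destruct (wbase_kb nu zeta n Hnu Hz) as [U _]. eapply Rle_trans; [exact U|]. fold L.
      apply Rmult_le_compat_l; [unfold L; lra|]. unfold kb, kw. lra.
Qed.

Lemma wgt_ge1 nu r zeta n : 0 < nu -> 0 <= r -> 1 <= wgt nu r zeta n.
Proof.
  intros Hnu Hr. rewrite wgt_wbase. rewrite <- (Rpower_O (wbase nu zeta n)).
  - apply Rle_Rpower; auto. now apply wbase_ge1.
  - generalize (wbase_ge1 nu zeta n Hnu); lra.
Qed.

Lemma one_coef_pairing a nu r zeta f B : 0 < a -> 0 < nu -> 0 <= r -> l2le (wgt nu r zeta) f B ->
  abs_summable (fun n => (f n * RtoC (one_coef a n))%C).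
Proof.
  intros Ha Hnu Hr Hf. destruct (p_series_bounded 2 ltac:(lra)) as [Y [HY0 HY]].
  replace (- (2)) with (-2) in HY by ring. set (D := (2 * amp a * a / PI) ^ 2).
  exists (sqrt (D * Y) * B). intros N.
  rewrite (rsum_ext _ (fun n => Cmod (f n) * Rabs (one_coef a n))).
  - apply l2le_pair_abs with (w := wgt nu r zeta); auto; [apply sqrt_pos|].
    assert (HD : 0 <= D) by apply pow2_ge_0.
    rewrite pow2_sqrt; [|nra]. eapply Rle_trans; [|apply Rmult_le_compat_l; [auto|apply (HY N)]].
    rewrite <- rsum_scal. apply rsum_le; intros n _.
    assert (W := wgt_ge1 nu r zeta n Hnu Hr).
    apply Rle_trans with (one_coef a n ^ 2); [|now apply one_coef_sq].
    apply Rmult_le_reg_r with (wgt nu r zeta n); [lra|].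
    unfold Rdiv. rewrite Rmult_assoc, Rinv_l; [|lra]. generalize (pow2_ge_0 (one_coef a n)). nra.
  - intros n _. now rewrite Cmod_mult, Cmod_R.
Qed.

Lemma one_coef_pairing_hdot a nu s zeta X B : 0 < a -> 0 < nu -> -2 <= s -> l2le3 (wgt nu (s + 2) zeta) X B ->
  abs_summable (fun n => (hdot zeta X n * RtoC (one_coef a n))%C).
Proof.
  intros Ha Hnu Hs HX. apply one_coef_pairing with (nu := nu) (r := s + 2) (zeta := zeta) (B := 2 * zabs zeta * B); auto; [lra|].
  apply hdot_l2le; auto.
Qed.

Lemma pmode_one_coef_summable a nu c ck lam zeta : 0 < a -> 0 < nu -> symb_bounds a nu c ck lam zeta ->
  abs_summable (fun n => (pmode a nu lam zeta n * RtoC (one_coef a n))%C).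
Proof.
  intros Ha Hnu HS. destruct (pmode_l2le a nu c ck 0 Ha Hnu ltac:(lra)) as [K [HK H]].
  apply one_coef_pairing with (nu := nu) (r := 0) (zeta := zeta) (B := K * Ms (- 0) lam zeta); auto; lra.
Qed.

Lemma psum_E a nu lam zeta : psum a nu lam zeta =
  Cseries (fun n => (pmode a nu lam zeta n * RtoC (one_coef a n))%C).
Proof. apply Cseries_ext. intros n. unfold pmode, Cdiv. ring. Qed.

Lemma psum_nz a nu c ck lam zeta : symb_bounds a nu c ck lam zeta -> psum a nu lam zeta <> 0%C.
Proof.
  intros [_ [Hck [Hz [_ H]]]]. apply Cmod_gt_0. eapply Rlt_le_trans; [|apply H].
  destruct (bomega2_bounds lam zeta Hz) as [_ [_ [_ [Z4 [Z5 _]]]]]. apply Rdiv_lt_0_compat; lra.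
Qed.

Lemma pmode_hdot_summable a nu c ck s lam zeta G B : 0 < a -> 0 < nu -> -5 / 2 < s -> symb_bounds a nu c ck lam zeta ->
  l2le3 (wgt nu s zeta) G B -> abs_summable (fun n => (pmode a nu lam zeta n * hdot zeta G n)%C).
Proof.
  intros Ha Hnu Hs HS HG. destruct (pmode_pairing a nu c ck s Ha Hnu Hs) as [K [HK H]].
  eexists. intros N. apply H with (N := N); auto. apply hdot_l2le; eauto.
Qed.

(** Divide by symb and pair with the integrals of the e_k: the divergence constraint removes X, and
    only the pressure is left. *)
Lemma pressure_eq a nu c ck s lam zeta X p0 B G : 0 < a -> 0 < nu -> -2 <= s -> symb_bounds a nu c ck lam zeta ->
  in_dom a nu s zeta X -> l2le3 (wgt nu s zeta) G B ->
  (forall i n, (i < 3)%nat -> stokes a nu lam zeta X p0 i n = G i n) ->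
  (Cseries (fun n => (pmode a nu lam zeta n * hdot zeta G n)%C) = Ci * RtoC (zabs zeta ^ 2) * p0 * psum a nu lam zeta)%C.
Proof.
  intros Ha Hnu Hs HS [[BX HX] Hdiv] HG HA.
  assert (HE : forall n, (hdot zeta X n * RtoC (one_coef a n))%C =
     (pmode a nu lam zeta n * hdot zeta G n + (- (Ci * RtoC (zabs zeta ^ 2) * p0)) * (pmode a nu lam zeta n * RtoC (one_coef a n)))%C).
  { intros n. replace (hdot zeta G n) with (hdot zeta (stokes a nu lam zeta X p0) n).
    - rewrite hdot_stokes. unfold pmode. field. eapply symb_nz; eauto.
    - unfold hdot. rewrite !HA; auto. }
  rewrite (Cseries_ext _ _ HE), Cseries_plus, Cseries_scal in Hdiv.
  - rewrite <- psum_E in Hdiv.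
    transitivity ((Cseries (fun n => (pmode a nu lam zeta n * hdot zeta G n)%C) + - (Ci * RtoC (zabs zeta ^ 2) * p0) * psum a nu lam zeta)
       + Ci * RtoC (zabs zeta ^ 2) * p0 * psum a nu lam zeta)%C; [ring|]. rewrite Hdiv. ring.
  - eapply pmode_one_coef_summable; eauto.
  - eapply pmode_hdot_summable with (s := s); eauto. lra.
  - apply abs_summable_scal. eapply pmode_one_coef_summable; eauto.
Qed.

(** One factor |zeta| cancels against that of [hdot], and the lower bound for [psum] produces
    <omega>^2. This is (a) with G in place of F. *)
Lemma pressure_estimate a nu c ck s : 0 < a -> 0 < nu -> -2 <= s -> exists K, 0 < K /\ forall lam zeta X p0 B G,
  symb_bounds a nu c ck lam zeta -> in_dom a nu s zeta X -> l2le3 (wgt nu s zeta) G B ->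
  (forall i n, (i < 3)%nat -> stokes a nu lam zeta X p0 i n = G i n) ->
  zabs zeta * Cmod p0 <= K * bomega2 lam zeta * Ms s lam zeta * B.
Proof.
  intros Ha Hnu Hs. destruct (pmode_pairing a nu c ck s Ha Hnu ltac:(lra)) as [K [HK HF]].
  exists (2 * K / Rabs ck + 1). split.
  { assert (0 <= 2 * K / Rabs ck); [|lra]. unfold Rdiv. apply Rmult_le_pos; [lra|].
    rewrite <- Rabs_inv. apply Rabs_pos. }
  intros lam zeta X p0 B G HS HX HG HA.
  assert (E := pressure_eq a nu c ck s lam zeta X p0 B G Ha Hnu Hs HS HX HG HA).
  assert (Hb := Cseries_bound _ _ (fun N => HF lam zeta (hdot zeta G) _ N HS (hdot_l2le _ zeta G B (wgt_ge0 _ _ _) HG))).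
  rewrite E, !Cmod_mult, Cmod_Ci, Cmod_R, Rmult_1_l in Hb.
  destruct HS as [_ [Hck [Hz [_ Hkap]]]]. rewrite (Rabs_pos_eq ck); [|lra].
  destruct (bomega2_bounds lam zeta Hz) as [Z1 [_ [_ [Z4 [Z5 _]]]]].
  rewrite Rabs_pos_eq in Hb; [|apply pow2_ge_0].
  assert (HB : 0 <= B) by apply (HG 0%nat ltac:(lia)).
  assert (HM := Ms_ge0 s lam zeta).
  set (z := zabs zeta) in *. set (w := bomega2 lam zeta) in *. set (M := Ms s lam zeta) in *.
  assert (Hp := Cmod_ge_0 p0). set (p := Cmod p0) in *. set (k := Cmod (psum a nu lam zeta)) in *.
  assert (Hb' : z * p * k <= 2 * K * M * B).
  { apply Rmult_le_reg_l with z; [lra|]. replace (z * (z * p * k)) with (z ^ 2 * p * k) by ring.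
    eapply Rle_trans; [exact Hb|]. right; ring. }
  assert (Hk2 : z * p * (ck / w) <= z * p * k) by (apply Rmult_le_compat_l; [apply Rmult_le_pos; lra|auto]).
  assert (T : z * p <= 2 * K / ck * w * M * B).
  { apply Rmult_le_reg_r with (ck / w); [apply Rdiv_lt_0_compat; lra|].
    eapply Rle_trans; [exact Hk2|]. eapply Rle_trans; [exact Hb'|]. right. field. lra. }
  eapply Rle_trans; [exact T|].
  assert (0 <= w * M * B) by (repeat apply Rmult_le_pos; lra).
  replace ((2 * K / ck + 1) * w * M * B) with (2 * K / ck * w * M * B + w * M * B) by ring. lra.
Qed.

Lemma stokes_stokes_inv a nu c ck lam zeta G i n : symb_bounds a nu c ck lam zeta ->
  stokes a nu lam zeta (stokes_inv a nu lam zeta G) (stokes_p a nu lam zeta G) i n = G i n.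
Proof.
  intros HS. unfold stokes, stokes_inv, pmode. field. eapply symb_nz; eauto.
Qed.

Lemma stokes_split a nu c ck lam zeta X p0 i n : symb_bounds a nu c ck lam zeta ->
  X i n = (- (Ci * RtoC (hfreq zeta i) * p0) * pmode a nu lam zeta n + stokes a nu lam zeta X p0 i n / symb a nu lam zeta n)%C.
Proof.
  intros HS. unfold stokes, pmode. field. eapply symb_nz; eauto.
Qed.

(** The pressure part has the regularity of [pmode], which must reach s + 2; its limit 5/2 is the
    condition s < 1/2. *)
Lemma stokes_inv_in_dom a nu c ck s lam zeta G B : 0 < a -> 0 < nu -> -2 <= s < 1 / 2 -> symb_bounds a nu c ck lam zeta ->
  l2le3 (wgt nu s zeta) G B -> in_dom a nu s zeta (stokes_inv a nu lam zeta G).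
Proof.
  intros Ha Hnu Hs HS HG.
  destruct (div_symb_l2le a nu c ck s Hnu) as [K1 [HK1 H1]].
  destruct (pmode_l2le a nu c ck (s + 2) Ha Hnu ltac:(lra)) as [K2 [HK2 H2]].
  specialize (H2 lam zeta HS). split.
  - exists (K1 * B + zabs zeta * Cmod (stokes_p a nu lam zeta G) * (K2 * Ms (- (s + 2)) lam zeta)).
    intros i Hi. unfold stokes_inv. apply l2le_minus; auto; [apply H1; auto|].
    eapply l2le_weaken; [|apply l2le_scal; exact H2].
    rewrite !Cmod_mult, Cmod_Ci, Cmod_R, Rmult_1_l.
    apply Rmult_le_compat_r; [apply H2|]. apply Rmult_le_compat_r; [apply Cmod_ge_0|]. apply hfreq_le.
  - assert (HE : forall n, (hdot zeta (stokes_inv a nu lam zeta G) n * RtoC (one_coef a n))%C =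
     (pmode a nu lam zeta n * hdot zeta G n + (- (Ci * RtoC (zabs zeta ^ 2) * stokes_p a nu lam zeta G)) * (pmode a nu lam zeta n * RtoC (one_coef a n)))%C).
    { intros n. rewrite zabs_sq, RtoC_plus, !RtoC_pow. unfold hdot, stokes_inv, hfreq, pmode. field. eapply symb_nz; eauto. }
    rewrite (Cseries_ext _ _ HE), Cseries_plus, Cseries_scal, <- psum_E.
    + unfold stokes_p.
      assert (Hz : RtoC (zabs zeta ^ 2) <> 0%C).
      { apply Cmod_gt_0. rewrite Cmod_R, Rabs_pos_eq; [|apply pow2_ge_0].
        apply pow_lt. destruct HS as [_ [_ [Hz _]]]. apply zabs_ge1 in Hz. lra. }
      assert (Hk := psum_nz a nu c ck lam zeta HS).
      set (Sg := Cseries _). field_simplify_eq; auto.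
      transitivity (Sg * (1 + Ci * Ci))%C; [ring|].
      replace (Ci * Ci)%C with (- (1))%C; [ring|]. unfold Ci, Cmult, Copp, RtoC; simpl. f_equal; ring.
    + eapply pmode_one_coef_summable; eauto.
    + eapply pmode_hdot_summable with (s := s); eauto. lra.
    + apply abs_summable_scal. eapply pmode_one_coef_summable; eauto.
Qed.

(** * The coupling terms *)

Definition Iz_summable3 a (X : nat -> nat -> C) := forall i, (i < 3)%nat -> Iz_summable a (X i).

Lemma Iz_summable_scal a f c : Iz_summable a f -> Iz_summable a (fun n => (c * f n)%C).
Proof.
  intros H j. destruct (abs_summable_scal c _ (H j)) as [B HB]. exists B. intros N.
  eapply Rle_trans; [|apply (HB N)]. right. apply rsum_ext; intros. f_equal. ring.
Qed.
Lemma Iz_summable_plus a f g : Iz_summable a f -> Iz_summable a g -> Iz_summable a (fun n => (f n + g n)%C).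
Proof.
  intros H H' j. destruct (abs_summable_plus _ _ (H j) (H' j)) as [B HB]. exists B. intros N.
  eapply Rle_trans; [|apply (HB N)]. right. apply rsum_ext; intros. f_equal. ring.
Qed.
Lemma Iz_scal a f c j : Iz_summable a f -> Iz a (fun n => (c * f n)%C) j = (c * Iz a f j)%C.
Proof.
  intros H. unfold Iz. rewrite <- Cseries_scal; auto. apply Cseries_ext; intros; ring.
Qed.
Lemma Iz_plus a f g j : Iz_summable a f -> Iz_summable a g -> Iz a (fun n => (f n + g n)%C) j = (Iz a f j + Iz a g j)%C.
Proof.
  intros H H'. unfold Iz. rewrite <- Cseries_plus; auto. apply Cseries_ext; intros; ring.
Qed.
Lemma Iz_ext a f g j : (forall n, f n = g n) -> Iz a f j = Iz a g j.
Proof. intros H. apply Cseries_ext. intros; now rewrite H. Qed.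

Lemma Iz_summable_ext a f g : (forall n, f n = g n) -> Iz_summable a f -> Iz_summable a g.
Proof. intros H. replace g with f; auto. now apply functional_extensionality. Qed.

Lemma coupling_lin a alpha beta gamma zeta X Y c : Iz_summable3 a X -> Iz_summable3 a Y -> forall i n,
  coupling a alpha beta gamma zeta (fun i n => (X i n + c * Y i n)%C) i n =
  (coupling a alpha beta gamma zeta X i n + c * coupling a alpha beta gamma zeta Y i n)%C.
Proof.
  intros HX HY i n. unfold coupling.
  rewrite Iz_lin; [|apply HX; lia|apply HY; lia].
  destruct i as [|[|i]]; [ring|ring|].
  set (D := fun (Z : nat -> nat -> C) m => (Ci * RtoC (IZR (fst zeta)) * Z 0%nat m + Ci * RtoC (IZR (snd zeta)) * Z 1%nat m)%C).
  assert (HD : forall Z, Iz_summable3 a Z -> Iz_summable a (D Z)).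
  { intros Z HZ. apply Iz_summable_plus; apply Iz_summable_scal; apply HZ; lia. }
  change (- (RtoC gamma * Iz a (D (fun i n => (X i n + c * Y i n)%C)) n) =
    - (RtoC gamma * Iz a (D X) n) + c * - (RtoC gamma * Iz a (D Y) n))%C.
  rewrite (Iz_ext a (D (fun i n => (X i n + c * Y i n)%C)) (fun m => (D X m + c * D Y m)%C)); [|intros; unfold D; ring].
  rewrite Iz_lin; auto. ring.
Qed.

Lemma stokes_p_lin a nu c ck s lam zeta F G d BF BG : 0 < a -> 0 < nu -> -5 / 2 < s -> symb_bounds a nu c ck lam zeta ->
  l2le3 (wgt nu s zeta) F BF -> l2le3 (wgt nu s zeta) G BG ->
  stokes_p a nu lam zeta (fun i n => (F i n + d * G i n)%C) = (stokes_p a nu lam zeta F + d * stokes_p a nu lam zeta G)%C.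
Proof.
  intros Ha Hnu Hs HS HF HG. unfold stokes_p.
  rewrite (Cseries_ext _ (fun n => (pmode a nu lam zeta n * hdot zeta F n + d * (pmode a nu lam zeta n * hdot zeta G n))%C)); [|intros; unfold hdot; ring].
  rewrite Cseries_plus, Cseries_scal.
  - unfold Cdiv. ring.
  - eapply pmode_hdot_summable with (s := s); eauto.
  - eapply pmode_hdot_summable with (s := s); eauto.
  - apply abs_summable_scal. eapply pmode_hdot_summable with (s := s); eauto.
Qed.

Lemma stokes_inv_lin a nu c ck s lam zeta F G d BF BG : 0 < a -> 0 < nu -> -5 / 2 < s -> symb_bounds a nu c ck lam zeta ->
  l2le3 (wgt nu s zeta) F BF -> l2le3 (wgt nu s zeta) G BG -> forall i n,
  stokes_inv a nu lam zeta (fun i n => (F i n + d * G i n)%C) i n = (stokes_inv a nu lam zeta F i n + d * stokes_inv a nu lam zeta G i n)%C.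
Proof.
  intros Ha Hnu Hs HS HF HG i n. unfold stokes_inv.
  erewrite stokes_p_lin; eauto. unfold Cdiv. ring.
Qed.

(** The gain from s to s' > s serves twice: it makes the coupling compact in the Fredholm argument,
    and it regularizes elements of the kernel. *)
Lemma Iz_reg a nu s s' : 0 < a -> 0 < nu -> -3 / 2 < s -> s <= s' -> s' < s + 1 -> s' < 1 / 2 ->
  exists K, 0 < K /\ forall zeta g B, l2le (wgt nu (s + 2) zeta) g B ->
    Iz_summable a g /\ l2le (wgt nu s' zeta) (Iz a g) (K * B).
Proof.
  intros Ha Hnu H1 H2 H3 H4. destruct (Iz_bound a s' Ha H4) as [K [HK H]].
  (* Solves s' + 2 t = s + 2: the weight to the power t, split off from g, is exactly what remains
     of its regularity beyond s'. The Hilbert-Schmidt exponent exceeds 1 since |s'| < 3/2 and s' - s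
     < 1. *)
  set (t := 1 + (s - s') / 2).
  assert (Hr : 0 <= Rabs s' < 3 / 2) by (split; [apply Rabs_pos|apply Rabs_def1; lra]).
  destruct (p_series_bounded (6 - 2 * Rabs s' - 2 * (s' - s)) ltac:(lra)) as [Y [HY0 HY]].
  set (Q := sqrt (Rpower nu (- t) ^ 2 * Y)).
  assert (HQ2 : 0 < Rpower nu (- t) ^ 2 * Y) by (apply Rmult_lt_0_compat; auto; apply pow_lt; auto).
  assert (HQ : 0 < Q) by (now apply sqrt_lt_R0).
  exists (K * Q). split; [nra|]. intros zeta g B Hg.
  apply (H nu zeta (fun n => Rpower (wbase nu zeta n) (- t)) Q (fun n => (RtoC (Rpower (wbase nu zeta n) t) * g n)%C)); auto.
  - intros; left; auto.
  - lra.
  - intros N. unfold Q. rewrite pow2_sqrt; [|lra].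
    eapply Rle_trans; [|apply Rmult_le_compat_l; [apply pow2_ge_0|apply (HY N)]].
    rewrite <- rsum_scal. apply rsum_le; intros n _.
    assert (E : Rpower (wbase nu zeta n) (- t) <= Rpower nu (- t) * kpow n (- (2 * t))).
    { replace (kpow n (- (2 * t))) with (Rpower (kk n ^ 2) (- t)) by (rewrite Rpower_kk2; f_equal; ring).
      assert (0 < kk n ^ 2) by (apply pow_lt; auto).
      rewrite Rpower_mult_distr; auto. rewrite !Rpower_Ropp. apply Rinv_le_contravar; auto.
      apply Rle_Rpower_l; [unfold t; lra|]. split; [nra|]. unfold wbase.
      generalize (pow2_ge_0 (zabs zeta)). nra. }
    apply Rle_trans with (kpow n (2 * Rabs s' - 2) * (Rpower nu (- t) * kpow n (- (2 * t))) ^ 2).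
    { apply Rmult_le_compat_l; [left; apply kpow_pos|]. apply sq_le. split; [left; auto|auto]. }
    rewrite Rpow_mult_distr. right.
    replace (kpow n (- (2 * t)) ^ 2) with (kpow n (- (4 * t))).
    2:{ replace (- (4 * t)) with (- (2 * t) + - (2 * t)) by ring. rewrite kpow_plus. ring. }
    replace (- (6 - 2 * Rabs s' - 2 * (s' - s))) with (2 * Rabs s' - 2 + - (4 * t)) by (unfold t; field).
    rewrite kpow_plus. ring.
  - replace B with (1 * B) by ring. revert Hg. apply l2le_dom; [lra|]. intros n.
    rewrite Cmod_mult, Cmod_R, Rpow_mult_distr, pow2_abs, !wgt_wbase.
    replace (Rpower (wbase nu zeta n) t ^ 2) with (Rpower (wbase nu zeta n) (t + t)) by (rewrite Rpower_plus; ring).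
    rewrite <- Rmult_assoc, <- Rpower_plus. replace (s' + (t + t)) with (s + 2) by (unfold t; field). right; ring.
  - intros n. rewrite Cmod_mult, Cmod_R, Rabs_pos_eq; [|left; auto].
    rewrite <- Rmult_assoc, <- Rpower_plus. replace (- t + t) with 0 by ring.
    rewrite Rpower_O; [lra|]. generalize (wbase_ge1 nu zeta n Hnu). lra.
Qed.

Lemma wgt_mono nu s s' zeta n : 0 < nu -> s <= s' -> wgt nu s zeta n <= wgt nu s' zeta n.
Proof. intros Hnu H. rewrite !wgt_wbase. apply Rle_Rpower; auto. now apply wbase_ge1. Qed.

Lemma l2le_mono nu s s' zeta f B : 0 < nu -> s <= s' -> l2le (wgt nu s' zeta) f B -> l2le (wgt nu s zeta) f B.
Proof.
  intros Hnu H Hf. replace B with (1 * B) by ring. revert Hf. apply l2le_dom; [lra|]. intros n.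
  assert (E := wgt_mono nu s s' zeta n Hnu H). generalize (pow2_ge_0 (Cmod (f n))). nra.
Qed.

Lemma Cmod_im_scal (x : R) : Cmod (Ci * RtoC x) = Rabs x.
Proof. rewrite Cmod_mult, Cmod_Ci, Cmod_R. ring. Qed.

Lemma coupling_reg a nu alpha beta gamma s s' : 0 < a -> 0 < nu -> -3 / 2 < s -> s <= s' -> s' < s + 1 -> s' < 1 / 2 ->
  exists K, 0 < K /\ forall zeta X B, l2le3 (wgt nu (s + 2) zeta) X B ->
    Iz_summable3 a X /\ l2le3 (wgt nu s' zeta) (coupling a alpha beta gamma zeta X) (K * (1 + zabs zeta) * B).
Proof.
  intros Ha Hnu H1 H2 H3 H4. destruct (Iz_reg a nu s s' Ha Hnu H1 H2 H3 H4) as [K [HK H]].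
  exists (1 + Rabs alpha + Rabs beta * K + 2 * Rabs gamma * K).
  assert (A1 := Rabs_pos alpha). assert (A2 := Rabs_pos beta). assert (A3 := Rabs_pos gamma).
  assert (B1 : 0 <= Rabs beta * K) by nra. assert (B2 : 0 <= Rabs gamma * K) by nra.
  split; [lra|].
  intros zeta X B HX. assert (Z := zabs_ge0 zeta).
  assert (HI : forall i, (i < 3)%nat -> Iz_summable a (X i) /\ l2le (wgt nu s' zeta) (Iz a (X i)) (K * B)) by (intros; apply H; auto).
  assert (HD : Iz_summable3 a X) by (intros i Hi; now apply HI).
  assert (HB : 0 <= B) by apply (HX 0%nat ltac:(lia)).
  assert (HM : forall i, (i < 3)%nat -> l2le (wgt nu s' zeta) (X i) B).
  { intros i Hi. apply l2le_mono with (s' := s + 2); auto. lra. }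
  assert (HIS : forall i x, (i < 3)%nat -> (x < 3)%nat -> l2le (wgt nu s' zeta) (fun n => (Ci * RtoC (hfreq zeta x) * Iz a (X i) n)%C) (zabs zeta * (K * B))).
  { intros i x Hi Hx. eapply l2le_weaken; [|apply l2le_scal, HI; auto].
    rewrite Cmod_im_scal. apply Rmult_le_compat_r; [nra|apply hfreq_le]. }
  assert (HIB : forall x, (x < 3)%nat -> l2le (wgt nu s' zeta) (fun n => (Ci * RtoC (hfreq zeta x) * RtoC beta * Iz a (X 2%nat) n)%C) (Rabs beta * (zabs zeta * (K * B)))).
  { intros x Hx. apply l2le_ext with (fun n => (RtoC beta * (Ci * RtoC (hfreq zeta x) * Iz a (X 2%nat) n))%C); [intros; ring|].
    rewrite <- Cmod_R. apply l2le_scal. apply HIS; auto. }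
  assert (P1 : 0 <= Rabs alpha * zabs zeta * B) by (repeat apply Rmult_le_pos; auto).
  assert (P2 : 0 <= Rabs beta * K * B) by (repeat apply Rmult_le_pos; auto; lra).
  assert (P3 : 0 <= Rabs gamma * K * B) by (repeat apply Rmult_le_pos; auto; lra).
  assert (P4 : 0 <= Rabs beta * K * zabs zeta * B) by (repeat apply Rmult_le_pos; auto; lra).
  assert (P5 : 0 <= Rabs gamma * K * zabs zeta * B) by (repeat apply Rmult_le_pos; auto; lra).
  assert (P6 : 0 <= zabs zeta * B) by (repeat apply Rmult_le_pos; auto; lra).
  assert (P7 : 0 <= Rabs alpha * B) by (repeat apply Rmult_le_pos; auto; lra).
  split; auto. intros i Hi. destruct i as [|[|[|i]]]; [| | |lia].
  - unfold coupling. eapply l2le_weaken; [|apply l2le_plus; [auto| |apply (HIB 0%nat); lia]].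
    2:{ apply l2le_opp. apply l2le_scal. apply HM; lia. }
    rewrite Cmod_R. lra.
  - unfold coupling. eapply l2le_weaken; [|apply l2le_plus; [auto| |apply (HIB 1%nat); lia]].
    2:{ apply l2le_scal. apply HM; lia. }
    rewrite Cmod_R. lra.
  - unfold coupling. apply l2le_weaken with (Rabs gamma * (zabs zeta * (K * B) + zabs zeta * (K * B))); [lra|].
    apply l2le_ext with (fun n => (RtoC (- gamma) * (Ci * RtoC (hfreq zeta 0) * Iz a (X 0%nat) n + Ci * RtoC (hfreq zeta 1) * Iz a (X 1%nat) n))%C).
    + intros n. rewrite Iz_plus, !Iz_scal; try apply Iz_summable_scal; try (apply HD; lia).
      unfold hfreq. rewrite RtoC_opp. ring.
    + rewrite <- Rabs_Ropp, <- (Cmod_R (- gamma)). apply l2le_scal. apply l2le_plus; auto.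
Qed.

(* Positive exactly for |s| < 3/2; this is where sigma > -3/2 enters. *)
Definition decay s := 3 / 8 - Rabs s / 4.

(** X is either M_(-s) or the norm of the primitive of [pmode]. Its power of <zeta> cancels the one
    in M_s, |zeta|^2 <= <omega>^2 takes care of the prefactor, and a negative power of <omega>
    remains. *)
Lemma Ms_product_decay s : -3 / 2 < s < 1 / 2 -> exists K, 0 < K /\ forall lam zeta D X, zeta <> (0%Z, 0%Z) ->
  0 <= D -> 0 <= X -> X ^ 2 <= D ^ 2 * (Rpower (bzeta zeta ^ 2) s / bomega2 lam zeta ^ 2) ->
  zabs zeta * (bomega2 lam zeta * Ms s lam zeta) * X <= K * D * Rpower (bomega2 lam zeta) (- decay s).
Proof.
  intros Hs. destruct (Ms_upper s Hs) as [K [HK HM]]. exists (sqrt K). split; [now apply sqrt_lt_R0|].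
  intros lam zeta D X Hz HD HX HX2. specialize (HM lam zeta Hz).
  destruct (bomega2_bounds lam zeta Hz) as [Z1 [_ [_ [Z4 [Z5 [_ Z7]]]]]].
  assert (P := Rpower_pos (bomega2 lam zeta) (- decay s)).
  set (w := bomega2 lam zeta) in *. set (z := zabs zeta) in *. assert (HMs := Ms_ge0 s lam zeta). set (M := Ms s lam zeta) in *.
  set (b := bzeta zeta ^ 2) in *. set (q := Rpower w (- decay s)) in *.
  apply sq_le_inv.
  { repeat apply Rmult_le_pos; try lra. apply sqrt_pos. }
  rewrite !Rpow_mult_distr, pow2_sqrt; [|lra].
  (* Exponent count: 1 - (7/4 - |s|/2) = -2 [decay] s. *)
  replace (q ^ 2) with (w * Rpower w (- (7 / 4 - Rabs s / 2))).
  2:{ unfold q. transitivity (Rpower w (1 + - (7 / 4 - Rabs s / 2))).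
      - rewrite Rpower_plus, Rpower_1; lra.
      - replace (Rpower w (- decay s) ^ 2) with (Rpower w (- decay s + - decay s)) by (rewrite Rpower_plus; ring).
        f_equal. unfold decay. field. }
  assert (Rb := Rpower_pos b s). rewrite Rpower_Ropp in HM.
  assert (Rq := Rpower_pos w (- (7 / 4 - Rabs s / 2))). set (r := Rpower w (- (7 / 4 - Rabs s / 2))) in *.
  apply Rle_trans with (w * (w ^ 2 * (K * / Rpower b s * r)) * (D ^ 2 * (Rpower b s / w ^ 2))).
  - assert (0 <= M ^ 2) by apply pow2_ge_0. assert (0 <= w ^ 2) by apply pow2_ge_0.
    assert (0 <= z ^ 2) by apply pow2_ge_0. assert (0 <= X ^ 2) by apply pow2_ge_0.
    apply Rmult_le_compat; auto; [apply Rmult_le_pos; auto; apply Rmult_le_pos; auto|].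
    apply Rmult_le_compat; auto; [apply Rmult_le_pos; auto|].
    apply Rmult_le_compat_l; auto.
  - right. field. lra.
Qed.

(** The bound is stated with 1/|zeta| because the coupling multiplies the primitive by one factor
    zeta. The multiplier 1/(c kw) yields a power of <omega>, of which a square root of <omega>^2 is
    spent on |zeta|. *)
Lemma Iz_div_symb_decay a nu c ck s : 0 < a -> 0 < nu -> -3 / 2 < s < 1 / 2 -> exists K, 0 < K /\ forall lam zeta f B,
  symb_bounds a nu c ck lam zeta -> l2le (wgt nu s zeta) f B ->
  Iz_summable a (fun n => (f n / symb a nu lam zeta n)%C) /\
  l2le (wgt nu s zeta) (Iz a (fun n => (f n / symb a nu lam zeta n)%C)) (K * Rpower (bomega2 lam zeta) (- decay s) / zabs zeta * B).
Proof.
  intros Ha Hnu Hs. destruct (Iz_bound a s Ha ltac:(lra)) as [K [HK H]].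
  assert (Hr : 0 <= Rabs s < 3 / 2) by (split; [apply Rabs_pos|apply Rabs_def1; lra]).
  destruct (sum_kpow_kw (Rabs s) Hr) as [Y [HY HP]].
  exists (K * (sqrt Y / Rabs c + 1)). assert (SY := sqrt_pos Y).
  split. { apply Rmult_lt_0_compat; auto. assert (0 <= sqrt Y / Rabs c); [|lra].
    unfold Rdiv. apply Rmult_le_pos; auto. rewrite <- Rabs_inv. apply Rabs_pos. }
  intros lam zeta f B HS Hf. assert (Hnz := fun n => symb_nz a nu c ck lam zeta n HS).
  destruct HS as [Hc [_ [Hz [Hsy _]]]].
  destruct (bomega2_bounds lam zeta Hz) as [Z1 [_ [_ [Z4 [Z5 [_ Z7]]]]]]. rewrite (Rabs_pos_eq c); [|lra].
  assert (HB : 0 <= B) by apply Hf.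
  set (w := bomega2 lam zeta) in *.
  set (e0 := 7 / 4 - Rabs s / 2) in *.
  set (Q := sqrt Y / c * Rpower w (- e0 / 2)).
  assert (HQ0 : 0 <= Q). { apply Rmult_le_pos; [apply Rdiv_le_0_compat; lra|left; auto]. }
  destruct (H nu zeta (fun n => / (c * kw lam zeta n)) Q f (fun n => (f n / symb a nu lam zeta n)%C) B) as [I1 I2]; auto.
  - intros n. left. apply Rinv_0_lt_compat, Rmult_lt_0_compat; auto. now apply kw_pos.
  - intros N. unfold Q. rewrite Rpow_mult_distr. unfold Rdiv at 1. rewrite Rpow_mult_distr, pow2_sqrt; [|lra].
    replace (Rpower w (- e0 / 2) ^ 2) with (Rpower w (- e0)).
    2:{ transitivity (Rpower w (- e0 / 2 + - e0 / 2)); [f_equal; field|rewrite Rpower_plus; ring]. }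
    replace (Y * (/ c) ^ 2 * Rpower w (- e0)) with ((/ c) ^ 2 * (Y * Rpower w (- e0))) by ring.
    eapply Rle_trans; [|apply Rmult_le_compat_l; [apply pow2_ge_0|apply (HP lam zeta N Hz)]].
    rewrite <- rsum_scal. right. apply rsum_ext; intros n _. field.
    split; [|lra]. apply Rgt_not_eq, kw_pos; auto.
  - intros n. rewrite Cmod_div; auto. unfold Rdiv. rewrite Rmult_comm.
    apply Rmult_le_compat_r; [apply Cmod_ge_0|]. apply Rinv_le_contravar; auto.
    apply Rmult_lt_0_compat; auto. now apply kw_pos.
  - split; auto. eapply l2le_weaken; [|exact I2].
    apply Rmult_le_compat_r; auto. unfold Rdiv. rewrite !Rmult_assoc. apply Rmult_le_compat_l; [lra|].
    assert (E : zabs zeta * Rpower w (- e0 / 2) <= Rpower w (- decay s)).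
    { replace (- decay s) with (/ 2 + - e0 / 2) by (unfold decay, e0; field). rewrite Rpower_plus.
      apply Rmult_le_compat_r; [left; auto|]. rewrite Rpower_sqrt; [|lra].
      rewrite <- (sqrt_pow2 (zabs zeta)); [|lra]. apply sqrt_le_1_alt. exact Z7. }
    unfold Q. assert (0 <= sqrt Y / c) by (apply Rdiv_le_0_compat; lra).
    apply Rle_trans with (sqrt Y / c * (Rpower w (- decay s) * / zabs zeta)).
    + apply Rmult_le_compat_l; auto. apply Rmult_le_reg_l with (zabs zeta); [lra|].
      eapply Rle_trans; [exact E|]. right; field; lra.
    + apply Rmult_le_compat_r; [|fold (Rdiv (sqrt Y) c); lra].
      apply Rmult_le_pos; [left; auto|left; apply Rinv_0_lt_compat; lra].
Qed.

(** [pmode] is of order 1/(<omega>^2 k) pointwise, hence so is its primitive, and the norm of 1/k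
    gives X. The squared form is the one that [Ms_product_decay] takes. *)
Lemma Iz_pmode_decay a nu c ck s : 0 < a -> 0 < nu -> -3 / 2 < s < 1 / 2 -> exists K, 0 < K /\ forall lam zeta,
  symb_bounds a nu c ck lam zeta -> Iz_summable a (pmode a nu lam zeta) /\ exists X,
  X ^ 2 <= K ^ 2 * (Rpower (bzeta zeta ^ 2) s / bomega2 lam zeta ^ 2) /\ l2le (wgt nu s zeta) (Iz a (pmode a nu lam zeta)) X.
Proof.
  intros Ha Hnu Hs. destruct (pmode_sq a nu c ck Ha) as [K1 [HK1 H1]].
  destruct (Iz_pointwise a Ha) as [K2 [HK2 H2]]. destruct (sum_Rpower_kb s ltac:(lra)) as [K3 [HK3 H3]].
  destruct (wgt_kb nu s Hnu) as [M [HM HW]].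
  set (D := K2 ^ 2 * K1 * M * K3).
  assert (HD : 0 < D) by (unfold D; apply Rmult_lt_0_compat; auto; apply Rmult_lt_0_compat; auto; apply Rmult_lt_0_compat; auto; apply pow_lt; auto).
  exists (sqrt D). split; [now apply sqrt_lt_R0|].
  intros lam zeta HS. assert (Hz : zeta <> (0%Z, 0%Z)) by apply HS.
  destruct (bomega2_bounds lam zeta Hz) as [Z1 [_ [_ [Z4 [Z5 [_ Z7]]]]]].
  assert (Hw : 0 < bomega2 lam zeta) by lra.
  assert (HA : forall n, Cmod (pmode a nu lam zeta n) <= sqrt K1 / bomega2 lam zeta / kk n).
  { intros n. apply sq_le_inv.
    - assert (KN := kk_pos n). repeat apply Rdiv_le_0_compat; auto. apply sqrt_pos.
    - eapply Rle_trans; [apply (H1 lam zeta n HS)|]. unfold Rdiv. rewrite !Rpow_mult_distr, pow2_sqrt; [|lra].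
      rewrite kpow_m2. rewrite !pow_inv. assert (KN := kk_pos n). rewrite (Rmult_assoc K1), (Rmult_assoc K1), (Rmult_comm (/ kk n ^ 2)). apply Rmult_le_compat_l; [lra|].
      apply Rmult_le_compat_r; [left; apply Rinv_0_lt_compat, pow_lt; auto|].
      apply Rinv_le_contravar; [apply pow_lt; auto|]. assert (0 < kk n ^ 4) by (apply pow_lt; auto). lra. }
  assert (HA0 : 0 <= sqrt K1 / bomega2 lam zeta) by (apply Rdiv_le_0_compat; auto; apply sqrt_pos).
  assert (HP := H2 _ _ HA0 HA).
  split; [intros j; apply HP|].
  exists (sqrt (D * (Rpower (bzeta zeta ^ 2) s / bomega2 lam zeta ^ 2))).
  assert (HR : 0 <= Rpower (bzeta zeta ^ 2) s / bomega2 lam zeta ^ 2).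
  { apply Rdiv_le_0_compat; [left; auto|apply pow_lt; auto]. }
  split.
  - rewrite !pow2_sqrt; [right; ring|lra|]. apply Rmult_le_pos; lra.
  - split; [apply sqrt_pos|]. intros N. rewrite pow2_sqrt; [|apply Rmult_le_pos; lra].
    apply Rle_trans with (rsum (fun n => K2 ^ 2 * K1 * M / bomega2 lam zeta ^ 2 * (Rpower (kb zeta n) s * kpow n (-2))) N).
    + apply rsum_le; intros n _. destruct (HP n) as [_ HPn]. destruct (HW zeta n Hz) as [W _].
      assert (KN := kk_pos n).
      replace (K2 ^ 2 * K1 * M / bomega2 lam zeta ^ 2 * (Rpower (kb zeta n) s * kpow n (-2))) with
        ((M * Rpower (kb zeta n) s) * (K2 * (sqrt K1 / bomega2 lam zeta) / kk n) ^ 2).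
      * apply Rmult_le_compat; auto; [apply pow2_ge_0|]. apply sq_le. split; auto. apply Cmod_ge_0.
      * unfold Rdiv. rewrite !Rpow_mult_distr, pow2_sqrt; [|lra]. rewrite kpow_m2, !pow_inv. ring.
    + rewrite rsum_scal. unfold D.
      replace (K2 ^ 2 * K1 * M * K3 * (Rpower (bzeta zeta ^ 2) s / bomega2 lam zeta ^ 2)) with
        (K2 ^ 2 * K1 * M / bomega2 lam zeta ^ 2 * (K3 * Rpower (bzeta zeta ^ 2) s)) by (field; lra).
      apply Rmult_le_compat_l; [|now apply H3].
      apply Rdiv_le_0_compat; [|apply pow_lt; auto]. apply Rmult_le_pos; [|lra]. apply Rmult_le_pos; [|lra]. apply pow2_ge_0.
Qed.

(** The smallness of T for large <omega>. The critical term is the gamma one: i [hdot] of the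
    velocity contains |zeta|^2 P [pmode], with |zeta| |P| of size <omega>^2 M_s, so one factor
    |zeta| stays in front of the primitive. Theta has no pressure part and is easier. *)
Lemma coupling_stokes_inv_decay a nu alpha beta gamma c ck s : 0 < a -> 0 < nu -> -3 / 2 < s < 1 / 2 ->
  exists K, 0 < K /\ forall lam zeta G B, symb_bounds a nu c ck lam zeta -> l2le3 (wgt nu s zeta) G B ->
  l2le3 (wgt nu s zeta) (coupling a alpha beta gamma zeta (stokes_inv a nu lam zeta G))
    (K * Rpower (bomega2 lam zeta) (- decay s) * B).
Proof.
  intros Ha Hnu Hs.
  destruct (pressure_estimate a nu c ck s Ha Hnu ltac:(lra)) as [Kp [HKp Hp]].
  destruct (pmode_l2le a nu c ck s Ha Hnu ltac:(lra)) as [Kb [HKb Hb]].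
  destruct (div_symb_l2le a nu c ck s Hnu) as [Kd [HKd Hd]].
  destruct (Ms_opp_upper s ltac:(lra)) as [Km [HKm Hm]].
  destruct (Iz_div_symb_decay a nu c ck s Ha Hnu Hs) as [Ki [HKi Hi]].
  destruct (Iz_pmode_decay a nu c ck s Ha Hnu Hs) as [Kx [HKx Hx]].
  destruct (Ms_product_decay s Hs) as [Ks [HKs Hsm]].
  assert (A1 := Rabs_pos alpha). assert (A2 := Rabs_pos beta). assert (A3 := Rabs_pos gamma).
  set (C1 := Kp * Kb * (Ks * sqrt Km) + Kd).
  set (C2 := Ki). set (C3 := 2 * Ki + Kp * (Ks * Kx)).
  assert (Sm := sqrt_pos Km).
  assert (HC1 : 0 <= C1) by (unfold C1; assert (0 <= Kp * Kb * (Ks * sqrt Km)) by (repeat apply Rmult_le_pos; lra); lra).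
  assert (HC3 : 0 <= C3) by (unfold C3; assert (0 <= Kp * (Ks * Kx)) by (repeat apply Rmult_le_pos; lra); lra).
  assert (T1 : 0 <= Rabs alpha * C1) by (apply Rmult_le_pos; auto).
  assert (T2 : 0 <= Rabs beta * C2) by (apply Rmult_le_pos; unfold C2; lra).
  assert (T3 : 0 <= Rabs gamma * C3) by (apply Rmult_le_pos; auto).
  exists (1 + Rabs alpha * C1 + Rabs beta * C2 + Rabs gamma * C3). split; [lra|].
  intros lam zeta G B HS HG. assert (Hz : zeta <> (0%Z, 0%Z)) by apply HS.
  destruct (bomega2_bounds lam zeta Hz) as [Z1 [_ [_ [Z4 [Z5 [_ Z7]]]]]].
  set (X := stokes_inv a nu lam zeta G). set (P := stokes_p a nu lam zeta G).
  assert (HX : in_dom a nu s zeta X) by (eapply stokes_inv_in_dom; eauto; lra).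
  assert (HP : zabs zeta * Cmod P <= Kp * bomega2 lam zeta * Ms s lam zeta * B).
  { apply (Hp lam zeta X P B G HS HX HG). intros i n _. eapply stokes_stokes_inv; eauto. }
  assert (HB : 0 <= B) by apply (HG 0%nat ltac:(lia)).
  set (w := bomega2 lam zeta) in *. set (q := Rpower w (- decay s)).
  assert (Hq : 0 < q) by apply Rpower_pos.
  assert (HM0 := Ms_ge0 s lam zeta). assert (HP0 := Cmod_ge_0 P).
  assert (HwM : 0 <= w * Ms s lam zeta * B) by (repeat apply Rmult_le_pos; lra).
  assert (qB : 0 <= q * B) by (apply Rmult_le_pos; lra).
  assert (Hcomp : forall i, (i < 3)%nat -> l2le (wgt nu s zeta) (X i) (C1 * q * B)).
  { intros i Hi3. unfold X, stokes_inv.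
    eapply l2le_weaken; [|apply l2le_minus; [auto|apply (Hd lam zeta (G i) B HS (HG i Hi3))|apply l2le_scal, (Hb lam zeta HS)]].
    rewrite !Cmod_mult, Cmod_Ci, Cmod_R, Rmult_1_l. fold P w.
    assert (U1 : Kd * B / w <= Kd * q * B).
    { replace (Kd * B / w) with (Kd * (/ w) * B) by (field; lra). apply Rmult_le_compat_r; auto.
      (* 1/w <= w^(- decay), as w >= 1 and [decay] s <= 3/8. *)
      apply Rmult_le_compat_l; [lra|]. unfold q. rewrite <- (Rpower_1 w) at 1; [|lra]. rewrite <- Rpower_Ropp.
      apply Rle_Rpower; [lra|]. unfold decay. generalize (Rabs_pos s). lra. }
    assert (U2 : zabs zeta * (w * Ms s lam zeta) * Ms (- s) lam zeta <= Ks * sqrt Km * q).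
    { apply (Hsm lam zeta (sqrt Km)); auto; [apply Ms_ge0|]. rewrite pow2_sqrt; [|lra].
      eapply Rle_trans; [apply (Hm lam zeta Hz)|]. right. fold w. field. lra. }
    assert (U3 : Rabs (hfreq zeta i) * Cmod P * (Kb * Ms (- s) lam zeta) <= Kp * Kb * (Ks * sqrt Km) * q * B).
    { assert (HMm := Ms_ge0 (- s) lam zeta).
      apply Rle_trans with (Kp * w * Ms s lam zeta * B * (Kb * Ms (- s) lam zeta)).
      - apply Rmult_le_compat_r; [apply Rmult_le_pos; lra|]. eapply Rle_trans; [|exact HP].
        apply Rmult_le_compat_r; auto. apply hfreq_le.
      - replace (Kp * w * Ms s lam zeta * B * (Kb * Ms (- s) lam zeta)) with (Kp * Kb * B * (1 * (w * Ms s lam zeta) * Ms (- s) lam zeta)) by ring.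
        replace (Kp * Kb * (Ks * sqrt Km) * q * B) with (Kp * Kb * B * (Ks * sqrt Km * q)) by ring.
        apply Rmult_le_compat_l; [repeat apply Rmult_le_pos; lra|].
        eapply Rle_trans; [|exact U2]. apply Rmult_le_compat_r; auto.
        apply Rmult_le_compat_r; [|lra]. apply Rmult_le_pos; lra. }
    unfold C1. lra. }
  assert (HI2 : Iz_summable a (X 2%nat) /\ l2le (wgt nu s zeta) (Iz a (X 2%nat)) (Ki * q / zabs zeta * B)).
  { destruct (Hi lam zeta (G 2%nat) B HS (HG 2%nat ltac:(lia))) as [J1 J2].
    assert (E : forall n, (G 2%nat n / symb a nu lam zeta n)%C = X 2%nat n) by (intros n; unfold X, stokes_inv, hfreq; ring).
    split; [exact (Iz_summable_ext _ _ _ E J1)|]. eapply l2le_ext; [|exact J2]. intros j. now apply Iz_ext. }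
  assert (HIB : forall x, (x < 3)%nat -> l2le (wgt nu s zeta) (fun n => (Ci * RtoC (hfreq zeta x) * RtoC beta * Iz a (X 2%nat) n)%C) (Rabs beta * C2 * q * B)).
  { intros x Hx3. eapply l2le_weaken; [|apply l2le_scal, HI2].
    rewrite Cmod_mult, Cmod_im_scal, Cmod_R.
    replace (Rabs (hfreq zeta x) * Rabs beta * (Ki * q / zabs zeta * B)) with (Rabs (hfreq zeta x) * (Rabs beta * Ki * q * B / zabs zeta)) by (field; lra).
    apply Rle_trans with (zabs zeta * (Rabs beta * Ki * q * B / zabs zeta)).
    - apply Rmult_le_compat_r; [|apply hfreq_le]. apply Rdiv_le_0_compat; [|lra].
      repeat apply Rmult_le_pos; lra.
    - right. unfold C2. field. lra. }
  assert (F1 : 0 <= Rabs alpha * C1 * q * B) by (rewrite Rmult_assoc; apply Rmult_le_pos; lra).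
  assert (F2 : 0 <= Rabs beta * C2 * q * B) by (rewrite Rmult_assoc; apply Rmult_le_pos; lra).
  assert (F3 : 0 <= Rabs gamma * C3 * q * B) by (rewrite Rmult_assoc; apply Rmult_le_pos; lra).
  intros i Hi3. destruct i as [|[|[|i]]]; [| | |lia].
  - unfold coupling. eapply l2le_weaken; [|apply l2le_plus; [auto| |apply (HIB 0%nat); lia]].
    2:{ apply l2le_opp. apply l2le_scal. apply Hcomp; lia. }
    rewrite Cmod_R. fold w q. lra.
  - unfold coupling. eapply l2le_weaken; [|apply l2le_plus; [auto| |apply (HIB 1%nat); lia]].
    2:{ apply l2le_scal. apply Hcomp; lia. }
    rewrite Cmod_R. fold w q. lra.
  - unfold coupling.
    destruct (Hi lam zeta (hdot zeta G) (2 * zabs zeta * B) HS (hdot_l2le _ zeta G B (wgt_ge0 _ _ _) HG)) as [J1 J2].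
    destruct (Hx lam zeta HS) as [J3 [Y [J4 J5]]].
    apply l2le_weaken with (Rabs gamma * (C3 * q * B)); [fold w q; lra|].
    (* i [hdot] of the uncoupled solution is i [hdot] G / symb + |zeta|^2 P [pmode]; the two
       primitives are estimated by different lemmas. *)
    apply l2le_ext with (fun n => (RtoC (- gamma) * (Ci * Iz a (fun n => (hdot zeta G n / symb a nu lam zeta n)%C) n
        + (RtoC (zabs zeta ^ 2) * P) * Iz a (pmode a nu lam zeta) n))%C).
    + intros n. rewrite RtoC_opp.
      transitivity (- (RtoC gamma * (Iz a (fun m => (Ci * (hdot zeta G m / symb a nu lam zeta m)
          + (RtoC (zabs zeta ^ 2) * P) * pmode a nu lam zeta m)%C) n)))%C.
      { rewrite Iz_plus, !Iz_scal; auto; try (apply Iz_summable_scal; auto). ring. }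
      f_equal. f_equal. apply Iz_ext.
      intros m. rewrite zabs_sq, RtoC_plus, !RtoC_pow. unfold X, stokes_inv, hdot, hfreq, pmode. fold P.
      assert (HCi : (Ci * Ci = - (1))%C) by (unfold Ci, Cmult, Copp, RtoC; simpl; f_equal; ring).
      assert (Hnz := symb_nz a nu c ck lam zeta m HS).
      set (x := RtoC (IZR (fst zeta))). set (y := RtoC (IZR (snd zeta))). set (o := RtoC (one_coef a m)). set (sy := symb a nu lam zeta m) in *.
      transitivity (Ci * ((x * G 0%nat m + y * G 1%nat m) / sy) - (Ci * Ci) * (x ^ 2 + y ^ 2) * P * (o / sy))%C; [rewrite HCi; ring|field; auto].
    + rewrite <- Rabs_Ropp, <- (Cmod_R (- gamma)). apply l2le_scal.
      eapply l2le_weaken; [|apply l2le_plus; [auto|apply l2le_scal; exact J2|apply l2le_scal; exact J5]].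
      rewrite Cmod_Ci, Cmod_mult, Cmod_R, Rabs_pos_eq; [|apply pow2_ge_0]. fold w q.
      assert (HY0 : 0 <= Y) by apply J5.
      assert (U2 : zabs zeta * (w * Ms s lam zeta) * Y <= Ks * Kx * q) by (apply (Hsm lam zeta Kx); auto; lra).
      assert (U3 : zabs zeta ^ 2 * Cmod P * Y <= Kp * (Ks * Kx) * q * B).
      { apply Rle_trans with (zabs zeta * (Kp * w * Ms s lam zeta * B) * Y).
        - apply Rmult_le_compat_r; auto. replace (zabs zeta ^ 2 * Cmod P) with (zabs zeta * (zabs zeta * Cmod P)) by ring.
          apply Rmult_le_compat_l; lra.
        - replace (zabs zeta * (Kp * w * Ms s lam zeta * B) * Y) with (Kp * B * (zabs zeta * (w * Ms s lam zeta) * Y)) by ring.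
          replace (Kp * (Ks * Kx) * q * B) with (Kp * B * (Ks * Kx * q)) by ring.
          apply Rmult_le_compat_l; auto. apply Rmult_le_pos; lra. }
      replace (1 * (Ki * q / zabs zeta * (2 * zabs zeta * B))) with (2 * Ki * q * B) by (field; lra).
      unfold C3. lra.
Qed.

(** * Triviality of the kernel *)

(* An element of the kernel solves the uncoupled system with right-hand side - coupling X, which is
   smoother than X; one step already reaches H^1. *)
Lemma kernel_regularity a nu c ck s alpha beta gamma lam zeta X p0 :
  0 < a -> 0 < nu -> -3 / 2 < s < 1 / 2 -> symb_bounds a nu c ck lam zeta -> in_dom a nu s zeta X ->
  (forall i n, (i < 3)%nat -> (stokes a nu lam zeta X p0 i n + coupling a alpha beta gamma zeta X i n = 0)%C) ->
  exists B, l2le3 (wgt nu 1 zeta) X B.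
Proof.
  intros Ha Hnu Hs HS [[B HX] _] HE.
  (* The midpoint of s and 1/2: it lies below s + 1 because s > -3/2, and s' + 2 > 3/2 reaches
     H^1. *)
  set (s' := (s + 1 / 2) / 2).
  destruct (coupling_reg a nu alpha beta gamma s s' Ha Hnu ltac:(lra) ltac:(unfold s'; lra) ltac:(unfold s'; lra) ltac:(unfold s'; lra)) as [K [HK H]].
  destruct (H zeta X B HX) as [_ HKX].
  destruct (div_symb_l2le a nu c ck s' Hnu) as [Kd [HKd Hd]].
  destruct (pmode_l2le a nu c ck (s' + 2) Ha Hnu ltac:(unfold s'; lra)) as [Kb [HKb Hb]].
  set (G := fun i n => (- coupling a alpha beta gamma zeta X i n)%C).
  exists (Cmod Ci * zabs zeta * Cmod p0 * (Kb * Ms (- (s' + 2)) lam zeta) + Kd * (K * (1 + zabs zeta) * B)).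
  intros i Hi. apply l2le_mono with (s' := s' + 2); auto; [unfold s'; lra|].
  apply l2le_ext with (fun n => (- (Ci * RtoC (hfreq zeta i) * p0) * pmode a nu lam zeta n + G i n / symb a nu lam zeta n)%C).
  - intros n. rewrite (stokes_split a nu c ck lam zeta X p0 i n HS). f_equal. f_equal.
    unfold G. specialize (HE i n Hi).
    transitivity ((stokes a nu lam zeta X p0 i n + coupling a alpha beta gamma zeta X i n) - coupling a alpha beta gamma zeta X i n)%C; [rewrite HE|]; ring.
  - apply l2le_plus; auto.
    + eapply l2le_weaken; [|apply l2le_scal, (Hb lam zeta HS)].
      rewrite Cmod_opp, !Cmod_mult, Cmod_R. apply Rmult_le_compat_r; [apply (Hb lam zeta HS)|].
      apply Rmult_le_compat_r; [apply Cmod_ge_0|]. apply Rmult_le_compat_l; [apply Cmod_ge_0|apply hfreq_le].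
    + apply Hd; auto. unfold G. apply l2le_opp. apply HKX; auto.
Qed.

(** * Integration by parts for sine series *)

Lemma wgt_0 nu zeta : wgt nu 0 zeta = unit_wgt.
Proof.
  apply functional_extensionality. intros n. unfold wgt, Rpower, unit_wgt. rewrite Rmult_0_l. apply exp_0.
Qed.

Lemma Iz_l2 a : 0 < a -> exists K, 0 < K /\ forall g B, l2le unit_wgt g B -> Iz_summable a g /\ l2le unit_wgt (Iz a g) (K * B).
Proof.
  intros Ha. destruct (Iz_bound a 0 Ha ltac:(lra)) as [K [HK H]].
  destruct (p_series_bounded 2 ltac:(lra)) as [Y [HY0 HY]].
  exists (K * sqrt Y). split; [apply Rmult_lt_0_compat; auto; now apply sqrt_lt_R0|].
  intros g B Hg. rewrite <- (wgt_0 1 (0%Z, 0%Z)) in Hg |- *.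
  apply (H 1 (0%Z, 0%Z) (fun _ => 1) (sqrt Y) g g B); auto; try lra.
  - intros; lra.
  - apply sqrt_pos.
  - intros N. rewrite pow2_sqrt; [|lra]. eapply Rle_trans; [|apply (HY N)].
    right. apply rsum_ext; intros n _. rewrite Rabs_R0.
    replace (2 * 0 - 2) with (- (2)) by ring. ring.
  - intros; lra.
Qed.

Definition tail (N : nat) (f : nat -> C) (n : nat) : C := if Nat.ltb n N then 0%C else f n.

Lemma tail_l2le f B : l2le unit_wgt f B -> exists u : nat -> R, is_lim_seq u 0 /\ forall N, l2le unit_wgt (tail N f) (u N).
Proof.
  intros [HB Hf]. set (F := fun n => unit_wgt n * Cmod (f n) ^ 2) in *.
  assert (HF : forall n, 0 <= F n).
  { intros n. unfold F, unit_wgt. generalize (pow2_ge_0 (Cmod (f n))). lra. }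
  assert (HE : ex_series F) by (apply rsum_ex_series with (B ^ 2); auto).
  exists (fun N => sqrt (Series F - rsum F N)). split.
  - rewrite <- sqrt_0. apply (is_lim_seq_continuous sqrt (fun N => Series F - rsum F N) 0).
    + apply continuity_pt_sqrt. lra.
    + replace (Finite 0) with (Finite (Series F - Series F)) by (f_equal; ring).
      apply is_lim_seq_minus'; [apply is_lim_seq_const|now apply ex_series_rsum_lim].
  - intros N. split; [apply sqrt_pos|]. intros M.
    rewrite pow2_sqrt; [|generalize (rsum_le_Series F N HF HE); lra].
    apply Rle_trans with (rsum (fun n => unit_wgt n * Cmod (tail N f n) ^ 2) (N + M)).
    { apply rsum_mono; [|lia]. intros n. unfold unit_wgt. generalize (pow2_ge_0 (Cmod (tail N f n))). lra. }
    rewrite rsum_split. rewrite (rsum_ext _ (fun _ => 0) N), rsum_zero.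
    + rewrite (rsum_ext (fun i => unit_wgt (N + i) * Cmod (tail N f (N + i)) ^ 2) (fun i => F (N + i)%nat)).
      * generalize (rsum_le_Series F (N + M) HF HE). rewrite rsum_split. lra.
      * intros i _. unfold F, tail. destruct (Nat.ltb_spec (N + i) N); [lia|auto].
    + intros n Hn. unfold tail. destruct (Nat.ltb_spec n N); [|lia]. rewrite Cmod_0. ring.
Qed.

Lemma csum_pair f g A B N : l2le unit_wgt f A -> l2le unit_wgt g B -> Cmod (csum (fun n => (f n * g n)%C) N) <= A * B.
Proof.
  intros [HA Hf] [HB Hg]. eapply Rle_trans; [apply csum_mod|].
  rewrite (rsum_ext (fun n => Cmod (f n * g n)) (fun n => unit_wgt n * (Cmod (f n) * Cmod (g n)))); [|intros n _; rewrite Cmod_mult; unfold unit_wgt; ring].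
apply rsum_CS; auto.
Qed.

Lemma Iz_split a f N n : Iz_summable a (tail N f) ->
  Iz a f n = (csum (fun m => (f m * RtoC (cc a n m))%C) N + Iz a (tail N f) n)%C.
Proof.
  intros Ht. destruct (Ht n) as [B HB].
  set (F := fun m => (f m * RtoC (cc a n m))%C).
  set (T := fun m => (tail N f m * RtoC (cc a n m))%C).
  assert (HS : forall M, csum F (N + M) = (csum F N + csum T (N + M))%C).
  { assert (H0 : forall M, (M <= N)%nat -> csum T M = 0%C).
    { induction M; intros HM; [reflexivity|]. cbn [csum]. rewrite IHM by lia.
      unfold T, tail. destruct (Nat.ltb_spec M N); [ring|lia]. }
    induction M.
    - rewrite Nat.add_0_r, H0 by lia. ring.
    - rewrite Nat.add_succ_r. cbn [csum]. rewrite IHM.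
      replace (T (N + M)%nat) with (F (N + M)%nat); [ring|]. unfold T, F, tail.
      destruct (Nat.ltb_spec (N + M) N); [lia|auto]. }
  assert (HF : abs_summable F).
  { exists (rsum (fun m => Cmod (F m)) N + B). intros M.
    apply Rle_trans with (rsum (fun m => Cmod (F m)) (N + M)).
    { apply rsum_mono; [intros; apply Cmod_ge_0|lia]. }
    rewrite rsum_split. apply Rplus_le_compat_l.
    eapply Rle_trans; [|apply (HB (N + M)%nat)]. rewrite rsum_split.
    assert (0 <= rsum (fun n0 => Cmod (tail N f n0 * RtoC (cc a n n0))) N) by (apply rsum_ge0; intros; apply Cmod_ge_0).
    rewrite (rsum_ext (fun i => Cmod (F (N + i)%nat)) (fun i => Cmod (tail N f (N + i) * RtoC (cc a n (N + i))))); [lra|].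
    intros i _. unfold F, tail. destruct (Nat.ltb_spec (N + i) N); [lia|auto]. }
  destruct HF as [BF HF]. unfold Iz. apply Cseries_eq with BF; auto.
  unfold clim. apply (is_lim_seq_incr_n _ N).
  apply is_lim_seq_ext with (fun M => Cmod (csum T (N + M) - Cseries T)).
  - intros M. rewrite (Nat.add_comm M N). fold F. rewrite HS. f_equal. fold F T. ring.
  - apply is_lim_seq_ext with (fun M => Cmod (csum T (M + N) - Cseries T)); [intros; do 3 f_equal; lia|].
    apply (is_lim_seq_incr_n (fun M => Cmod (csum T M - Cseries T)) N).
    apply (Cseries_clim T B HB).
Qed.

(* Integration by parts: the left-hand side sums to (int_0^a f) (int_0^a g). *)
Lemma Iz_parts a f g A B : 0 < a -> l2le unit_wgt f A -> l2le unit_wgt g B ->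
  Cseries (fun n => (g n * RtoC (one_coef a n))%C) = 0%C ->
  clim (csum (fun n => (Iz a f n * g n + f n * Iz a g n)%C)) 0%C.
Proof.
  intros Ha Hf Hg Hg0.
  destruct (Iz_l2 a Ha) as [K [HK HI]].
  destruct (tail_l2le f A Hf) as [u [Hu Htf]]. destruct (tail_l2le g B Hg) as [v [Hv Htg]].
  assert (Hcf : forall (N : nat) h H, l2le unit_wgt h H -> abs_summable (fun n => (h n * RtoC (one_coef a n))%C)).
  { intros _ h H Hh. rewrite <- (wgt_0 1 (0%Z, 0%Z)) in Hh. apply one_coef_pairing with (nu := 1) (r := 0) (zeta := (0%Z, 0%Z)) (B := H); auto; lra. }
  destruct (Hcf 0%nat f A Hf) as [Bf HBf]. destruct (Hcf 0%nat g B Hg) as [Bg HBg].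
  assert (Lg := Cseries_clim _ _ HBg). rewrite Hg0 in Lg.
  (* By [cc_antisym] the truncated double sum is the product of the partial sums of the two
     integrals, and the second of these tends to 0. What truncation leaves out is carried by the
     tails of f and g, small in l2. *)
  assert (HN : forall N, csum (fun n => (Iz a f n * g n + f n * Iz a g n)%C) N =
     (csum (fun n => (f n * RtoC (one_coef a n))%C) N * csum (fun n => (g n * RtoC (one_coef a n))%C) N
      + (csum (fun n => (Iz a (tail N f) n * g n)%C) N + csum (fun n => (f n * Iz a (tail N g) n)%C) N))%C).
  { intros N.
    rewrite (csum_ext _ (fun n => ((csum (fun m => (f m * RtoC (cc a n m))%C) N * g n + f n * csum (fun m => (g m * RtoC (cc a n m))%C) N)
       + (Iz a (tail N f) n * g n + f n * Iz a (tail N g) n))%C)).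
    - rewrite csum_plus, (csum_plus (fun n => (Iz a (tail N f) n * g n)%C)). f_equal.
      rewrite csum_plus.
      rewrite (csum_ext (fun n => (f n * csum (fun m => (g m * RtoC (cc a n m))%C) N)%C)
         (fun n => csum (fun m => (f n * (g m * RtoC (cc a n m)))%C) N)); [|intros; now rewrite csum_scal].
      rewrite csum_swap. rewrite <- csum_plus.
      rewrite <- csum_scal. apply csum_ext. intros n _.
      rewrite (Cmult_comm (csum _ N) (g n)), <- csum_scal, <- csum_plus.
      rewrite (Cmult_comm (csum _ N)), <- csum_scal. apply csum_ext. intros m _.
      assert (E := cc_antisym a n m Ha).
      transitivity (f m * g n * RtoC (cc a n m + cc a m n))%C; [rewrite RtoC_plus; ring|].
      rewrite E, RtoC_mult. ring.
    - intros n _. rewrite (Iz_split a f N n), (Iz_split a g N n); [ring|apply (HI _ _ (Htg N))|apply (HI _ _ (Htf N))]. }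
  apply is_lim_seq_dom0 with (v := fun N => Bf * Cmod (csum (fun n => (g n * RtoC (one_coef a n))%C) N - 0) + (K * u N * B + A * (K * v N))).
  - intros N. split; [apply Cmod_ge_0|].
    replace (csum (fun n => (Iz a f n * g n + f n * Iz a g n)%C) N - 0)%C with (csum (fun n => (Iz a f n * g n + f n * Iz a g n)%C) N) by ring.
    rewrite HN. replace (csum (fun n => (g n * RtoC (one_coef a n))%C) N - 0)%C with (csum (fun n => (g n * RtoC (one_coef a n))%C) N) by ring.
    eapply Rle_trans; [apply Cmod_triangle|]. apply Rplus_le_compat.
    + rewrite Cmod_mult. apply Rmult_le_compat_r; [apply Cmod_ge_0|]. eapply Rle_trans; [apply csum_mod|]. apply HBf.
    + eapply Rle_trans; [apply Cmod_triangle|]. apply Rplus_le_compat.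
      * apply csum_pair; auto. apply HI; auto.
      * apply csum_pair; auto. apply HI; auto.
  - replace (Finite 0) with (Finite (Bf * 0 + (K * 0 * B + A * (K * 0)))) by (f_equal; ring).
    apply is_lim_seq_plus'; [apply is_lim_seq_mult'; [apply is_lim_seq_const|exact Lg]|].
    apply is_lim_seq_plus'.
    + apply is_lim_seq_mult'; [|apply is_lim_seq_const]. apply is_lim_seq_mult'; [apply is_lim_seq_const|auto].
    + apply is_lim_seq_mult'; [apply is_lim_seq_const|]. apply is_lim_seq_mult'; [apply is_lim_seq_const|auto].
Qed.

(** * Conjugation and sums over Fourier modes *)

Lemma csum_conj f N : csum (fun n => Cconj (f n)) N = Cconj (csum f N).
Proof.
  induction N; cbn [csum]; [unfold Cconj, RtoC; simpl; f_equal; ring|].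
  rewrite IHN, Cplus_conj. reflexivity.
Qed.

Lemma Cseries_conj f : abs_summable f -> Cseries (fun n => Cconj (f n)) = Cconj (Cseries f).
Proof.
  intros [B HB]. apply Cseries_eq with B.
  - intros N. rewrite (rsum_ext _ (fun n => Cmod (f n))); auto. intros; apply Cmod_conj.
  - apply is_lim_seq_ext with (fun n => Cmod (csum f n - Cseries f)).
    + intros n. rewrite csum_conj, <- Cminus_conj, Cmod_conj. reflexivity.
    + now apply Cseries_clim with B.
Qed.

Lemma Cconj_R (x : R) : Cconj (RtoC x) = RtoC x.
Proof. unfold Cconj, RtoC; simpl. f_equal. ring. Qed.

Lemma Iz_conj a g j : Iz_summable a g -> Iz a (fun n => Cconj (g n)) j = Cconj (Iz a g j).
Proof.
  intros H. unfold Iz. rewrite <- Cseries_conj; auto. apply Cseries_ext. intros n.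
  rewrite Cmult_conj, Cconj_R. reflexivity.
Qed.

Lemma boxsum_csum f N : boxsum f N = csum (fun i => csum (fun j => csum (fun n =>
     f (Z.of_nat i - Z.of_nat N)%Z (Z.of_nat j - Z.of_nat N)%Z n) (S N)) (S (2 * N))) (S (2 * N)).
Proof.
  unfold boxsum. rewrite sum_n_csum. apply csum_ext; intros i _.
  rewrite sum_n_csum. apply csum_ext; intros j _. apply sum_n_csum.
Qed.

Lemma csum_single (g : nat -> C) M i0 : (forall i, (i < M)%nat -> i <> i0 -> g i = 0%C) ->
  csum g M = if Nat.ltb i0 M then g i0 else 0%C.
Proof.
  intros H. induction M; [reflexivity|]. cbn [csum]. rewrite IHM; [|intros; apply H; lia].
  destruct (Nat.ltb_spec i0 M); destruct (Nat.ltb_spec i0 (S M)); try lia.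
  - rewrite (H M); [ring|lia|lia].
  - replace M with i0 by lia. ring.
  - rewrite (H M); [ring|lia|lia].
Qed.

Lemma boxsum_single (f : field) (zeta : Z * Z) N :
  (forall x y n, (x, y) <> zeta -> f x y n = 0%C) ->
  (Z.abs (fst zeta) <= Z.of_nat N)%Z -> (Z.abs (snd zeta) <= Z.of_nat N)%Z ->
  boxsum f N = csum (f (fst zeta) (snd zeta)) (S N).
Proof.
  intros Hf H1 H2. rewrite boxsum_csum.
  set (h := fun i j => csum (fun n => f (Z.of_nat i - Z.of_nat N)%Z (Z.of_nat j - Z.of_nat N)%Z n) (S N)).
  assert (Hh : forall i j, (i <> Z.to_nat (fst zeta + Z.of_nat N) \/ j <> Z.to_nat (snd zeta + Z.of_nat N)) -> h i j = 0%C).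
  { intros i j Hne. unfold h. rewrite (csum_ext _ (fun _ => 0%C)); [apply csum_zero|].
    intros n _. apply Hf. intros E. destruct Hne as [Hne|Hne]; apply Hne; rewrite <- E; simpl; lia. }
  transitivity (csum (fun i => csum (h i) (S (2 * N))) (S (2 * N))); [reflexivity|].
  rewrite (csum_single (fun i => csum (h i) (S (2 * N))) _ (Z.to_nat (fst zeta + Z.of_nat N))).
  - destruct (Nat.ltb_spec (Z.to_nat (fst zeta + Z.of_nat N)) (S (2 * N))); [|lia].
    rewrite (csum_single (h _) _ (Z.to_nat (snd zeta + Z.of_nat N))).
    + destruct (Nat.ltb_spec (Z.to_nat (snd zeta + Z.of_nat N)) (S (2 * N))); [|lia].
      unfold h. apply csum_ext; intros n _. f_equal; lia.
    + intros j Hj Hne. apply Hh. now right.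
  - intros i Hi Hne. rewrite (csum_ext _ (fun _ => 0%C)); [apply csum_zero|].
    intros j _. apply Hh. now left.
Qed.

Lemma boxsum_mode_le (f : field) (zeta : Z * Z) M :
  (forall x y n, 0 <= Re (f x y n)) ->
  exists N, rsum (fun n => Re (f (fst zeta) (snd zeta) n)) M <= Re (boxsum f N).
Proof.
  intros Hf. exists (M + Z.to_nat (Z.abs (fst zeta)) + Z.to_nat (Z.abs (snd zeta)))%nat.
  set (N := (M + Z.to_nat (Z.abs (fst zeta)) + Z.to_nat (Z.abs (snd zeta)))%nat).
  rewrite boxsum_csum, csum_re.
  set (h := fun i j => csum (fun n => f (Z.of_nat i - Z.of_nat N)%Z (Z.of_nat j - Z.of_nat N)%Z n) (S N)).
  assert (H3 : forall i j, 0 <= Re (h i j)).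
  { intros i j. unfold h. rewrite csum_re. apply rsum_ge0; auto. }
  assert (H2 : forall i, 0 <= Re (csum (h i) (S (2 * N)))).
  { intros i. rewrite csum_re. apply rsum_ge0; auto. }
  set (i0 := Z.to_nat (fst zeta + Z.of_nat N)). set (j0 := Z.to_nat (snd zeta + Z.of_nat N)).
  apply Rle_trans with (Re (csum (h i0) (S (2 * N)))).
  - rewrite csum_re. apply Rle_trans with (Re (h i0 j0)).
    + unfold h. rewrite csum_re.
      apply Rle_trans with (rsum (fun n => Re (f (fst zeta) (snd zeta) n)) (S N)).
      * apply rsum_mono; auto. unfold N; lia.
      * right. apply rsum_ext; intros n _. f_equal. unfold i0, j0, N. f_equal; lia.
    + apply (rsum_term (fun j => Re (h i0 j))); auto. unfold j0, N; lia.
  - apply (rsum_term (fun i => Re (csum (h i) (S (2 * N))))); auto. unfold i0, N; lia.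
Qed.

Definition extend (zeta : Z * Z) (f : nat -> C) : field := fun x y n =>
  if Z.eq_dec x (fst zeta) then (if Z.eq_dec y (snd zeta) then f n else 0%C) else 0%C.

Lemma extend_at zeta f n : extend zeta f (fst zeta) (snd zeta) n = f n.
Proof.
  unfold extend. destruct (Z.eq_dec (fst zeta) (fst zeta)); [|congruence].
  destruct (Z.eq_dec (snd zeta) (snd zeta)); congruence.
Qed.
Lemma extend_off zeta f x y n : (x, y) <> zeta -> extend zeta f x y n = 0%C.
Proof.
  intros H. unfold extend. destruct (Z.eq_dec x (fst zeta)); auto.
  destruct (Z.eq_dec y (snd zeta)); auto. exfalso; apply H. subst. now destruct zeta.
Qed.

Definition H1_term a (U V Th : field) : field := fun hfreq eta n =>
  RtoC ((1 + zabs2 hfreq eta + (kk n * PI / a) ^ 2)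
            * (Cmod (U hfreq eta n) ^ 2 + Cmod (V hfreq eta n) ^ 2 + Cmod (Th hfreq eta n) ^ 2)).

Lemma zabs2_ge0 x y : 0 <= zabs2 x y.
Proof. unfold zabs2. generalize (pow2_ge_0 (IZR x)) (pow2_ge_0 (IZR y)); lra. Qed.

Lemma inV_mode a U V Th (zeta : Z * Z) : inV a U V Th -> exists B,
  l2le unit_wgt (U (fst zeta) (snd zeta)) B /\ l2le unit_wgt (V (fst zeta) (snd zeta)) B /\ l2le unit_wgt (Th (fst zeta) (snd zeta)) B.
Proof.
  intros [[B HB] _]. fold (H1_term a U V Th) in HB.
  assert (Hp : forall x y n, Cmod (U x y n) ^ 2 + Cmod (V x y n) ^ 2 + Cmod (Th x y n) ^ 2 <= Re (H1_term a U V Th x y n)).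
  { intros x y n. unfold H1_term. simpl Re. generalize (zabs2_ge0 x y) (pow2_ge_0 (kk n * PI / a)).
    generalize (pow2_ge_0 (Cmod (U x y n))) (pow2_ge_0 (Cmod (V x y n))) (pow2_ge_0 (Cmod (Th x y n))).
    intros. nra. }
  assert (Hp0 : forall x y n, 0 <= Re (H1_term a U V Th x y n)).
  { intros x y n. eapply Rle_trans; [|apply Hp].
    generalize (pow2_ge_0 (Cmod (U x y n))) (pow2_ge_0 (Cmod (V x y n))) (pow2_ge_0 (Cmod (Th x y n))). lra. }
  assert (HS : forall M, rsum (fun n => Re (H1_term a U V Th (fst zeta) (snd zeta) n)) M <= Rabs B + 1).
  { intros M. destruct (boxsum_mode_le (H1_term a U V Th) zeta M Hp0) as [N HN].
    specialize (HB N). generalize (Rle_abs B). unfold H1_term in *. lra. }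
  exists (Rabs B + 1). assert (HB0 := Rabs_pos B).
  repeat split; try lra; intros N; (apply Rle_trans with (Rabs B + 1); [|nra]);
    (eapply Rle_trans; [|apply (HS N)]); apply rsum_le; intros n _;
    (eapply Rle_trans; [|apply Hp]); unfold unit_wgt;
    generalize (pow2_ge_0 (Cmod (U (fst zeta) (snd zeta) n))) (pow2_ge_0 (Cmod (V (fst zeta) (snd zeta) n))) (pow2_ge_0 (Cmod (Th (fst zeta) (snd zeta) n))); lra.
Qed.

Lemma inV_extend a nu zeta X B : 0 < a -> 0 < nu -> l2le3 (wgt nu 1 zeta) X B ->
  Cseries (fun n => (hdot zeta X n * RtoC (one_coef a n))%C) = 0%C ->
  inV a (extend zeta (X 0%nat)) (extend zeta (X 1%nat)) (extend zeta (X 2%nat)).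
Proof.
  intros Ha Hnu HX Hd. split.
  - set (L := 1 + 1 / nu + PI ^ 2 / a ^ 2 / nu).
    assert (P := PI_RGT_0). assert (Ha2 : 0 < a ^ 2) by (apply pow_lt; auto).
    assert (HL1 : 0 <= 1 / nu) by (apply Rdiv_le_0_compat; lra).
    assert (HL2 : 0 <= PI ^ 2 / a ^ 2 / nu) by (repeat apply Rdiv_le_0_compat; auto; apply pow2_ge_0).
    exists (L * (3 * B ^ 2)). intros N.
    fold (H1_term a (extend zeta (X 0%nat)) (extend zeta (X 1%nat)) (extend zeta (X 2%nat))).
    set (h := H1_term a (extend zeta (X 0%nat)) (extend zeta (X 1%nat)) (extend zeta (X 2%nat))).
    assert (Hoff : forall x y n, (x, y) <> zeta -> h x y n = 0%C).
    { intros x y n Hxy. unfold h, H1_term. rewrite !extend_off, Cmod_0; auto. f_equal. ring. }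
    assert (Hmode : forall M, rsum (fun n => Re (h (fst zeta) (snd zeta) n)) M <= L * (3 * B ^ 2)).
    { intros M.
      apply Rle_trans with (rsum (fun n => L * ((wgt nu 1 zeta n * Cmod (X 0%nat n) ^ 2 + wgt nu 1 zeta n * Cmod (X 1%nat n) ^ 2) + wgt nu 1 zeta n * Cmod (X 2%nat n) ^ 2)) M).
      - apply rsum_le; intros n _. unfold h, H1_term. rewrite !extend_at. simpl Re.
        rewrite wgt_wbase, Rpower_1; [|generalize (wbase_ge1 nu zeta n Hnu); lra].
        set (S := Cmod (X 0%nat n) ^ 2 + Cmod (X 1%nat n) ^ 2 + Cmod (X 2%nat n) ^ 2).
        assert (HS : 0 <= S).
        { unfold S. generalize (pow2_ge_0 (Cmod (X 0%nat n))) (pow2_ge_0 (Cmod (X 1%nat n))) (pow2_ge_0 (Cmod (X 2%nat n))). lra. }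
        replace (L * (wbase nu zeta n * Cmod (X 0%nat n) ^ 2 + wbase nu zeta n * Cmod (X 1%nat n) ^ 2 + wbase nu zeta n * Cmod (X 2%nat n) ^ 2)) with (L * wbase nu zeta n * S) by (unfold S; ring).
        apply Rmult_le_compat_r; auto.
        assert (O := wbase_ge1 nu zeta n Hnu).
        assert (E1 : zabs2 (fst zeta) (snd zeta) <= 1 / nu * wbase nu zeta n).
        { unfold wbase, zabs2. rewrite <- zabs_sq.
          replace (1 / nu * (1 + nu * kk n ^ 2 + nu * zabs zeta ^ 2)) with (1 / nu + kk n ^ 2 + zabs zeta ^ 2) by (field; lra).
          generalize (pow2_ge_0 (kk n)). lra. }
        assert (E2 : (kk n * PI / a) ^ 2 <= PI ^ 2 / a ^ 2 / nu * wbase nu zeta n).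
        { replace ((kk n * PI / a) ^ 2) with (PI ^ 2 / a ^ 2 / nu * (nu * kk n ^ 2)) by (field; lra).
          apply Rmult_le_compat_l; auto. unfold wbase. generalize (pow2_ge_0 (zabs zeta)). nra. }
        unfold L. lra.
      - rewrite rsum_scal, !rsum_plus. apply Rmult_le_compat_l; [unfold L; lra|].
        destruct (HX 0%nat ltac:(lia)) as [_ H0]. destruct (HX 1%nat ltac:(lia)) as [_ H1]. destruct (HX 2%nat ltac:(lia)) as [_ H2].
        specialize (H0 M). specialize (H1 M). specialize (H2 M). lra. }
    destruct (Z_le_gt_dec (Z.abs (fst zeta)) (Z.of_nat N)); [destruct (Z_le_gt_dec (Z.abs (snd zeta)) (Z.of_nat N))|].
    (* A box that contains the mode zeta sees its partial sum; the two remaining cases are boxes too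
       small for it, where the sum is 0. *)
    + rewrite (boxsum_single h zeta N Hoff); auto. rewrite csum_re. apply Hmode.
    + rewrite boxsum_csum. rewrite (csum_ext _ (fun _ => 0%C)); [rewrite csum_zero; eapply Rle_trans; [|apply (Hmode 0%nat)]; simpl; lra|].
      intros i Hi. rewrite (csum_ext _ (fun _ => 0%C)); [apply csum_zero|]. intros j Hj.
      rewrite (csum_ext _ (fun _ => 0%C)); [apply csum_zero|]. intros n _.
      apply Hoff. intros E. rewrite <- E in g. simpl in g. lia.
    + rewrite boxsum_csum. rewrite (csum_ext _ (fun _ => 0%C)); [rewrite csum_zero; eapply Rle_trans; [|apply (Hmode 0%nat)]; simpl; lra|].
      intros i Hi. rewrite (csum_ext _ (fun _ => 0%C)); [apply csum_zero|]. intros j Hj.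
      rewrite (csum_ext _ (fun _ => 0%C)); [apply csum_zero|]. intros n _.
      apply Hoff. intros E. rewrite <- E in g. simpl in g. lia.
  - intros x y. destruct (classic ((x, y) = zeta)) as [<-|Hne].
    + rewrite <- Hd. apply Cseries_ext. intros n. unfold hdot.
      replace (extend (x, y) (X 0%nat) x y n) with (X 0%nat n) by (symmetry; exact (extend_at (x, y) _ n)).
      replace (extend (x, y) (X 1%nat) x y n) with (X 1%nat n) by (symmetry; exact (extend_at (x, y) _ n)). reflexivity.
    + rewrite <- Cseries_zero. apply Cseries_ext. intros n. rewrite !extend_off; auto. ring.
Qed.

Lemma Cconj_Ci : Cconj Ci = (- Ci)%C.
Proof. unfold Cconj, Ci, Copp; simpl. f_equal; ring. Qed.

(** The eigenfunction is X placed in the single mode zeta. Tested against X', the form reduces to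
    mode zeta, where the kernel equations leave two terms: the pressure times the integral of the
    divergence of X', and a sum handled by [Iz_parts]. Both tend to 0 by the constraint on X'. *)
Lemma VP_of_kernel a nu alpha beta gamma c ck s lam zeta X p0 :
  0 < a -> 0 < nu -> 0 < gamma -> -3 / 2 < s < 1 / 2 -> symb_bounds a nu c ck lam zeta -> in_dom a nu s zeta X ->
  (forall i n, (i < 3)%nat -> (stokes a nu lam zeta X p0 i n + coupling a alpha beta gamma zeta X i n = 0)%C) ->
  (exists i n, (i < 3)%nat /\ X i n <> 0%C) -> VP a nu alpha beta gamma lam.
Proof.
  intros Ha Hnu Hga Hs HS HX HE [i0 [n0 [Hi0 Hn0]]].
  destruct (kernel_regularity a nu c ck s alpha beta gamma lam zeta X p0 Ha Hnu Hs HS HX HE) as [B HB].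
  set (U := extend zeta (X 0%nat)). set (V := extend zeta (X 1%nat)). set (Th := extend zeta (X 2%nat)).
  exists U, V, Th. split; [|split].
  - apply (inV_extend a nu zeta X B Ha Hnu HB). apply HX.
  - exists (fst zeta), (snd zeta), n0. unfold U, V, Th. rewrite !extend_at.
    destruct i0 as [|[|[|i0]]]; auto; lia.
  - intros U' V' Th' HV'.
    destruct (inV_mode a U' V' Th' zeta HV') as [B' [HU' [HV'' HT']]].
    destruct HV' as [_ Hdiv']. specialize (Hdiv' (fst zeta) (snd zeta)).
    set (u' := U' (fst zeta) (snd zeta)) in *. set (v' := V' (fst zeta) (snd zeta)) in *. set (t' := Th' (fst zeta) (snd zeta)) in *.
    set (D' := fun n => (RtoC (IZR (fst zeta)) * u' n + RtoC (IZR (snd zeta)) * v' n)%C).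
    assert (HD' : l2le unit_wgt D' (Rabs (hfreq zeta 0) * B' + Rabs (hfreq zeta 1) * B')).
    { unfold D'. apply l2le_plus; auto.
      - rewrite <- (Cmod_R (hfreq zeta 0)). now apply l2le_scal.
      - rewrite <- (Cmod_R (hfreq zeta 1)). now apply l2le_scal. }
    set (BD := Rabs (hfreq zeta 0) * B' + Rabs (hfreq zeta 1) * B') in *.
    set (g := fun n => Cconj (D' n)).
    assert (Hg : l2le unit_wgt g BD).
    { replace BD with (1 * BD) by ring. revert HD'. apply l2le_dom; [lra|]. intros n. unfold g. rewrite Cmod_conj. lra. }
    assert (Hc : forall h H, l2le unit_wgt h H -> abs_summable (fun n => (h n * RtoC (one_coef a n))%C)).
    { intros h H Hh. rewrite <- (wgt_0 1 (0%Z, 0%Z)) in Hh. apply one_coef_pairing with (nu := 1) (r := 0) (zeta := (0%Z, 0%Z)) (B := H); auto; lra. }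
    assert (Hg0 : Cseries (fun n => (g n * RtoC (one_coef a n))%C) = 0%C).
    { transitivity (Cconj (Cseries (fun n => (D' n * RtoC (one_coef a n))%C))).
      - rewrite <- Cseries_conj; [|eapply Hc; eauto]. apply Cseries_ext. intros n. unfold g. now rewrite Cmult_conj, Cconj_R.
      - unfold D'. rewrite Hdiv'. apply Cconj_R. }
    assert (Hth : l2le unit_wgt (X 2%nat) B).
    { rewrite <- (wgt_0 nu zeta). apply l2le_mono with (s' := 1); auto; try lra. }
    assert (HL1 := Iz_parts a (X 2%nat) g B BD Ha Hth Hg Hg0).
    destruct (Hc g BD Hg) as [Bg HBg]. assert (HL2 := Cseries_clim _ _ HBg). rewrite Hg0 in HL2.
    destruct (Iz_l2 a Ha) as [KI [_ HI]]. assert (HID : Iz_summable a D') by (eapply HI; eauto).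
    set (T := VPterm a nu alpha beta gamma lam U V Th U' V' Th').
    assert (Hoff : forall x y n, (x, y) <> zeta -> T x y n = 0%C).
    { intros x y n Hxy. unfold T, VPterm, Wc, U, V, Th.
      rewrite (Iz_ext a (fun n1 => (Ci * RtoC (IZR x) * extend zeta (X 0%nat) x y n1 + Ci * RtoC (IZR y) * extend zeta (X 1%nat) x y n1)%C) (fun _ => 0%C)).
      - rewrite Iz_zero, !extend_off; auto. ring.
      - intros m. rewrite !extend_off; auto. ring. }
    assert (Hgz : RtoC gamma <> 0%C) by (apply Cmod_gt_0; rewrite Cmod_R, Rabs_pos_eq; lra).
    assert (Hon : forall n, T (fst zeta) (snd zeta) n =
      (RtoC ((2 * PI) ^ 2) * (- Ci) * (p0 * (g n * RtoC (one_coef a n)) + RtoC beta * (Iz a (X 2%nat) n * g n + X 2%nat n * Iz a g n)))%C).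
    { intros n. unfold T, VPterm. unfold U, V, Th. rewrite !extend_at.
      fold (u' n) (v' n) (t' n). change (U' (fst zeta) (snd zeta) n) with (u' n). change (V' (fst zeta) (snd zeta) n) with (v' n). change (Th' (fst zeta) (snd zeta) n) with (t' n).
      assert (W1 : Wc a (extend zeta (X 0%nat)) (extend zeta (X 1%nat)) (fst zeta) (snd zeta) n
         = (- Iz a (fun m => Ci * RtoC (IZR (fst zeta)) * X 0%nat m + Ci * RtoC (IZR (snd zeta)) * X 1%nat m) n)%C).
      { unfold Wc. f_equal. apply Iz_ext. intros m. now rewrite !extend_at. }
      assert (W2 : Cconj (Wc a U' V' (fst zeta) (snd zeta) n) = (Ci * Iz a g n)%C).
      { unfold Wc. rewrite (Iz_ext a _ (fun m => (Ci * D' m)%C)); [|intros m; unfold D', u', v'; ring].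
        rewrite Iz_scal; auto. unfold g. rewrite Iz_conj; auto.
        rewrite Copp_conj, Cmult_conj, Cconj_Ci. ring. }
      rewrite W1, W2.
      assert (E0 := HE 0%nat n ltac:(lia)). assert (E1 := HE 1%nat n ltac:(lia)). assert (E2 := HE 2%nat n ltac:(lia)).
      unfold stokes, coupling, hfreq in E0, E1, E2.
      assert (Hsy : (lam + RtoC (nu * (zabs2 (fst zeta) (snd zeta) + (kk n * PI / a) ^ 2)))%C = symb a nu lam zeta n).
      { unfold symb, omega2, zabs2. rewrite zabs_sq. rewrite <- Cplus_assoc, <- RtoC_plus. do 2 f_equal. ring. }
      set (W := Iz a (fun m => (Ci * RtoC (IZR (fst zeta)) * X 0%nat m + Ci * RtoC (IZR (snd zeta)) * X 1%nat m)%C) n) in *.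
      set (J := Iz a (X 2%nat) n) in *. set (Jg := Iz a g n).
      replace (g n) with (RtoC (IZR (fst zeta)) * Cconj (u' n) + RtoC (IZR (snd zeta)) * Cconj (v' n))%C
        by (unfold g, D'; rewrite Cplus_conj, !Cmult_conj, !Cconj_R; reflexivity).
      rewrite RtoC_div by lra.
      set (ub := Cconj (u' n)). set (vb := Cconj (v' n)). set (tb := Cconj (t' n)).
      set (x0 := X 0%nat n) in *. set (x1 := X 1%nat n) in *. set (x2 := X 2%nat n) in *.
      set (o := RtoC (one_coef a n)) in *. set (sy := symb a nu lam zeta n) in *.
      set (rx := RtoC (IZR (fst zeta))) in *. set (ry := RtoC (IZR (snd zeta))) in *.
      set (al := RtoC alpha) in *. set (be := RtoC beta) in *. set (ga := RtoC gamma) in *.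
      set (mu := RtoC (nu * (zabs2 (fst zeta) (snd zeta) + (kk n * PI / a) ^ 2))) in *.
      (* The equations for u, v, theta are multiplied by the conjugates of u', v' and (beta/gamma)
         theta' and added. The factor beta/gamma turns the gamma of the third equation into the beta
         of the form. *)
      transitivity (RtoC ((2 * PI) ^ 2) * ((sy * x0 + Ci * rx * p0 * o + (- (al * x1) + Ci * rx * be * J)) * ub
         + (sy * x1 + Ci * ry * p0 * o + (al * x0 + Ci * ry * be * J)) * vb
         + (sy * x2 + Ci * 0 * p0 * o + - (ga * W)) * (be / ga * tb)
         - Ci * (p0 * ((rx * ub + ry * vb) * o) + be * (J * (rx * ub + ry * vb) + x2 * Jg))))%C.
      - rewrite <- Hsy. field. auto.
      - rewrite E0, E1, E2. ring. }
    apply is_lim_seq_ext_loc with (fun N => Cmod (csum (T (fst zeta) (snd zeta)) (S N))).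
    + exists (Z.to_nat (Z.abs (fst zeta)) + Z.to_nat (Z.abs (snd zeta)))%nat. intros N HN.
      f_equal. symmetry. apply boxsum_single; auto; lia.
    + apply (is_lim_seq_incr_1 (fun N => Cmod (csum (T (fst zeta) (snd zeta)) N))).
      set (k := (RtoC ((2 * PI) ^ 2) * (- Ci))%C).
      assert (HLL : clim (csum (T (fst zeta) (snd zeta))) (k * (p0 * 0 + RtoC beta * 0))%C).
      { apply clim_ext with (fun N => (k * (p0 * csum (fun n => (g n * RtoC (one_coef a n))%C) N +
           RtoC beta * csum (fun n => (Iz a (X 2%nat) n * g n + X 2%nat n * Iz a g n)%C) N))%C).
        - intros N. rewrite <- !csum_scal, <- csum_plus, <- csum_scal. apply csum_ext. intros n _. now rewrite Hon.
        - apply clim_scal. apply clim_plus; apply clim_scal; auto. }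
      apply clim_Cmod in HLL. replace (Cmod (k * (p0 * 0 + RtoC beta * 0))) with 0 in HLL; auto.
      replace (k * (p0 * 0 + RtoC beta * 0))%C with (RtoC 0) by ring. now rewrite Cmod_0.
Qed.

Lemma kernel_trivial a nu alpha beta gamma c ck s lam zeta X p0 :
  0 < a -> 0 < nu -> 0 < gamma -> -3 / 2 < s < 1 / 2 -> symb_bounds a nu c ck lam zeta ->
  ~ VP a nu alpha beta gamma lam -> in_dom a nu s zeta X ->
  (forall i n, (i < 3)%nat -> (stokes a nu lam zeta X p0 i n + coupling a alpha beta gamma zeta X i n = 0)%C) ->
  (forall i n, (i < 3)%nat -> X i n = 0%C) /\ p0 = 0%C.
Proof.
  intros Ha Hnu Hga Hs HS HVP HX HE.
  assert (H0 : forall i n, (i < 3)%nat -> X i n = 0%C).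
  { intros i n Hi. apply NNPP. intros Hne. apply HVP. eapply VP_of_kernel; eauto. }
  split; auto.
  assert (Hc0 : RtoC (one_coef a 0) <> 0%C).
  { rewrite one_coef_first; auto. apply Cmod_gt_0. rewrite Cmod_R.
    assert (0 < 2 * amp a * a / PI). { apply Rdiv_lt_0_compat; [|apply PI_RGT_0]. generalize (amp_pos a Ha). nra. }
    rewrite Rabs_pos_eq; lra. }
  assert (HI : forall n, Iz a (X 2%nat) n = 0%C).
  { intros n. rewrite (Iz_ext a _ (fun _ => 0%C)); [apply Iz_zero|]. intros; apply H0; lia. }
  assert (HCi : Ci <> 0%C) by (apply Cmod_gt_0; rewrite Cmod_Ci; lra).
  assert (K : forall r : R, (Ci * RtoC r * p0 * RtoC (one_coef a 0) = 0)%C -> r <> 0 -> p0 = 0%C).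
  { intros r E Hr. assert (Hrz : RtoC r <> 0%C) by (intros E'; apply Hr; now injection E').
    transitivity (/ (Ci * RtoC r * RtoC (one_coef a 0)) * (Ci * RtoC r * p0 * RtoC (one_coef a 0)))%C; [field; auto|].
    rewrite E. ring. }
  assert (E0 := HE 0%nat 0%nat ltac:(lia)). assert (E1 := HE 1%nat 0%nat ltac:(lia)).
  unfold stokes, coupling, hfreq in E0, E1. rewrite HI, !H0 in E0 by lia. rewrite HI, !H0 in E1 by lia.
  destruct HS as [_ [_ [Hz _]]]. destruct zeta as [x y]. simpl in *.
  (* With X = 0, the equation of a nonzero component of zeta at n = 0 is i zeta_j p0 c_0 = 0, and
     c_0, the integral of e_1, is positive. *)
  destruct (Z.eq_dec x 0) as [->|Hx].
  - apply (K (IZR y)); [rewrite <- E1; ring|]. apply not_0_IZR. intros ->. now apply Hz.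
  - apply (K (IZR x)); [rewrite <- E0; ring|]. now apply not_0_IZR.
Qed.

(** * Uniform solvability *)

(* Interleaves the three components and absorbs the weight, so that weighted triples become plain l2 sequences. *)
Definition pack (w : nat -> R) (F : nat -> nat -> C) (p : nat) : C :=
  (RtoC (sqrt (w (p / 3)%nat)) * F (p mod 3)%nat (p / 3)%nat)%C.
Definition unpack (w : nat -> R) (g : nat -> C) (i n : nat) : C :=
  (g (3 * n + i)%nat / RtoC (sqrt (w n)))%C.

Lemma div3 n i : (i < 3)%nat -> ((3 * n + i) / 3 = n /\ (3 * n + i) mod 3 = i)%nat.
Proof.
  intros H. split.
  - symmetry. apply Nat.div_unique with i; lia.
  - symmetry. apply Nat.mod_unique with n; lia.
Qed.

Lemma sqrtw_nz (w : nat -> R) n : 0 < w n -> RtoC (sqrt (w n)) <> 0%C.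
Proof.
  intros H. apply Cmod_gt_0. rewrite Cmod_R, Rabs_pos_eq; [|apply sqrt_pos]. now apply sqrt_lt_R0.
Qed.

Lemma pack_at w F n i : (i < 3)%nat -> pack w F (3 * n + i) = (RtoC (sqrt (w n)) * F i n)%C.
Proof. intros H. unfold pack. destruct (div3 n i H) as [-> ->]. reflexivity. Qed.

Lemma pack_unpack w g : (forall n, 0 < w n) -> forall p, pack w (unpack w g) p = g p.
Proof.
  intros Hw p. unfold pack, unpack.
  rewrite <- Nat.div_mod by lia. field. now apply sqrtw_nz.
Qed.

Lemma rsum3 f N : rsum f (3 * N) = rsum (fun n => f (3 * n + 0)%nat + f (3 * n + 1)%nat + f (3 * n + 2)%nat) N.
Proof.
  induction N; [reflexivity|]. replace (3 * S N)%nat with (S (S (S (3 * N)))) by lia.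
  cbn [rsum]. rewrite IHN. replace (S (S (3 * N))) with (3 * N + 2)%nat by lia.
  replace (S (3 * N)) with (3 * N + 1)%nat by lia. rewrite Nat.add_0_r. ring.
Qed.

(** The factor sqrt 3 for three components, rounded up to 2. *)
Lemma pack_l2le w F B : (forall n, 0 < w n) -> l2le3 w F B -> l2le unit_wgt (pack w F) (2 * B).
Proof.
  intros Hw HF. assert (HB : 0 <= B) by apply (HF 0%nat ltac:(lia)). split; [lra|]. intros N.
  apply Rle_trans with (rsum (fun p => unit_wgt p * Cmod (pack w F p) ^ 2) (3 * N)).
  { apply rsum_mono; [|lia]. intros n. unfold unit_wgt. generalize (pow2_ge_0 (Cmod (pack w F n))). lra. }
  rewrite rsum3.
  assert (E : forall n i, (i < 3)%nat -> unit_wgt (3 * n + i) * Cmod (pack w F (3 * n + i)) ^ 2 = w n * Cmod (F i n) ^ 2).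
  { intros n i Hi. rewrite pack_at, Cmod_mult, Cmod_R, Rpow_mult_distr, pow2_abs, pow2_sqrt; auto; [|left; auto].
    unfold unit_wgt. ring. }
  rewrite (rsum_ext _ (fun n => w n * Cmod (F 0%nat n) ^ 2 + w n * Cmod (F 1%nat n) ^ 2 + w n * Cmod (F 2%nat n) ^ 2)).
  - rewrite !rsum_plus. destruct (HF 0%nat ltac:(lia)) as [_ H0]. destruct (HF 1%nat ltac:(lia)) as [_ H1].
    destruct (HF 2%nat ltac:(lia)) as [_ H2]. specialize (H0 N). specialize (H1 N). specialize (H2 N). nra.
  - intros n _. rewrite !E by lia. reflexivity.
Qed.

Lemma unpack_l2le w g B : (forall n, 0 < w n) -> l2le unit_wgt g B -> l2le3 w (unpack w g) B.
Proof.
  intros Hw [HB Hg] i Hi. split; auto. intros N.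
  apply Rle_trans with (rsum (fun p => unit_wgt p * Cmod (g p) ^ 2) (3 * N)); auto.
  rewrite rsum3. apply rsum_le; intros n _. unfold unpack.
  rewrite Cmod_div; [|now apply sqrtw_nz]. rewrite Cmod_R, Rabs_pos_eq; [|apply sqrt_pos].
  unfold Rdiv. rewrite Rpow_mult_distr, pow_inv, pow2_sqrt; [|left; auto].
  replace (w n * (Cmod (g (3 * n + i)%nat) ^ 2 * / w n)) with (Cmod (g (3 * n + i)%nat) ^ 2) by (field; generalize (Hw n); lra).
  unfold unit_wgt. generalize (pow2_ge_0 (Cmod (g (3 * n + 0)%nat))) (pow2_ge_0 (Cmod (g (3 * n + 1)%nat))) (pow2_ge_0 (Cmod (g (3 * n + 2)%nat))).
  destruct i as [|[|[|i]]]; try lia; lra.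
Qed.

Definition linear_op3 w (T : (nat -> nat -> C) -> nat -> nat -> C) := forall F G c BF BG,
  l2le3 w F BF -> l2le3 w G BG -> forall i n, (i < 3)%nat ->
  T (fun i n => (F i n + c * G i n)%C) i n = (T F i n + c * T G i n)%C.
Definition bounded_op3 w (T : (nat -> nat -> C) -> nat -> nat -> C) K := forall F B, l2le3 w F B -> l2le3 w (T F) (K * B).

Definition packed w (T : (nat -> nat -> C) -> nat -> nat -> C) (g : nat -> C) := pack w (T (unpack w g)).

Lemma packed_linear w T : (forall n, 0 < w n) -> linear_op3 w T -> linear_op (packed w T).
Proof.
  intros Hw HT f g c [Bf Hf] [Bg Hg] p. unfold packed.
  replace (unpack w (fun m => (f m + c * g m)%C)) with (fun i n => (unpack w f i n + c * unpack w g i n)%C).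
  - unfold pack. rewrite (HT _ _ c Bf Bg); [ring|now apply unpack_l2le|now apply unpack_l2le|]. apply Nat.mod_upper_bound. lia.
  - apply functional_extensionality; intros i. apply functional_extensionality; intros n. unfold unpack, Cdiv. ring.
Qed.

Lemma packed_bounded w T K : (forall n, 0 < w n) -> bounded_op3 w T K -> bounded_op (packed w T) (2 * K).
Proof.
  intros Hw HT f B Hf. unfold packed. rewrite Rmult_assoc. apply pack_l2le; auto. apply HT. now apply unpack_l2le.
Qed.

Lemma packed_solve w T F g : (forall n, 0 < w n) -> (forall p, (g p + packed w T g p = pack w F p)%C) ->
  forall i n, (i < 3)%nat -> (unpack w g i n + T (unpack w g) i n = F i n)%C.
Proof.
  intros Hw H i n Hi. specialize (H (3 * n + i)%nat). unfold packed in H. rewrite !pack_at in H; auto.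
  assert (Hz := sqrtw_nz w n (Hw n)).
  set (t := T (unpack w g) i n) in *. unfold unpack.
  transitivity ((g (3 * n + i)%nat + RtoC (sqrt (w n)) * t) / RtoC (sqrt (w n)))%C; [field; auto|].
  rewrite H. field. auto.
Qed.

(** Packing costs a factor 2, hence 1/4 instead of 1/2 in the hypothesis and 4 instead of 2 in the
    bound. *)
Lemma neumann3 w T F B : (forall n, 0 < w n) -> linear_op3 w T -> bounded_op3 w T (1 / 4) -> l2le3 w F B ->
  exists G, l2le3 w G (4 * B) /\ forall i n, (i < 3)%nat -> (G i n + T G i n = F i n)%C.
Proof.
  intros Hw HT HTb HF.
  assert (Hb : bounded_op (packed w T) (1 / 2)).
  { replace (1 / 2) with (2 * (1 / 4)) by field. now apply packed_bounded. }
  destruct (neumann _ _ _ (packed_linear w T Hw HT) Hb (pack_l2le w F B Hw HF)) as [g [Hg E]].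
  exists (unpack w g). split.
  - replace (4 * B) with (2 * (2 * B)) by ring. now apply unpack_l2le.
  - now apply packed_solve.
Qed.

Lemma fredholm3 w T K N : (forall n, 0 < w n) -> linear_op3 w T -> bounded_op3 w T K -> 0 <= K ->
  bounded_op3 w (fun F i n => if Nat.ltb n N then 0%C else T F i n) (1 / 4) ->
  (forall G B, l2le3 w G B -> (forall i n, (i < 3)%nat -> (G i n + T G i n = 0)%C) ->
     forall i n, (i < 3)%nat -> G i n = 0%C) ->
  exists K', 0 <= K' /\ forall F B, l2le3 w F B ->
    exists G, l2le3 w G (K' * B) /\ forall i n, (i < 3)%nat -> (G i n + T G i n = F i n)%C.
Proof.
  intros Hw HT HTb HK HQ Hinj.
  destruct (fredholm (packed w T) (2 * K) (3 * N)) as [K' [HK' H]].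
  - now apply packed_linear.
  - now apply packed_bounded.
  - lra.
  - intros f B Hf.
    apply l2le_ext with (packed w (fun F i n => if Nat.ltb n N then 0%C else T F i n) f).
    + intros p. unfold packed, pack.
      assert (E := Nat.div_mod p 3 ltac:(lia)). assert (E' := Nat.mod_upper_bound p 3 ltac:(lia)).
      destruct (Nat.ltb_spec (p / 3) N); destruct (Nat.ltb_spec p (3 * N)); try lia; ring.
    + replace (1 / 2) with (2 * (1 / 4)) by field. now apply (packed_bounded w _ (1 / 4) Hw HQ).
  - intros g [B Hg] E p. rewrite <- (pack_unpack w g Hw p).
    assert (Hz : unpack w g (p mod 3) (p / 3) = 0%C).
    { apply (Hinj _ B).
      - now apply unpack_l2le.
      - apply (packed_solve w T (fun _ _ => 0%C) g Hw). intros q. rewrite E. unfold pack. ring.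
      - apply Nat.mod_upper_bound. lia. }
    unfold pack. rewrite Hz. ring.
  - exists (K' * 2). split; [lra|]. intros F B HF.
    destruct (H _ _ (pack_l2le w F B Hw HF)) as [g [Hg E]].
    exists (unpack w g). split.
    + rewrite Rmult_assoc. now apply unpack_l2le.
    + now apply packed_solve.
Qed.

(** The bound is placed on G = [stokes] X p0 and not on X: (a)-(d) all follow from it by the
    uncoupled estimates, with one constant K. *)
Definition solvable a nu alpha beta gamma s lam zeta K := forall F B, l2le3 (wgt nu s zeta) F B ->
  exists X p0, in_dom a nu s zeta X /\ l2le3 (wgt nu s zeta) (stokes a nu lam zeta X p0) (K * B) /\
    forall i n, (i < 3)%nat -> (stokes a nu lam zeta X p0 i n + coupling a alpha beta gamma zeta X i n = F i n)%C.

Lemma solvable_mono a nu alpha beta gamma s lam zeta K K' : K <= K' ->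
  solvable a nu alpha beta gamma s lam zeta K -> solvable a nu alpha beta gamma s lam zeta K'.
Proof.
  intros HK H F B HF. destruct (H F B HF) as [X [p0 [H1 [H2 H3]]]]. exists X, p0. split; [auto|split; [|auto]].
  intros i Hi. eapply l2le_weaken; [|apply H2; auto]. apply Rmult_le_compat_r; auto. apply (HF 0%nat ltac:(lia)).
Qed.

Lemma in_dom_Iz_summable3 a nu s zeta X : 0 < a -> 0 < nu -> -3 / 2 < s < 1 / 2 -> in_dom a nu s zeta X -> Iz_summable3 a X.
Proof.
  intros Ha Hnu Hs [[B HX] _].
  destruct (coupling_reg a nu 0 0 0 s s Ha Hnu) as [K [_ H]]; try lra. now apply (H zeta X B HX).
Qed.

Lemma coupling_stokes_inv_linear a nu alpha beta gamma c ck s lam zeta : 0 < a -> 0 < nu -> -3 / 2 < s < 1 / 2 -> symb_bounds a nu c ck lam zeta ->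
  linear_op3 (wgt nu s zeta) (fun G => coupling a alpha beta gamma zeta (stokes_inv a nu lam zeta G)).
Proof.
  intros Ha Hnu Hs HS F G d BF BG HF HG i n _.
  rewrite <- coupling_lin.
  - f_equal. apply functional_extensionality; intros j. apply functional_extensionality; intros m.
    apply (stokes_inv_lin a nu c ck s lam zeta F G d BF BG); auto. lra.
  - apply (in_dom_Iz_summable3 a nu s zeta); auto. apply (stokes_inv_in_dom a nu c ck s lam zeta F BF); auto. lra.
  - apply (in_dom_Iz_summable3 a nu s zeta); auto. apply (stokes_inv_in_dom a nu c ck s lam zeta G BG); auto. lra.
Qed.

Lemma solvable_of_stokes_inv a nu alpha beta gamma c ck s lam zeta K : 0 < a -> 0 < nu -> -3 / 2 < s < 1 / 2 -> symb_bounds a nu c ck lam zeta ->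
  (forall F B, l2le3 (wgt nu s zeta) F B -> exists G, l2le3 (wgt nu s zeta) G (K * B) /\
    forall i n, (i < 3)%nat -> (G i n + coupling a alpha beta gamma zeta (stokes_inv a nu lam zeta G) i n = F i n)%C) ->
  solvable a nu alpha beta gamma s lam zeta K.
Proof.
  intros Ha Hnu Hs HS H F B HF. destruct (H F B HF) as [G [HG E]].
  exists (stokes_inv a nu lam zeta G), (stokes_p a nu lam zeta G). split; [|split].
  - apply (stokes_inv_in_dom a nu c ck s lam zeta G (K * B)); auto. lra.
  - intros i Hi. apply l2le_ext with (G i); auto. intros n. symmetry. eapply stokes_stokes_inv; eauto.
  - intros i n Hi. erewrite stokes_stokes_inv; eauto.
Qed.

Lemma solvable_large a nu alpha beta gamma c ck s : 0 < a -> 0 < nu -> -3 / 2 < s < 1 / 2 ->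
  exists R, forall lam zeta, symb_bounds a nu c ck lam zeta -> R <= bomega2 lam zeta -> solvable a nu alpha beta gamma s lam zeta 4.
Proof.
  intros Ha Hnu Hs. destruct (coupling_stokes_inv_decay a nu alpha beta gamma c ck s Ha Hnu Hs) as [K [HK HT]].
  assert (Hg : 0 < decay s) by (unfold decay; assert (Rabs s < 3 / 2) by (apply Rabs_def1; lra); lra).
  (* Beyond this radius K <omega>^(-2 decay) is at most 1/4, where <omega>^2 is [bomega2]. *)
  exists (Rpower (4 * K) (/ decay s)). intros lam zeta HS HR.
  eapply solvable_of_stokes_inv; eauto. intros F B HF.
  apply neumann3; auto.
  - eapply coupling_stokes_inv_linear; eauto.
  - intros G BG HG i Hi. eapply l2le_weaken; [|apply (HT lam zeta G BG HS HG i Hi)].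
    apply Rmult_le_compat_r; [apply (HG 0%nat ltac:(lia))|].
    assert (E : 4 * K <= Rpower (bomega2 lam zeta) (decay s)).
    { apply Rle_trans with (Rpower (Rpower (4 * K) (/ decay s)) (decay s)).
      - rewrite Rpower_mult, Rinv_l, Rpower_1; lra.
      - apply Rle_Rpower_l; [lra|]. split; auto. }
    rewrite Rpower_Ropp. set (q := Rpower (bomega2 lam zeta) (decay s)) in *.
    apply Rmult_le_reg_r with q; [lra|]. rewrite Rmult_assoc, Rinv_l; lra.
Qed.

(** Here the constant depends on lam and zeta, which is enough: it is used for one fixed pair at a
    time. *)
Lemma in_dom_l2le a nu c ck s lam zeta : 0 < a -> 0 < nu -> -3 / 2 < s < 1 / 2 -> symb_bounds a nu c ck lam zeta ->
  exists K, 0 < K /\ forall X p0 B, in_dom a nu s zeta X -> l2le3 (wgt nu s zeta) (stokes a nu lam zeta X p0) B ->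
    l2le3 (wgt nu (s + 2) zeta) X (K * B).
Proof.
  intros Ha Hnu Hs HS.
  destruct (pressure_estimate a nu c ck s Ha Hnu ltac:(lra)) as [Kp [HKp Hp]].
  destruct (div_symb_l2le a nu c ck s Hnu) as [Kd [HKd Hd]].
  destruct (pmode_l2le a nu c ck (s + 2) Ha Hnu ltac:(lra)) as [Kb [HKb Hb]]. specialize (Hb lam zeta HS).
  assert (Hz : zeta <> (0%Z, 0%Z)) by apply HS.
  destruct (bomega2_bounds lam zeta Hz) as [Z1 [_ [_ [Z4 [Z5 [_ Z7]]]]]].
  assert (M1 := Ms_ge0 s lam zeta). assert (M2 := Ms_ge0 (- (s + 2)) lam zeta).
  set (C1 := Kp * bomega2 lam zeta * Ms s lam zeta * (Kb * Ms (- (s + 2)) lam zeta)).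
  assert (HC1 : 0 <= C1) by (unfold C1; repeat apply Rmult_le_pos; lra).
  exists (C1 + Kd). split; [lra|]. intros X p0 B HX HA i Hi.
  assert (HP := Hp lam zeta X p0 B _ HS HX HA (fun i n _ => eq_refl)).
  apply l2le_ext with (fun n => (- (Ci * RtoC (hfreq zeta i) * p0) * pmode a nu lam zeta n + stokes a nu lam zeta X p0 i n / symb a nu lam zeta n)%C).
  - intros n. symmetry. eapply stokes_split; eauto.
  - rewrite Rmult_plus_distr_r. apply l2le_plus; auto; [|apply Hd; auto].
    eapply l2le_weaken; [|apply l2le_scal; exact Hb].
    rewrite Cmod_opp, !Cmod_mult, Cmod_Ci, Cmod_R, Rmult_1_l.
    apply Rle_trans with (Kp * bomega2 lam zeta * Ms s lam zeta * B * (Kb * Ms (- (s + 2)) lam zeta)); [|unfold C1; right; ring].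
    apply Rmult_le_compat_r; [apply Rmult_le_pos; lra|]. eapply Rle_trans; [|exact HP].
    apply Rmult_le_compat_r; [apply Cmod_ge_0|apply hfreq_le].
Qed.

(** T maps H^s to H^s' with s' > s, so its rows with large n are small in H^s; this is the
    compactness that [fredholm3] asks for. Injectivity of 1 + T is the triviality of the kernel. *)
Lemma solvable_each a nu alpha beta gamma c ck s lam zeta : 0 < a -> 0 < nu -> 0 < gamma -> -3 / 2 < s < 1 / 2 ->
  symb_bounds a nu c ck lam zeta -> ~ VP a nu alpha beta gamma lam ->
  exists K, 0 <= K /\ solvable a nu alpha beta gamma s lam zeta K.
Proof.
  intros Ha Hnu Hga Hs HS HVP.
  set (s' := (s + 1 / 2) / 2).
  destruct (coupling_reg a nu alpha beta gamma s s' Ha Hnu ltac:(lra) ltac:(unfold s'; lra) ltac:(unfold s'; lra) ltac:(unfold s'; lra)) as [K1 [HK1 H1]].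
  destruct (in_dom_l2le a nu c ck s lam zeta Ha Hnu Hs HS) as [K2 [HK2 H2]].
  set (T := fun G => coupling a alpha beta gamma zeta (stokes_inv a nu lam zeta G)).
  set (K := K1 * (1 + zabs zeta) * K2).
  assert (HK : 0 < K). { unfold K. generalize (zabs_ge0 zeta). intros. apply Rmult_lt_0_compat; auto. apply Rmult_lt_0_compat; lra. }
  assert (HT : forall F B, l2le3 (wgt nu s zeta) F B -> l2le3 (wgt nu s' zeta) (T F) (K * B)).
  { intros F B HF. unfold K. rewrite Rmult_assoc. apply H1.
    apply (H2 _ (stokes_p a nu lam zeta F)).
    - apply (stokes_inv_in_dom a nu c ck s lam zeta F B); auto. lra.
    - intros i Hi. apply l2le_ext with (F i); auto. intros n. symmetry. eapply stokes_stokes_inv; eauto. }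
  set (eta := s' - s). assert (Heta : 0 < eta) by (unfold eta, s'; lra).
  (* Where the base of the weight exceeds Y, its power eta is at least (4 K)^2, which reduces the
     norm K of T to 1/4. N is taken with nu N >= Y. *)
  set (Y := Rpower (4 * K) (2 / eta)).
  assert (HN : exists N : nat, Y / nu <= INR N).
  { destruct (archimed (Y / nu)) as [Hup _].
    exists (Z.to_nat (up (Y / nu))). rewrite INR_IZR_INZ, Z2Nat.id; [lra|].
    apply le_IZR. assert (0 < Y / nu) by (apply Rdiv_lt_0_compat; auto; apply Rpower_pos). lra. }
  destruct HN as [N HN].
  destruct (fredholm3 (wgt nu s zeta) T K N) as [K' [HK' H']]; auto.
  - eapply coupling_stokes_inv_linear; eauto.
  - intros F B HF i Hi. apply l2le_mono with (s' := s'); auto; [unfold s'; lra|]. now apply HT.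
  - lra.
  - intros F B HF i Hi.
    replace (1 / 4 * B) with (/ (4 * K) * (K * B)) by (field; lra).
    generalize (HT F B HF i Hi). apply l2le_dom; [left; apply Rinv_0_lt_compat; lra|].
    intros n. destruct (Nat.ltb_spec n N) as [Hn|Hn].
    + rewrite Cmod_0. replace (wgt nu s zeta n * 0 ^ 2) with 0 by ring.
      apply Rmult_le_pos; [apply pow2_ge_0|]. apply Rmult_le_pos; auto. apply pow2_ge_0.
    + rewrite <- Rmult_assoc. apply Rmult_le_compat_r; [apply pow2_ge_0|].
      rewrite !wgt_wbase. replace s' with (s + eta) by (unfold eta; ring). rewrite Rpower_plus.
      assert (HY : Y <= wbase nu zeta n).
      { unfold wbase. assert (INR N <= kk n ^ 2).
        { apply Rle_trans with (kk n). unfold kk. rewrite S_INR. apply le_INR in Hn. lra.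
          generalize (kk_ge1 n). nra. }
        assert (nu * (Y / nu) <= nu * kk n ^ 2) by (apply Rmult_le_compat_l; lra).
        replace (nu * (Y / nu)) with Y in H0 by (field; lra).
        generalize (pow2_ge_0 (zabs zeta)). nra. }
      assert (HE : (4 * K) ^ 2 <= Rpower (wbase nu zeta n) eta).
      { apply Rle_trans with (Rpower Y eta).
        - unfold Y. rewrite Rpower_mult. replace (2 / eta * eta) with (INR 2) by (simpl; field; lra).
          rewrite Rpower_pow; lra.
        - apply Rle_Rpower_l; [lra|]. split; auto. apply Rpower_pos. }
      assert (W := Rpower_pos (wbase nu zeta n) s).
      set (q := Rpower (wbase nu zeta n) eta) in *. set (r := Rpower (wbase nu zeta n) s) in *.
      rewrite pow_inv. assert (P4 : 0 < (4 * K) ^ 2) by (apply pow_lt; lra).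
      apply Rmult_le_reg_l with ((4 * K) ^ 2); auto.
      replace ((4 * K) ^ 2 * (/ (4 * K) ^ 2 * (r * q))) with (r * q) by (field; lra). nra.
  - intros G B HG E.
    assert (HSX : in_dom a nu s zeta (stokes_inv a nu lam zeta G)) by (apply (stokes_inv_in_dom a nu c ck s lam zeta G B); auto; lra).
    assert (HSE : forall i n, (i < 3)%nat -> (stokes a nu lam zeta (stokes_inv a nu lam zeta G) (stokes_p a nu lam zeta G) i n
       + coupling a alpha beta gamma zeta (stokes_inv a nu lam zeta G) i n = 0)%C).
    { intros i n Hi. rewrite (stokes_stokes_inv a nu c ck lam zeta G i n HS). now apply E. }
    destruct (kernel_trivial a nu alpha beta gamma c ck s lam zeta _ _ Ha Hnu Hga Hs HS HVP HSX HSE) as [E1 E2].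
    intros i n Hi. rewrite <- (stokes_stokes_inv a nu c ck lam zeta G i n HS). unfold stokes. rewrite E1, E2; auto. ring.
  - exists K'. split; auto. eapply solvable_of_stokes_inv; eauto.
Qed.

Lemma stokes_lin a nu lam zeta X Y p q d i n :
  stokes a nu lam zeta (fun i n => (X i n + d * Y i n)%C) (p + d * q)%C i n
  = (stokes a nu lam zeta X p i n + d * stokes a nu lam zeta Y q i n)%C.
Proof. unfold stokes. ring. Qed.

Lemma in_dom_lin a nu s zeta X Y d : 0 < a -> 0 < nu -> -2 <= s -> in_dom a nu s zeta X -> in_dom a nu s zeta Y ->
  in_dom a nu s zeta (fun i n => (X i n + d * Y i n)%C).
Proof.
  intros Ha Hnu Hs [[BX HX] DX] [[BY HY] DY]. split.
  - exists (BX + Cmod d * BY). intros i Hi. apply l2le_plus; auto. apply l2le_scal; auto.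
  - rewrite (Cseries_ext _ (fun n => (hdot zeta X n * RtoC (one_coef a n) + d * (hdot zeta Y n * RtoC (one_coef a n)))%C)); [|intros; unfold hdot; ring].
    rewrite Cseries_plus, Cseries_scal, DX, DY; [ring| | |apply abs_summable_scal]; eapply one_coef_pairing_hdot with (s := s); eauto.
Qed.

Lemma solution_unique a nu alpha beta gamma c ck s lam zeta X Y p q :
  0 < a -> 0 < nu -> 0 < gamma -> -3 / 2 < s < 1 / 2 -> symb_bounds a nu c ck lam zeta ->
  ~ VP a nu alpha beta gamma lam -> in_dom a nu s zeta X -> in_dom a nu s zeta Y ->
  (forall i n, (i < 3)%nat -> (stokes a nu lam zeta X p i n + coupling a alpha beta gamma zeta X i n =
     stokes a nu lam zeta Y q i n + coupling a alpha beta gamma zeta Y i n)%C) ->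
  (forall i n, (i < 3)%nat -> X i n = Y i n) /\ p = q.
Proof.
  intros Ha Hnu Hga Hs HS HVP HX HY HE.
  assert (HZ : in_dom a nu s zeta (fun i n => (X i n + (- (1)) * Y i n)%C)) by (apply in_dom_lin; auto; lra).
  assert (HZE : forall i n, (i < 3)%nat -> (stokes a nu lam zeta (fun i n => (X i n + (- (1)) * Y i n)%C) (p + (- (1)) * q)%C i n
     + coupling a alpha beta gamma zeta (fun i n => (X i n + (- (1)) * Y i n)%C) i n = 0)%C).
  { intros i n Hi. rewrite stokes_lin, coupling_lin; try (apply (in_dom_Iz_summable3 a nu s zeta); auto).
    specialize (HE i n Hi).
    transitivity ((stokes a nu lam zeta X p i n + coupling a alpha beta gamma zeta X i n) - (stokes a nu lam zeta Y q i n + coupling a alpha beta gamma zeta Y i n))%C; [ring|].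
    rewrite HE. ring. }
  destruct (kernel_trivial a nu alpha beta gamma c ck s lam zeta _ _ Ha Hnu Hga Hs HS HVP HZ HZE) as [E1 E2].
  split.
  - intros i n Hi. specialize (E1 i n Hi). simpl in E1.
    transitivity ((X i n + (- (1)) * Y i n) + Y i n)%C; [ring|]. rewrite E1. ring.
  - transitivity ((p + (- (1)) * q) + q)%C; [ring|]. rewrite E2. ring.
Qed.

Lemma stokes_shift a nu lam0 lam zeta X p i n :
  stokes a nu lam zeta X p i n = (stokes a nu lam0 zeta X p i n + (lam - lam0) * X i n)%C.
Proof. unfold stokes, symb, omega2. ring. Qed.

(* At lam the system reads L_lam0 X + (lam - lam0) X = F, a small perturbation of F' |-> F' in terms of
   F' = L_lam0 X. *)
Lemma solvable_near a nu alpha beta gamma c ck s lam0 zeta K0 :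
  0 < a -> 0 < nu -> 0 < gamma -> -3 / 2 < s < 1 / 2 -> symb_bounds a nu c ck lam0 zeta ->
  ~ VP a nu alpha beta gamma lam0 -> 0 <= K0 -> solvable a nu alpha beta gamma s lam0 zeta K0 ->
  exists d, 0 < d /\ forall lam, Cmod (lam - lam0) < d -> solvable a nu alpha beta gamma s lam zeta (4 * K0 + 1).
Proof.
  intros Ha Hnu Hga Hs HS HVP HK0 HG.
  destruct (in_dom_l2le a nu c ck s lam0 zeta Ha Hnu Hs HS) as [Kx [HKx HX]].
  (* A solution operator at lam0, with the solution chosen before the bound B; uniqueness transfers
     the estimate to every B. *)
  assert (Hch : forall F, exists Xp : (nat -> nat -> C) * C, forall B, l2le3 (wgt nu s zeta) F B ->
     in_dom a nu s zeta (fst Xp) /\ l2le3 (wgt nu s zeta) (stokes a nu lam0 zeta (fst Xp) (snd Xp)) (K0 * B) /\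
    forall i n, (i < 3)%nat -> (stokes a nu lam0 zeta (fst Xp) (snd Xp) i n + coupling a alpha beta gamma zeta (fst Xp) i n = F i n)%C).
  { intros F. destruct (classic (exists B, l2le3 (wgt nu s zeta) F B)) as [[B0 HB0]|Hn].
    - destruct (HG F B0 HB0) as [X [p [H1 [H2 H3]]]]. exists (X, p). intros B HB. simpl fst; simpl snd.
      split; [auto|split; auto].
      destruct (HG F B HB) as [X' [p' [H1' [H2' H3']]]].
      destruct (solution_unique a nu alpha beta gamma c ck s lam0 zeta X' X p' p Ha Hnu Hga Hs HS HVP H1' H1) as [E1 E2].
      { intros i n Hi. now rewrite H3, H3'. }
      intros i Hi. apply l2le_ext with (stokes a nu lam0 zeta X' p' i); [|now apply H2'].
      intros n. unfold stokes. now rewrite E1, E2.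
    - exists ((fun _ _ => RtoC 0), RtoC 0). intros B HB. exfalso; eauto. }
  destruct (choice _ Hch) as [R0 HR0]. clear Hch.
  (* Makes |lam - lam0| Kx K0 <= 1/4, the size required of the perturbation T. *)
  exists (/ (4 * (Kx * K0 + 1))). assert (HCK : 0 <= Kx * K0) by (apply Rmult_le_pos; lra).
  split; [apply Rinv_0_lt_compat; lra|]. intros lam Hlam.
  set (T := fun F i n => ((lam - lam0) * fst (R0 F) i n)%C).
  assert (HTb : bounded_op3 (wgt nu s zeta) T (1 / 4)).
  { intros F B HF i Hi. destruct (HR0 F B HF) as [R1 [R2 R3]].
    assert (HB : 0 <= B) by apply (HF 0%nat ltac:(lia)).
    unfold T. eapply l2le_weaken; [|apply l2le_scal; apply l2le_mono with (s' := s + 2); [auto|lra|apply (HX _ _ _ R1 R2 i Hi)]].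
    apply Rle_trans with (/ (4 * (Kx * K0 + 1)) * (Kx * K0 * B)).
    - replace (Kx * (K0 * B)) with (Kx * K0 * B) by ring. apply Rmult_le_compat_r; [apply Rmult_le_pos; auto|lra].
    - replace (1 / 4 * B) with (/ (4 * (Kx * K0 + 1)) * ((Kx * K0 + 1) * B)) by (field; lra).
      apply Rmult_le_compat_l; [left; apply Rinv_0_lt_compat; lra|]. nra. }
  assert (HTl : linear_op3 (wgt nu s zeta) T).
  { intros F G e BF BG HF HG' i n Hi. unfold T.
    assert (HFG : l2le3 (wgt nu s zeta) (fun i n => (F i n + e * G i n)%C) (BF + Cmod e * BG)).
    { intros j Hj. apply l2le_plus; auto. apply l2le_scal; auto. }
    destruct (HR0 F BF HF) as [R1 [R2 R3]]. destruct (HR0 G BG HG') as [S1 [S2 S3]]. destruct (HR0 _ _ HFG) as [U1 [U2 U3]].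
    set (XF := R0 F) in *. set (XG := R0 G) in *. set (XS := R0 (fun i n => (F i n + e * G i n)%C)) in *.
    destruct (solution_unique a nu alpha beta gamma c ck s lam0 zeta (fst XS) (fun i n => (fst XF i n + e * fst XG i n)%C)
       (snd XS) (snd XF + e * snd XG)%C Ha Hnu Hga Hs HS HVP U1) as [E1 _].
    - apply in_dom_lin; auto. lra.
    - intros j m Hj. rewrite U3; auto. rewrite stokes_lin, coupling_lin; try (apply (in_dom_Iz_summable3 a nu s zeta); auto).
      rewrite <- R3, <- S3; auto. ring.
    - rewrite E1; auto. ring. }
  intros F B HF.
  destruct (neumann3 (wgt nu s zeta) T F B (wgt_pos nu s zeta) HTl HTb HF) as [F' [HF' E]].
  destruct (HR0 F' _ HF') as [R1 [R2 R3]].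
  exists (fst (R0 F')), (snd (R0 F')). split; [auto|split].
  - intros i Hi. apply l2le_ext with (fun n => (stokes a nu lam0 zeta (fst (R0 F')) (snd (R0 F')) i n + T F' i n)%C).
    + intros n. unfold T. symmetry. apply stokes_shift.
    (* At lam, [stokes] is its value at lam0 plus T F', with F' bounded by 4 B: 4 K0 from the former
       and 1/4 * 4 = 1 from the latter. *)
    + replace ((4 * K0 + 1) * B) with (K0 * (4 * B) + 1 / 4 * (4 * B)) by field. apply l2le_plus; auto.
      now apply HTb.
  - intros i n Hi. rewrite (stokes_shift a nu lam0 lam). rewrite <- E, <- R3; auto. unfold T. ring.
Qed.

(** * Uniformity in lambda and zeta *)

Lemma inS_compl_open delta1 delta2 u v : 0 < delta1 -> ~ inS delta1 delta2 (u, v) ->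
  exists d, 0 < d /\ forall x y, Rabs (x - u) < d -> Rabs (y - v) < d -> ~ inS delta1 delta2 (x, y).
Proof.
  intros Hd Hn.
  (* The sector is a superlevel set of |y| + (delta2 + x) / delta1. The radius d below divides the
     gap - h by 1 + 1 / delta1, which bounds the variation of this function under coordinate changes
     below d. *)
  assert (Hiff : forall x y, inS delta1 delta2 (x, y) <-> 0 <= Rabs y + (delta2 + x) / delta1).
  { intros x y. split.
    - intros [m1 [m2 [E H]]]. injection E as -> ->. apply Rge_le in H.
      replace ((delta2 + (- delta2 - m1)) / delta1) with (- (m1 / delta1)) by (field; lra). lra.
    - intros H. exists (- delta2 - x), y. split; [f_equal; ring|]. apply Rle_ge.
      replace ((- delta2 - x) / delta1) with (- ((delta2 + x) / delta1)) by (field; lra). lra. }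
  rewrite Hiff in Hn. set (h := Rabs v + (delta2 + u) / delta1) in *.
  assert (Hh : 0 < - h) by lra. assert (Hi : 0 < / delta1) by (now apply Rinv_0_lt_compat).
  exists (- h / (1 + / delta1)). split; [apply Rdiv_lt_0_compat; lra|].
  intros x y Hx Hy. rewrite Hiff. set (d := - h / (1 + / delta1)) in *.
  assert (E : d * (1 + / delta1) = - h) by (unfold d; field; split; [|lra]; intros E; assert (0 < / delta1 * delta1) by nra; nra).
  assert (H1 : Rabs y < Rabs v + d).
  { replace y with ((y - v) + v) by ring. generalize (Rabs_triang (y - v) v). lra. }
  assert (H2 : (delta2 + x) / delta1 <= (delta2 + u) / delta1 + d * / delta1).
  { unfold Rdiv. rewrite <- Rmult_plus_distr_r. apply Rmult_le_compat_r; [lra|].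
    generalize (Rle_abs (x - u)). lra. }
  unfold h in E. lra.
Qed.

Lemma solvable_ball a nu alpha beta gamma delta1 delta2 c ck s zeta rho :
  0 < a -> 0 < nu -> 0 < gamma -> -3 / 2 < s < 1 / 2 -> 0 < delta1 ->
  (forall lam, inS delta1 delta2 lam -> symb_bounds a nu c ck lam zeta /\ ~ VP a nu alpha beta gamma lam) ->
  exists K, forall lam, inS delta1 delta2 lam -> Cmod lam <= rho -> solvable a nu alpha beta gamma s lam zeta K.
Proof.
  intros Ha Hnu Hga Hs Hd1 HS.
  (* One positive number serves as radius of the neighbourhood and, through its inverse, as constant
     of solvability, so that a lower bound on radii bounds the constants too. Points outside the
     sector get a neighbourhood disjoint from it, because compactness is applied to a whole
     square. *)
  assert (H : forall uv : R * R, exists d : posreal, forall x y,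
     Rabs (x - fst uv) < d -> Rabs (y - snd uv) < d -> inS delta1 delta2 (x, y) ->
     solvable a nu alpha beta gamma s (x, y) zeta (/ d)).
  { intros [u v]. simpl fst; simpl snd. destruct (classic (inS delta1 delta2 (u, v))) as [Hin|Hout].
    - destruct (HS _ Hin) as [HSec HVP].
      destruct (solvable_each a nu alpha beta gamma c ck s (u, v) zeta Ha Hnu Hga Hs HSec HVP) as [K0 [HK0 HG]].
      destruct (solvable_near a nu alpha beta gamma c ck s (u, v) zeta K0 Ha Hnu Hga Hs HSec HVP HK0 HG) as [d [Hd HG']].
      (* Half of d, because |lam - lam0| is bounded by the sum of the two coordinate distances. *)
      assert (Hm : 0 < Rmin (d / 2) (/ (4 * K0 + 1))) by (apply Rmin_pos; [lra|apply Rinv_0_lt_compat; lra]).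
      exists (mkposreal _ Hm). simpl. intros x y Hx Hy _.
      apply solvable_mono with (4 * K0 + 1).
      + rewrite <- (Rinv_inv (4 * K0 + 1)) at 1. apply Rinv_le_contravar; auto. apply Rmin_r.
      + apply HG'. eapply Rle_lt_trans; [apply Cmod_le_ReIm|]. simpl Re; simpl Im.
        assert (M := Rmin_l (d / 2) (/ (4 * K0 + 1))).
        change (Rabs (x + - u) + Rabs (y + - v) < d). unfold Rminus in Hx, Hy. lra.
    - destruct (inS_compl_open delta1 delta2 u v Hd1 Hout) as [d [Hd HG']].
      exists (mkposreal _ Hd). simpl. intros x y Hx Hy Hin. exfalso. exact (HG' x y Hx Hy Hin). }
  destruct (choice _ H) as [dl Hdl].
  destruct (compactness_value_2d (- rho) rho (- rho) rho (fun u v => dl (u, v))) as [d Hd].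
  exists (/ d). intros [x y] Hin Hrho.
  assert (Bx : - rho <= x <= rho).
  { assert (Q := re_le_Cmod (x, y)). simpl Re in Q. apply Rabs_le_between. lra. }
  assert (By : - rho <= y <= rho).
  { assert (Q := Im_le_Cmod (x, y)). simpl Im in Q. apply Rabs_le_between. lra. }
  (* The compactness lemma gives the nearby centre (u, v) under a double negation. *)
  specialize (Hd x y Bx By). apply NNPP in Hd. destruct Hd as [u [v [_ [_ [Hx [Hy Hdd]]]]]].
  apply solvable_mono with (/ dl (u, v)).
  - apply Rinv_le_contravar; auto. apply cond_pos.
  - apply Hdl; auto.
Qed.

Lemma Z_uniform (P : Z -> R -> Prop) (M : nat) :
  (forall x K K', K <= K' -> P x K -> P x K') -> (forall x, exists K, P x K) ->
  exists K, forall x, (Z.abs x <= Z.of_nat M)%Z -> P x K.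
Proof.
  intros Hm H. induction M.
  - destruct (H 0%Z) as [K HK]. exists K. intros x Hx. replace x with 0%Z by lia. auto.
  - destruct IHM as [K0 HK0]. destruct (H (Z.of_nat (S M))) as [K1 HK1]. destruct (H (- Z.of_nat (S M))%Z) as [K2 HK2].
    exists (Rmax K0 (Rmax K1 K2)). intros x Hx.
    destruct (Z_le_gt_dec (Z.abs x) (Z.of_nat M)).
    + apply Hm with K0; auto. apply Rmax_l.
    + assert (E : (x = Z.of_nat (S M) \/ x = - Z.of_nat (S M))%Z) by lia. destruct E as [-> | ->].
      * apply Hm with K1; auto. eapply Rle_trans; [apply Rmax_l|apply Rmax_r].
      * apply Hm with K2; auto. eapply Rle_trans; [apply Rmax_r|apply Rmax_r].
Qed.

Lemma solvable_uniform a nu alpha beta gamma delta1 delta2 c ck s :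
  0 < a -> 0 < nu -> 0 < gamma -> -3 / 2 < s < 1 / 2 -> 0 < delta1 ->
  (forall lam zeta, inS delta1 delta2 lam -> zeta <> (0%Z, 0%Z) -> symb_bounds a nu c ck lam zeta) ->
  (forall lam, inS delta1 delta2 lam -> ~ VP a nu alpha beta gamma lam) ->
  exists K, forall lam zeta, inS delta1 delta2 lam -> zeta <> (0%Z, 0%Z) -> solvable a nu alpha beta gamma s lam zeta K.
Proof.
  intros Ha Hnu Hga Hs Hd1 HS HVP.
  destruct (solvable_large a nu alpha beta gamma c ck s Ha Hnu Hs) as [R HR].
  set (P := fun x y K => (x, y) <> (0%Z, 0%Z) -> forall lam, inS delta1 delta2 lam -> Cmod lam <= R -> solvable a nu alpha beta gamma s lam (x, y) K).
  assert (Pm : forall x y K K', K <= K' -> P x y K -> P x y K').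
  { intros x y K K' HK H Hz lam H1 H2. apply solvable_mono with K; auto. }
  assert (HP : forall x y, exists K, P x y K).
  { intros x y. destruct (classic ((x, y) = (0%Z, 0%Z))) as [E|Hz].
    - exists 0. intros Hz. now exfalso.
    - destruct (solvable_ball a nu alpha beta gamma delta1 delta2 c ck s (x, y) R Ha Hnu Hga Hs Hd1) as [K HK]; [intros; split; auto|].
      exists K. intros _. exact HK. }
  set (M := Z.to_nat (up R)).
  destruct (Z_uniform (fun x K => forall y, (Z.abs y <= Z.of_nat M)%Z -> P x y K) M) as [K HK].
  { intros x K K' H H' y Hy. apply Pm with K; auto. }
  { intros x. apply (Z_uniform (P x) M); auto. apply Pm. }
  exists (Rmax 4 K). intros lam zeta Hin Hz.
  destruct (Rle_dec R (bomega2 lam zeta)) as [Hl|Hl].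
  - apply solvable_mono with 4; [apply Rmax_l|]. apply HR; auto.
  - apply solvable_mono with K; [apply Rmax_r|].
    destruct (bomega2_bounds lam zeta Hz) as [Z1 [_ [_ [Z4 [Z5 [Z6 Z7]]]]]].
    destruct (archimed R) as [Hup _].
    assert (Hup0 : (0 <= up R)%Z) by (apply le_IZR; lra).
    (* Below the threshold R, each component satisfies i^2 <= |zeta|^2 <= <omega>^2 < R, and |i| <=
       i^2 for integers, so |i| <= up R. *)
    assert (Hc : forall i : Z, IZR i ^ 2 <= zabs zeta ^ 2 -> (Z.abs i <= Z.of_nat M)%Z).
    { intros i Hi. unfold M. rewrite Z2Nat.id; auto.
      assert (E : IZR (i * i) <= IZR (up R)) by (rewrite mult_IZR; lra). apply le_IZR in E. nia. }
    rewrite zabs_sq in Hc. destruct zeta as [x y]. simpl fst in Hc. simpl snd in Hc.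
    apply (HK x); auto; [| |lra]; apply Hc; [generalize (pow2_ge_0 (IZR y))|generalize (pow2_ge_0 (IZR x))]; lra.
Qed.

(** * Passage between partial-sum bounds and the norms of the theorem *)

Lemma l2le_of_inH nu s zeta f : inH nu s zeta f -> l2le (wgt nu s zeta) f (normH nu s zeta f).
Proof.
  intros H. assert (Hp : forall n, 0 <= wgt nu s zeta n * Cmod (f n) ^ 2) by (intros; apply Rmult_le_pos; auto; apply pow2_ge_0).
  split; [apply sqrt_pos|]. intros N. unfold normH. rewrite pow2_sqrt.
  - apply (rsum_le_Series _ N Hp H).
  - eapply Rle_trans; [|apply (rsum_le_Series _ 0 Hp H)]. simpl; lra.
Qed.

Lemma inH_of_l2le nu s zeta f B : l2le (wgt nu s zeta) f B -> inH nu s zeta f.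
Proof.
  intros [_ H]. apply rsum_ex_series with (B ^ 2); auto.
  intros; apply Rmult_le_pos; auto; apply pow2_ge_0.
Qed.

Lemma normH_le nu s zeta f B : l2le (wgt nu s zeta) f B -> normH nu s zeta f <= B.
Proof.
  intros [HB H]. unfold normH. rewrite <- (sqrt_pow2 B); auto. apply sqrt_le_1_alt.
  apply Series_le_bound; auto. intros; apply Rmult_le_pos; auto; apply pow2_ge_0.
Qed.

Lemma normH_ge0 nu s zeta f : 0 <= normH nu s zeta f.
Proof. apply sqrt_pos. Qed.

Definition triple (f g h : nat -> C) (i : nat) : nat -> C :=
  match i with O => f | S O => g | _ => h end.

Lemma l2le3_triple w f g h B : l2le w f B -> l2le w g B -> l2le w h B -> l2le3 w (triple f g h) B.
Proof. intros H1 H2 H3 i Hi. destruct i as [|[|[|i]]]; simpl; auto. Qed.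

(** * Estimates *)

(** The pressure enters as p0 times the constant function 1, whose coefficients are of order 1/k;
    this bounds the pressure term in the continuity of the operator. *)
Lemma one_coef_l2le a nu s zeta : 0 < a -> 0 < nu -> s < 1 / 2 -> zeta <> (0%Z, 0%Z) ->
  exists B, l2le (wgt nu s zeta) (fun n => RtoC (one_coef a n)) B.
Proof.
  intros Ha Hnu Hs Hz. destruct (sum_Rpower_kb s Hs) as [K [HK HW]]. destruct (wgt_kb nu s Hnu) as [M [HM HA]].
  set (D := (2 * amp a * a / PI) ^ 2). assert (HD : 0 <= D) by apply pow2_ge_0.
  assert (HR := Rpower_pos (bzeta zeta ^ 2) s).
  exists (sqrt (M * D * (K * Rpower (bzeta zeta ^ 2) s))). split; [apply sqrt_pos|]. intros N.
  rewrite pow2_sqrt.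
  - eapply Rle_trans; [|apply Rmult_le_compat_l; [|apply (HW zeta N Hz)]].
    + rewrite <- rsum_scal. apply rsum_le; intros n _. rewrite Cmod_R, pow2_abs.
      replace (M * D * (Rpower (kb zeta n) s * kpow n (-2))) with ((M * Rpower (kb zeta n) s) * (D * kpow n (-2))) by ring.
      apply Rmult_le_compat; auto; [apply pow2_ge_0|apply HA; auto|now apply one_coef_sq].
    + apply Rmult_le_pos; lra.
  - apply Rmult_le_pos; [apply Rmult_le_pos; lra|apply Rmult_le_pos; lra].
Qed.

Lemma symb_upper a nu lam zeta : 0 < a -> 0 < nu ->
  exists K, 0 <= K /\ forall n, Cmod (symb a nu lam zeta n) <= K * wbase nu zeta n.
Proof.
  intros Ha Hnu. set (t := PI ^ 2 / a ^ 2).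
  assert (Ht : 0 <= t) by (apply Rdiv_le_0_compat; [apply pow2_ge_0|apply pow_lt; auto]).
  exists (Cmod lam + 1 + t). split; [generalize (Cmod_ge_0 lam); lra|]. intros n.
  unfold symb, omega2. eapply Rle_trans; [apply Cmod_triangle|].
  assert (O := wbase_ge1 nu zeta n Hnu).
  assert (E1 : Cmod (lam + RtoC (nu * zabs zeta ^ 2)) <= Cmod lam + nu * zabs zeta ^ 2).
  { eapply Rle_trans; [apply Cmod_triangle|]. rewrite Cmod_R, Rabs_pos_eq; [lra|].
    apply Rmult_le_pos; [lra|apply pow2_ge_0]. }
  rewrite Cmod_R, Rabs_pos_eq; [|apply Rmult_le_pos; [lra|apply pow2_ge_0]].
  replace (nu * (kk n * PI / a) ^ 2) with (t * (nu * kk n ^ 2)) by (unfold t; field; lra).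
  assert (Z := Cmod_ge_0 lam). assert (A1 : 0 <= nu * kk n ^ 2) by (apply Rmult_le_pos; [lra|apply pow2_ge_0]).
  assert (A2 : 0 <= nu * zabs zeta ^ 2) by (apply Rmult_le_pos; [lra|apply pow2_ge_0]).
  unfold wbase in *. set (x := nu * kk n ^ 2) in *. set (y := nu * zabs zeta ^ 2) in *.
  assert (0 <= Cmod lam * (x + y)) by (apply Rmult_le_pos; lra). assert (0 <= t * (1 + y)) by (apply Rmult_le_pos; lra). nra.
Qed.

Lemma symb_l2le a nu s lam zeta : 0 < a -> 0 < nu -> exists K, 0 <= K /\ forall f B,
  l2le (wgt nu (s + 2) zeta) f B -> l2le (wgt nu s zeta) (fun n => (symb a nu lam zeta n * f n)%C) (K * B).
Proof.
  intros Ha Hnu. destruct (symb_upper a nu lam zeta Ha Hnu) as [K [HK H]]. exists K. split; auto.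
  intros f B. apply l2le_dom; auto. intros n. rewrite !wgt_wbase, Rpower_plus.
  assert (O := wbase_ge1 nu zeta n Hnu).
  replace (Rpower (wbase nu zeta n) 2) with (wbase nu zeta n ^ 2).
  2:{ replace 2 with (INR 2) by (simpl; ring). rewrite Rpower_pow; auto. lra. }
  replace (K ^ 2 * (Rpower (wbase nu zeta n) s * wbase nu zeta n ^ 2 * Cmod (f n) ^ 2)) with
    (Rpower (wbase nu zeta n) s * (K * wbase nu zeta n * Cmod (f n)) ^ 2) by ring.
  apply Rmult_le_compat_l; [left; auto|]. apply sq_le. split; [apply Cmod_ge_0|].
  rewrite Cmod_mult. apply Rmult_le_compat_r; auto. apply Cmod_ge_0.
Qed.

Lemma sqrt_sum2_le x y : 0 <= x -> 0 <= y -> sqrt (x ^ 2 + y ^ 2) <= x + y.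
Proof.
  intros Hx Hy. rewrite <- (sqrt_pow2 (x + y)); [|lra]. apply sqrt_le_1_alt. nra.
Qed.
Lemma sqrt_sum3_le x y z : 0 <= x -> 0 <= y -> 0 <= z -> sqrt (x ^ 2 + y ^ 2 + z ^ 2) <= x + y + z.
Proof.
  intros Hx Hy Hz. rewrite <- (sqrt_pow2 (x + y + z)); [|lra]. apply sqrt_le_1_alt.
  assert (0 <= x * y) by nra. assert (0 <= x * z) by nra. assert (0 <= y * z) by nra. nra.
Qed.
Lemma le_sqrt x t : x ^ 2 <= t -> x <= sqrt t.
Proof.
  intros H. apply sq_le_inv; [apply sqrt_pos|]. rewrite pow2_sqrt; auto. generalize (pow2_ge_0 x); lra.
Qed.

Lemma L_continuous a nu alpha beta gamma lam zeta s :
  0 < a -> 0 < nu -> -3 / 2 < s < 1 / 2 -> zeta <> (0%Z, 0%Z) ->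
  exists K : R, forall (u v : nat -> C) (p0 : C) (th : nat -> C),
         inHdiv a nu (s + 2) zeta u v -> inH nu (s + 2) zeta th ->
         inH nu s zeta (L1 a nu alpha beta lam zeta u v p0 th) /\
         inH nu s zeta (L2 a nu alpha beta lam zeta u v p0 th) /\
         inH nu s zeta (L3 a nu gamma lam zeta u v th) /\
         norm3 nu s zeta (L1 a nu alpha beta lam zeta u v p0 th)
                             (L2 a nu alpha beta lam zeta u v p0 th)
                             (L3 a nu gamma lam zeta u v th)
         <= K * sqrt (normH nu (s + 2) zeta u ^ 2 + normH nu (s + 2) zeta v ^ 2
                      + Cmod p0 ^ 2 + normH nu (s + 2) zeta th ^ 2).
Proof.
  intros Ha Hnu Hs Hz.
  destruct (coupling_reg a nu alpha beta gamma s s Ha Hnu) as [K1 [HK1 H1]]; try lra.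
  destruct (symb_l2le a nu s lam zeta Ha Hnu) as [K2 [HK2 H2]].
  destruct (one_coef_l2le a nu s zeta Ha Hnu ltac:(lra) Hz) as [Bc Hc].
  set (K := K2 + zabs zeta * Bc + K1 * (1 + zabs zeta)).
  exists (3 * K). intros u v p0 th [Hu [Hv _]] Hth.
  set (N := sqrt _).
  assert (Qu := pow2_ge_0 (normH nu (s + 2) zeta u)). assert (Qv := pow2_ge_0 (normH nu (s + 2) zeta v)).
  assert (Qt := pow2_ge_0 (normH nu (s + 2) zeta th)). assert (Qp := pow2_ge_0 (Cmod p0)).
  assert (HX : l2le3 (wgt nu (s + 2) zeta) (triple u v th) N).
  { apply l2le3_triple; (eapply l2le_weaken; [|apply l2le_of_inH; auto]); apply le_sqrt; lra. }
  assert (Hp : Cmod p0 <= N) by (apply le_sqrt; lra).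
  assert (HN : 0 <= N) by apply sqrt_pos.
  destruct (H1 zeta (triple u v th) N HX) as [_ HK].
  assert (HBc : 0 <= Bc) by apply Hc.
  assert (HL : forall i, (i < 3)%nat -> l2le (wgt nu s zeta) (fun n => (stokes a nu lam zeta (triple u v th) p0 i n + coupling a alpha beta gamma zeta (triple u v th) i n)%C) (K * N)).
  { intros i Hi. replace (K * N) with ((K2 * N + zabs zeta * N * Bc) + K1 * (1 + zabs zeta) * N) by (unfold K; ring).
    apply l2le_plus; auto. unfold stokes. apply l2le_plus; auto.
    eapply l2le_weaken; [|apply l2le_scal; exact Hc].
    rewrite !Cmod_mult, Cmod_Ci, Cmod_R, Rmult_1_l. apply Rmult_le_compat_r; auto.
    apply Rmult_le_compat; auto; [apply Rabs_pos|apply Cmod_ge_0|apply hfreq_le]. }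
  assert (F1 : l2le (wgt nu s zeta) (L1 a nu alpha beta lam zeta u v p0 th) (K * N)).
  { eapply l2le_ext; [|apply (HL 0%nat); lia]. intros n. symmetry. apply (L1_split a nu alpha beta gamma lam zeta (triple u v th) p0 n). }
  assert (F2 : l2le (wgt nu s zeta) (L2 a nu alpha beta lam zeta u v p0 th) (K * N)).
  { eapply l2le_ext; [|apply (HL 1%nat); lia]. intros n. symmetry. apply (L2_split a nu alpha beta gamma lam zeta (triple u v th) p0 n). }
  assert (F3 : l2le (wgt nu s zeta) (L3 a nu gamma lam zeta u v th) (K * N)).
  { eapply l2le_ext; [|apply (HL 2%nat); lia]. intros n. symmetry. apply (L3_split a nu alpha beta gamma lam zeta (triple u v th) p0 n). }
  split; [eapply inH_of_l2le; eauto|]. split; [eapply inH_of_l2le; eauto|]. split; [eapply inH_of_l2le; eauto|].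
  unfold norm3. eapply Rle_trans; [apply sqrt_sum3_le; apply normH_ge0|].
  apply normH_le in F1. apply normH_le in F2. apply normH_le in F3. lra.
Qed.

Lemma in_dom_triple a nu s zeta u v th : inHdiv a nu (s + 2) zeta u v -> inH nu (s + 2) zeta th ->
  in_dom a nu s zeta (triple u v th).
Proof.
  intros [Hu [Hv Hd]] Ht. split; [|exact Hd].
  exists (normH nu (s + 2) zeta u + normH nu (s + 2) zeta v + normH nu (s + 2) zeta th).
  assert (A := normH_ge0 nu (s + 2) zeta u). assert (B := normH_ge0 nu (s + 2) zeta v). assert (D := normH_ge0 nu (s + 2) zeta th).
  apply l2le3_triple; (eapply l2le_weaken; [|apply l2le_of_inH; auto]); lra.
Qed.

Theorem theorem3 :
  forall (a nu alpha beta gamma delta1 delta2 : R),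
    0 < a -> 0 < nu -> 0 < beta -> 0 < gamma -> 0 < delta1 ->
    (forall lam : C, inS delta1 delta2 lam -> ~ VP a nu alpha beta gamma lam) ->
    delta2 < Rmin (nu * PI ^ 2 / (2 * a ^ 2)) (nu / 2) ->
  forall sigma : R, -3/2 < sigma < 1/2 -> sigma <> -1/2 ->
  exists Cst : R,
  forall (lam : C) (zeta : Z * Z),
    inS delta1 delta2 lam -> zeta <> (0%Z, 0%Z) ->
    (* L is well defined and continuous (bounded) *)
    (exists K : R,
       forall (u v : nat -> C) (p0 : C) (th : nat -> C),
         inHdiv a nu (sigma + 2) zeta u v -> inH nu (sigma + 2) zeta th ->
         inH nu sigma zeta (L1 a nu alpha beta lam zeta u v p0 th) /\
         inH nu sigma zeta (L2 a nu alpha beta lam zeta u v p0 th) /\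
         inH nu sigma zeta (L3 a nu gamma lam zeta u v th) /\
         norm3 nu sigma zeta (L1 a nu alpha beta lam zeta u v p0 th)
                             (L2 a nu alpha beta lam zeta u v p0 th)
                             (L3 a nu gamma lam zeta u v th)
         <= K * sqrt (normH nu (sigma + 2) zeta u ^ 2 + normH nu (sigma + 2) zeta v ^ 2
                      + Cmod p0 ^ 2 + normH nu (sigma + 2) zeta th ^ 2)) /\
    (* L is bijective, with the estimates on the solution *)
    (forall F1 F2 F3 : nat -> C,
       inH nu sigma zeta F1 -> inH nu sigma zeta F2 -> inH nu sigma zeta F3 ->
       exists (u v : nat -> C) (p0 : C) (th : nat -> C),
         inHdiv a nu (sigma + 2) zeta u v /\ inH nu (sigma + 2) zeta th /\
         (forall n, L1 a nu alpha beta lam zeta u v p0 th n = F1 n) /\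
         (forall n, L2 a nu alpha beta lam zeta u v p0 th n = F2 n) /\
         (forall n, L3 a nu gamma lam zeta u v th n = F3 n) /\
         (forall (u' v' : nat -> C) (p0' : C) (th' : nat -> C),
            inHdiv a nu (sigma + 2) zeta u' v' -> inH nu (sigma + 2) zeta th' ->
            (forall n, L1 a nu alpha beta lam zeta u' v' p0' th' n = F1 n) ->
            (forall n, L2 a nu alpha beta lam zeta u' v' p0' th' n = F2 n) ->
            (forall n, L3 a nu gamma lam zeta u' v' th' n = F3 n) ->
            u' = u /\ v' = v /\ p0' = p0 /\ th' = th) /\
         let nF := norm3 nu sigma zeta F1 F2 F3 in
         let w2 := bomega2 lam zeta in
         (* (a) *)
         zabs zeta * Cmod p0 <= Cst * w2 * Ms sigma lam zeta * nF /\
         (exists u1 v1 u2 v2 : nat -> C,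
            inH nu (sigma + 2) zeta u1 /\ inH nu (sigma + 2) zeta v1 /\
            inH nu (sigma + 2) zeta u2 /\ inH nu (sigma + 2) zeta v2 /\
            (forall n, u n = (u1 n + u2 n)%C) /\ (forall n, v n = (v1 n + v2 n)%C) /\
            (* (b) *)
            Ms (- sigma - 2) lam zeta / Ms (- sigma) lam zeta * norm2 nu sigma zeta u1 v1
              + norm2 nu (sigma + 2) zeta u1 v1
              <= Cst * w2 * Ms sigma lam zeta * Ms (- sigma - 2) lam zeta * nF /\
            (* (c) *)
            w2 * norm2 nu sigma zeta u2 v2 + norm2 nu (sigma + 2) zeta u2 v2
              <= Cst * nF) /\
         (* (d) *)
         w2 * normH nu sigma zeta th + normH nu (sigma + 2) zeta th <= Cst * nF).
Proof.
  intros a nu alpha beta gamma delta1 delta2 Ha Hnu _ Hga Hd1 HVP Hd2 s Hs _.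
  destruct (symb_lower a nu delta1 delta2 Ha Hnu Hd1 Hd2) as [c [Hc Hsy]].
  destruct (psum_lower a nu delta1 delta2 Ha Hnu Hd1 Hd2) as [ck [Hck Hkap]].
  assert (HSec : forall lam zeta, inS delta1 delta2 lam -> zeta <> (0%Z, 0%Z) -> symb_bounds a nu c ck lam zeta).
  { intros lam zeta Hin Hz. split; [auto|split; [auto|split; [auto|split; auto]]].
    intros n. now apply Hsy. }
  destruct (solvable_uniform a nu alpha beta gamma delta1 delta2 c ck s Ha Hnu Hga Hs Hd1 HSec HVP) as [K0 HK0].
  (* The sign of K0 is not known. *)
  set (K := Rmax K0 1). assert (HK : 1 <= K) by apply Rmax_r.
  destruct (pressure_estimate a nu c ck s Ha Hnu ltac:(lra)) as [Kp [HKp Hp]].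
  destruct (div_symb_l2le a nu c ck s Hnu) as [Kd [HKd Hd]].
  destruct (pmode_l2le a nu c ck s Ha Hnu ltac:(lra)) as [Kb [HKb Hb]].
  destruct (pmode_l2le a nu c ck (s + 2) Ha Hnu ltac:(lra)) as [Kb2 [HKb2 Hb2]].
  (* Ca serves (a), Cb serves (b), Cd serves (c) and (d). The 2 in Cb counts the components of Y1;
     the 4 in Cd counts the two components of Y2 in the two norms. *)
  set (Ca := Kp * K). set (Cb := 2 * (Kb + Kb2) * Ca). set (Cd := 4 * Kd * K).
  assert (HCa : 0 < Ca) by (apply Rmult_lt_0_compat; lra).
  assert (HCb : 0 < Cb) by (unfold Cb; apply Rmult_lt_0_compat; lra).
  assert (HCd : 0 < Cd) by (unfold Cd; apply Rmult_lt_0_compat; lra).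
  exists (Ca + Cb + Cd). intros lam zeta Hin Hz.
  specialize (HSec lam zeta Hin Hz). specialize (HVP lam Hin). specialize (HK0 lam zeta Hin Hz).
  apply (solvable_mono _ _ _ _ _ _ _ _ K0 K (Rmax_l _ _)) in HK0.
  split; [now apply L_continuous|].
  intros F1 F2 F3 HF1 HF2 HF3.
  set (nF := norm3 nu s zeta F1 F2 F3).
  assert (HnF : 0 <= nF) by apply sqrt_pos.
  assert (HF : l2le3 (wgt nu s zeta) (triple F1 F2 F3) nF).
  { assert (Q1 := pow2_ge_0 (normH nu s zeta F1)). assert (Q2 := pow2_ge_0 (normH nu s zeta F2)). assert (Q3 := pow2_ge_0 (normH nu s zeta F3)).
    apply l2le3_triple; (eapply l2le_weaken; [|apply l2le_of_inH; auto]); apply le_sqrt; lra. }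
  destruct (HK0 _ _ HF) as [X [p0 [HX [HA HE]]]].
  exists (X 0%nat), (X 1%nat), p0, (X 2%nat).
  assert (HXi : forall i, (i < 3)%nat -> inH nu (s + 2) zeta (X i)).
  { intros i Hi. destruct HX as [[B HB] _]. eapply inH_of_l2le, HB; auto. }
  split. { split; [apply HXi; lia|split; [apply HXi; lia|apply HX]]. }
  split. { apply HXi; lia. }
  split. { intros n. rewrite (L1_split a nu alpha beta gamma lam zeta X p0 n). apply (HE 0%nat); lia. }
  split. { intros n. rewrite (L2_split a nu alpha beta gamma lam zeta X p0 n). apply (HE 1%nat); lia. }
  split. { intros n. rewrite (L3_split a nu alpha beta gamma lam zeta X p0 n). apply (HE 2%nat); lia. }
  split.
  { intros u' v' p0' th' Huv' Hth' E1 E2 E3.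
    assert (HX' := in_dom_triple a nu s zeta u' v' th' Huv' Hth').
    destruct (solution_unique a nu alpha beta gamma c ck s lam zeta (triple u' v' th') X p0' p0 Ha Hnu Hga Hs HSec HVP HX' HX) as [U1 U2].
    - intros i n Hi. rewrite HE; auto. destruct i as [|[|[|i]]]; [| | |lia].
      + rewrite <- (L1_split a nu alpha beta gamma lam zeta (triple u' v' th') p0' n). apply E1.
      + rewrite <- (L2_split a nu alpha beta gamma lam zeta (triple u' v' th') p0' n). apply E2.
      + rewrite <- (L3_split a nu alpha beta gamma lam zeta (triple u' v' th') p0' n). apply E3.
    - split; [|split; [|split; auto]]; apply functional_extensionality; intros n.
      + apply (U1 0%nat n); lia.
      + apply (U1 1%nat n); lia.
      + apply (U1 2%nat n); lia. }
  intros nF' w2.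
  assert (HP := Hp lam zeta X p0 _ _ HSec HX HA (fun i n _ => eq_refl)).
  assert (HM := Ms_ge0 s lam zeta). assert (HM2 := Ms_ge0 (- s - 2) lam zeta).
  assert (HM1 : 0 < Ms (- s) lam zeta) by (apply Ms_pos; auto; lra).
  destruct (bomega2_bounds lam zeta Hz) as [Z1 [_ [_ [Z4 [Z5 [_ Z7]]]]]].
  assert (Hw : 0 < w2) by (unfold w2; lra).
  (* Y1 is a multiple of the pressure profile and Y2 the diagonal part. No coupling appears: it is
     contained in [stokes] X p0, already bounded by K times the norm of F. *)
  set (Y1 := fun i n => (- (Ci * RtoC (hfreq zeta i) * p0) * pmode a nu lam zeta n)%C).
  set (Y2 := fun i n => (stokes a nu lam zeta X p0 i n / symb a nu lam zeta n)%C).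
  assert (HY : forall i n, X i n = (Y1 i n + Y2 i n)%C) by (intros i n; eapply stokes_split; eauto).
  assert (Hpz : zabs zeta * Cmod p0 <= Ca * w2 * Ms s lam zeta * nF).
  { eapply Rle_trans; [exact HP|]. right. unfold Ca, w2. ring. }
  assert (HT : 0 <= w2 * Ms s lam zeta * nF) by (repeat apply Rmult_le_pos; lra).
  assert (HT2 : 0 <= w2 * Ms s lam zeta * Ms (- s - 2) lam zeta * nF) by (repeat apply Rmult_le_pos; lra).
  assert (HY1 : forall r D i, l2le (wgt nu r zeta) (pmode a nu lam zeta) D -> l2le (wgt nu r zeta) (Y1 i) (zabs zeta * Cmod p0 * D)).
  { intros r D i HD. unfold Y1. eapply l2le_weaken; [|apply l2le_scal; exact HD].
    rewrite Cmod_opp, !Cmod_mult, Cmod_Ci, Cmod_R, Rmult_1_l. apply Rmult_le_compat_r; [apply HD|].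
    apply Rmult_le_compat_r; [apply Cmod_ge_0|apply hfreq_le]. }
  assert (A1 := fun i => HY1 _ _ i (Hb lam zeta HSec)). assert (A2 := fun i => HY1 _ _ i (Hb2 lam zeta HSec)).
  replace (- (s + 2)) with (- s - 2) in A2 by ring.
  assert (B12 : forall i, (i < 3)%nat -> l2le (wgt nu s zeta) (Y2 i) (Kd * (K * nF) / w2) /\ l2le (wgt nu (s + 2) zeta) (Y2 i) (Kd * (K * nF))).
  { intros i Hi. apply Hd; auto. }
  assert (Bw : w2 * (Kd * (K * nF) / w2) = Kd * K * nF) by (field; lra).
  split; [|split].
  - eapply Rle_trans; [exact Hpz|]. fold nF in nF'. unfold nF'. nra.
  - exists (Y1 0%nat), (Y1 1%nat), (Y2 0%nat), (Y2 1%nat).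
    split; [eapply inH_of_l2le, A2|]. split; [eapply inH_of_l2le, A2|].
    split; [eapply inH_of_l2le, B12; lia|]. split; [eapply inH_of_l2le, B12; lia|].
    split; [auto|]. split; [auto|]. split.
    + assert (N1 : norm2 nu s zeta (Y1 0%nat) (Y1 1%nat) <= 2 * (zabs zeta * Cmod p0 * (Kb * Ms (- s) lam zeta))).
      { unfold norm2. eapply Rle_trans; [apply sqrt_sum2_le; apply normH_ge0|].
        generalize (normH_le _ _ _ _ _ (A1 0%nat)) (normH_le _ _ _ _ _ (A1 1%nat)). lra. }
      assert (N2 : norm2 nu (s + 2) zeta (Y1 0%nat) (Y1 1%nat) <= 2 * (zabs zeta * Cmod p0 * (Kb2 * Ms (- s - 2) lam zeta))).
      { unfold norm2. eapply Rle_trans; [apply sqrt_sum2_le; apply normH_ge0|].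
        generalize (normH_le _ _ _ _ _ (A2 0%nat)) (normH_le _ _ _ _ _ (A2 1%nat)). lra. }
      (* The norms of Y1 in H^s and H^(s+2) are |zeta| |p0| times M_(-s) and M_(-s-2). The quotient
         in (b) turns the first into the second, and (a) bounds |zeta| |p0|. *)
      apply Rle_trans with (Ms (- s - 2) lam zeta / Ms (- s) lam zeta * (2 * (zabs zeta * Cmod p0 * (Kb * Ms (- s) lam zeta))) + 2 * (zabs zeta * Cmod p0 * (Kb2 * Ms (- s - 2) lam zeta))).
      { apply Rplus_le_compat; auto. apply Rmult_le_compat_l; auto. apply Rdiv_le_0_compat; auto. }
      replace (Ms (- s - 2) lam zeta / Ms (- s) lam zeta * (2 * (zabs zeta * Cmod p0 * (Kb * Ms (- s) lam zeta))) + 2 * (zabs zeta * Cmod p0 * (Kb2 * Ms (- s - 2) lam zeta)))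
        with (2 * (Kb + Kb2) * Ms (- s - 2) lam zeta * (zabs zeta * Cmod p0)) by (field; lra).
      apply Rle_trans with (2 * (Kb + Kb2) * Ms (- s - 2) lam zeta * (Ca * w2 * Ms s lam zeta * nF)).
      { apply Rmult_le_compat_l; auto. apply Rmult_le_pos; lra. }
      replace (2 * (Kb + Kb2) * Ms (- s - 2) lam zeta * (Ca * w2 * Ms s lam zeta * nF)) with
        (Cb * (w2 * Ms s lam zeta * Ms (- s - 2) lam zeta * nF)) by (unfold Cb; ring).
      replace ((Ca + Cb + Cd) * w2 * Ms s lam zeta * Ms (- s - 2) lam zeta * nF') with
        ((Ca + Cb + Cd) * (w2 * Ms s lam zeta * Ms (- s - 2) lam zeta * nF)) by (unfold nF', nF; ring).
      apply Rmult_le_compat_r; lra.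
    + destruct (B12 0%nat ltac:(lia)) as [P1 P2]. destruct (B12 1%nat ltac:(lia)) as [P3 P4].
      apply normH_le in P1, P2, P3, P4.
      assert (N1 : norm2 nu s zeta (Y2 0%nat) (Y2 1%nat) <= 2 * (Kd * (K * nF) / w2)).
      { unfold norm2. eapply Rle_trans; [apply sqrt_sum2_le; apply normH_ge0|]. lra. }
      assert (N2 : norm2 nu (s + 2) zeta (Y2 0%nat) (Y2 1%nat) <= 2 * (Kd * (K * nF))).
      { unfold norm2. eapply Rle_trans; [apply sqrt_sum2_le; apply normH_ge0|]. lra. }
      apply Rmult_le_compat_l with (r := w2) in N1; [|lra].
      assert (0 <= (Ca + Cb) * nF) by (apply Rmult_le_pos; lra).
      change nF' with nF. unfold Cd. lra.
  (* [hfreq] vanishes at index 2, so theta has no pressure part and equals its Y2 component. *)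
  - assert (E : forall n, Y2 2%nat n = X 2%nat n) by (intros n; rewrite HY; unfold Y1, hfreq; ring).
    destruct (B12 2%nat ltac:(lia)) as [P1 P2].
    apply (l2le_ext _ _ _ _ E), normH_le in P1. apply (l2le_ext _ _ _ _ E), normH_le in P2.
    apply Rmult_le_compat_l with (r := w2) in P1; [|lra].
    assert (0 <= (Ca + Cb) * nF) by (apply Rmult_le_pos; lra).
    assert (0 <= Kd * K * nF) by (repeat apply Rmult_le_pos; lra).
    change nF' with nF. unfold Cd. lra.
Qed.
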